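(* Let $\mathbf r=(r_1,r_2)$ with $r_1,r_2>0$, $r_1+r_2=1$. (i) If $\mathcal L\subset\mathbb R^2$ is a line containing a point which is badly approximable w.r.t. weights $\mathbf r$, then almost every $\mathbf v\in\mathcal L$ (w.r.t. length measure on $\mathcal L$) admits no improvement in Dirichlet's theorem w.r.t. weights $\mathbf r$. (ii) If $\varphi:[0,1]\to\mathbb R^2$ is a nondegenerate curve, then for Lebesgue-almost every $s\in[0,1]$, $\varphi(s)$ admits no improvement in Dirichlet's theorem w.r.t. weights $\mathbf r$.
   Context: $\mathbf v=(v_1,v_2)\in\mathbb R^2$ is badly approximable w.r.t. weights $\mathbf r$ if there is $c>0$ such that for all $q\in\mathbb N$, $\mathbf p=(p_1,p_2)\in\mathbb Z^2$ and $i=1,2$: $|qv_i-p_i|^{1/r_i}\ge c/q$. $\mathbf v$ admits no improvement in Dirichlet's theorem w.r.t. weights $\mathbf r$ if there is no $\sigma\in(0,1)$ such that for all sufficiently large $Q$ there exist $q\in\mathbb N$, $\mathbf p\in\mathbb Z^2$ with $|qv_i-p_i|<\sigma Q^{-r_i}$ for $i=1,2$ and $q<\sigma Q$. A map $\varphi:[0,1]\to\mathbb R^2$ is nondegenerate if it is twice continuously differentiable and for almost every $s$ the vectors $\varphi'(s),\varphi''(s)$ are linearly independent. *)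

(* Defs.v *)
From Stdlib Require Import Reals Lra ZArith.
Open Scope R_scope.

(* x^y for x >= 0, y > 0, with the convention 0^y = 0 (Rpower is only
   meaningful for positive bases). *)
Definition rpow (x y : R) : R := if Rle_dec x 0 then 0 else Rpower x y.

Definition dev (q : nat) (v : R) (p : Z) : R := Rabs (INR q * v - IZR p).

Definition badly_approximable (r1 r2 : R) (v : R * R) : Prop :=
  exists c : R, 0 < c /\
    forall (q : nat) (p1 p2 : Z), (1 <= q)%nat ->
      Rmax (rpow (dev q (fst v) p1) (1 / r1))
           (rpow (dev q (snd v) p2) (1 / r2)) >= c / INR q.

Definition DI_improvable (r1 r2 : R) (v : R * R) : Prop :=
  exists sigma : R, 0 < sigma < 1 /\
    exists Q0 : R, forall Q : R, Q0 <= Q ->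
      exists (q : nat) (p1 p2 : Z), (1 <= q)%nat /\
        dev q (fst v) p1 < sigma * Rpower Q (- r1) /\
        dev q (snd v) p2 < sigma * Rpower Q (- r2) /\
        INR q < sigma * Q.

Definition no_DI_improvement (r1 r2 : R) (v : R * R) : Prop :=
  ~ DI_improvable r1 r2 v.

Definition null_set (E : R -> Prop) : Prop :=
  forall eps : R, 0 < eps ->
    exists a b : nat -> R,
      (forall n, a n <= b n) /\
      (forall x, E x -> exists n, a n < x < b n) /\
      (forall N, sum_f_R0 (fun n => b n - a n) N <= eps).

Definition in01 (s : R) : Prop := 0 <= s <= 1.

Definition deriv01 (f : R -> R) (s l : R) : Prop :=
  forall eps, 0 < eps -> exists delta, 0 < delta /\
    forall x, in01 x -> 0 < Rabs (x - s) < delta ->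
      Rabs ((f x - f s) / (x - s) - l) < eps.

Definition cont01 (f : R -> R) (s : R) : Prop :=
  forall eps, 0 < eps -> exists delta, 0 < delta /\
    forall x, in01 x -> Rabs (x - s) < delta -> Rabs (f x - f s) < eps.

Definition C2_01 (f f1 f2 : R -> R) : Prop :=
  forall s, in01 s -> deriv01 f s (f1 s) /\ deriv01 f1 s (f2 s) /\ cont01 f2 s.

Definition lin_indep2 (u w : R * R) : Prop :=
  forall a b : R, a * fst u + b * fst w = 0 -> a * snd u + b * snd w = 0 ->
    a = 0 /\ b = 0.

(* phi : [0,1] -> R^2 (values outside [0,1] irrelevant) is nondegenerate:
   C^2 and phi'(s), phi''(s) linearly independent for a.e. s in [0,1]. *)
Definition nondegenerate (phi : R -> R * R) : Prop :=
  exists d1x d2x d1y d2y : R -> R,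
    C2_01 (fun s => fst (phi s)) d1x d2x /\
    C2_01 (fun s => snd (phi s)) d1y d2y /\
    null_set (fun s => in01 s /\
      ~ lin_indep2 (d1x s, d1y s) (d2x s, d2y s)).

(* Main.v *)
(* Expand the lattice attached to a point of the curve by the flow diag(Q^r1, Q^r2, 1/Q). An
   improvement at Q means that a short integer point lies in a cube of side slightly less
   than 2, so it suffices to show that for almost every point the flow comes back near a
   critical lattice of the cube; critical lattices may be chosen to contain e_2 and to have
   e_3 in their dual, and being close to one is witnessed by an integer line w and an integer
   point v on it.

   A small interval of the curve around s is expanded to a piece of a unipotent orbit. If the
   lattice of s at time Q, and at boundedly many nearby times, has no short vector (true off
   a set of small measure, by nondivergence), then the pigeonhole principle yields v with a
   small nonzero invariant coordinate y, and then w orthogonal to v, such that moving s by a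
   bounded amount along the orbit and flowing for the time that makes |y| = 1 brings (w, v)
   close to (e_3, e_2). So near almost every point, at arbitrarily small scales, a fixed
   proportion of the curve is not improved at some large time, and a covering argument makes
   the improvable set null. For lines, nondivergence on a whole interval comes from the badly
   approximable point; for curves, from the nonvanishing Wronskian. *)
Require Import Defs.
From Stdlib Require Import Reals ZArith Lra Psatz ClassicalEpsilon List Cantor.
Open Scope R_scope.

(** No equidistribution theorem enters; every step is quantitative. Compactness in the space of
    lattices is replaced by a lower bound [eta] for all vectors and dual vectors at five fixed
    multiples of the time Q: each degenerate position of v or w would give a shorter vector at one
    of these times, so all bounds depend on [eta] and not on Q. The delicate quantity is the
    invariant coordinate y. It must be small for the pigeonhole to give w, but bounded below, since
    otherwise the exit time is unbounded and the error of the approximation by a unipotent orbit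
    gets out of control; a second, independent v is produced when the first one has y too small. The
    two coordinates of the curve are expanded at different rates, so the orbit follows the faster
    one; after an exchange of coordinates this is the first, and only for equal weights can a shear
    remain. To deny improvement, one time beyond each bound suffices, so the argument ends in
    porosity at arbitrarily small scales, where the exceptional set may change with the scale and is
    measured by finite interval covers only. *)

(** * Integer vectors in rank three: pairing, cross product, primitivity *)

Definition Z3 : Type := (Z * Z * Z)%type.

Definition zdot (u v : Z3) : Z :=
  let '(a, b, c) := u in let '(x, y, z) := v in (a * x + b * y + c * z)%Z.

Definition zcross (u v : Z3) : Z3 :=
  let '(a, b, c) := u in let '(x, y, z) := v in
  (b * z - c * y, c * x - a * z, a * y - b * x)%Z.

Definition zscal (k : Z) (u : Z3) : Z3 :=
  let '(a, b, c) := u in (k * a, k * b, k * c)%Z.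

Definition zzero : Z3 := (0, 0, 0)%Z.

(* Bezout form of [gcd = 1]. *)
Definition zprimitive (u : Z3) : Prop := exists e, zdot e u = 1%Z.

(** The Bezout vector [e] of [w] turns a rational ratio into the integer [k = zdot e u]: each
    coordinate of [u] is multiplied by [zdot e w = 1] and rewritten with the vanishing minors. *)
Lemma zcross_primitive_0 (u w : Z3) :
  zprimitive w -> zcross u w = zzero -> exists k, u = zscal k w.
Proof.
  destruct u as [[u1 u2] u3], w as [[w1 w2] w3].
  intros [[[e1 e2] e3] He] H; unfold zzero in H; simpl in *.
  injection H as H1 H2 H3.
  exists (e1 * u1 + e2 * u2 + e3 * u3)%Z.
  assert (A1 : (u1 = u1 * (e1 * w1 + e2 * w2 + e3 * w3))%Z) by (rewrite He; lia).
  assert (A2 : (u2 = u2 * (e1 * w1 + e2 * w2 + e3 * w3))%Z) by (rewrite He; lia).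
  assert (A3 : (u3 = u3 * (e1 * w1 + e2 * w2 + e3 * w3))%Z) by (rewrite He; lia).
  assert (B1 : (u2 * w3 = u3 * w2)%Z) by lia.
  assert (B2 : (u3 * w1 = u1 * w3)%Z) by lia.
  assert (B3 : (u1 * w2 = u2 * w1)%Z) by lia.
  f_equal; [f_equal|].
  - rewrite A1 at 1.
    replace (u1 * (e1 * w1 + e2 * w2 + e3 * w3))%Z
      with (e1 * u1 * w1 + e2 * (u1 * w2) + e3 * (u1 * w3))%Z by ring.
    rewrite B3, <- B2. ring.
  - rewrite A2 at 1.
    replace (u2 * (e1 * w1 + e2 * w2 + e3 * w3))%Z
      with (e1 * (u2 * w1) + e2 * u2 * w2 + e3 * (u2 * w3))%Z by ring.
    rewrite <- B3, B1. ring.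
  - rewrite A3 at 1.
    replace (u3 * (e1 * w1 + e2 * w2 + e3 * w3))%Z
      with (e1 * (u3 * w1) + e2 * (u3 * w2) + e3 * u3 * w3)%Z by ring.
    rewrite B2, <- B1. ring.
Qed.

Lemma zcross_zcross_0 (u v w : Z3) :
  zdot w u = 0%Z -> zdot w v = 0%Z -> zcross (zcross u v) w = zzero.
Proof.
  destruct u as [[u1 u2] u3], v as [[v1 v2] v3], w as [[w1 w2] w3].
  unfold zzero; simpl; intros Hu Hv.
  f_equal; [f_equal|].
  - transitivity (v1 * (w1 * u1 + w2 * u2 + w3 * u3) - u1 * (w1 * v1 + w2 * v2 + w3 * v3))%Z;
      [ring | rewrite Hu, Hv; ring].
  - transitivity (v2 * (w1 * u1 + w2 * u2 + w3 * u3) - u2 * (w1 * v1 + w2 * v2 + w3 * v3))%Z;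
      [ring | rewrite Hu, Hv; ring].
  - transitivity (v3 * (w1 * u1 + w2 * u2 + w3 * u3) - u3 * (w1 * v1 + w2 * v2 + w3 * v3))%Z;
      [ring | rewrite Hu, Hv; ring].
Qed.

Lemma zdot_comm (u v : Z3) : zdot u v = zdot v u.
Proof. destruct u as [[? ?] ?], v as [[? ?] ?]; simpl; ring. Qed.

Lemma zdot_zcross_l (u v : Z3) : zdot u (zcross u v) = 0%Z.
Proof. destruct u as [[? ?] ?], v as [[? ?] ?]; simpl; ring. Qed.

Lemma zdot_zscal_r (k : Z) (u v : Z3) : zdot u (zscal k v) = (k * zdot u v)%Z.
Proof. destruct u as [[? ?] ?], v as [[? ?] ?]; simpl; ring. Qed.

Lemma zscal_0_l (u : Z3) : zscal 0 u = zzero.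
Proof. destruct u as [[? ?] ?]; reflexivity. Qed.

Lemma zscal_eq_0 (k : Z) (u : Z3) : zscal k u = zzero -> k = 0%Z \/ u = zzero.
Proof.
  destruct u as [[a b] c]. unfold zzero; simpl; intros H. injection H as H1 H2 H3.
  destruct (Z.eq_dec k 0) as [?|Hk]; [tauto|right].
  f_equal; [f_equal|]; apply Z.mul_reg_l with k; try exact Hk; lia.
Qed.

Lemma zcross_zscal_l (k : Z) (u v : Z3) : zcross (zscal k u) v = zscal k (zcross u v).
Proof. destruct u as [[? ?] ?], v as [[? ?] ?]; simpl; f_equal; [f_equal|]; ring. Qed.

Lemma zcross_comm_0 (u v : Z3) : zcross u v = zzero -> zcross v u = zzero.
Proof.
  destruct u as [[? ?] ?], v as [[? ?] ?]. unfold zzero; simpl; intros H.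
  injection H as H1 H2 H3. f_equal; [f_equal|]; lia.
Qed.

(** The normals of a plane have rank one. If [t] and [t'] were independent, their cross product
    would be a nonzero multiple of [u] that is parallel to [v], against the independence of [u] and
    [v]. *)
Lemma common_normal (u v t t' : Z3) :
  zprimitive u -> zprimitive t' -> zcross u v <> zzero ->
  zdot u t = 0%Z -> zdot v t = 0%Z -> zdot u t' = 0%Z -> zdot v t' = 0%Z ->
  exists k, t = zscal k t'.
Proof.
  intros Hu Ht' Huv H1 H2 H3 H4. apply zcross_primitive_0; [exact Ht'|].
  destruct (zcross_primitive_0 (zcross t t') u Hu) as [k Hk];
    [apply zcross_zcross_0; assumption|].
  assert (Hv : zcross (zcross t t') v = zzero) by (apply zcross_zcross_0; assumption).
  rewrite Hk, zcross_zscal_l in Hv. apply zscal_eq_0 in Hv.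
  destruct Hv as [->|Hv]; [rewrite Hk; apply zscal_0_l|contradiction].
Qed.

Lemma primitive_neq_0 (u : Z3) : zprimitive u -> u <> zzero.
Proof.
  intros [[[e1 e2] e3] He] ->. unfold zzero in He; simpl in He. lia.
Qed.

Lemma primitive_factor (u : Z3) :
  u <> zzero -> exists k v, zprimitive v /\ u = zscal k v /\ (1 <= k)%Z.
Proof.
  destruct u as [[a b] c]. intros Hu.
  destruct (Z.gcd_bezout a b (Z.gcd a b) eq_refl) as [x [y Hxy]].
  destruct (Z.gcd_bezout (Z.gcd a b) c (Z.gcd (Z.gcd a b) c) eq_refl) as [x' [y' Hxy']].
  set (g := Z.gcd (Z.gcd a b) c) in *.
  assert (Hg0 : (0 <= g)%Z) by apply Z.gcd_nonneg.
  assert (Hgab : (g | Z.gcd a b)%Z) by apply Z.gcd_divide_l.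
  assert (Hgc : (g | c)%Z) by apply Z.gcd_divide_r.
  assert (Hga : (g | a)%Z) by (eapply Z.divide_trans; [apply Hgab | apply Z.gcd_divide_l]).
  assert (Hgb : (g | b)%Z) by (eapply Z.divide_trans; [apply Hgab | apply Z.gcd_divide_r]).
  destruct Hga as [a1 Ha], Hgb as [b1 Hb], Hgc as [c1 Hc].
  assert (Hg : (g <> 0)%Z).
  { intros E. apply Hu. unfold zzero. rewrite Ha, Hb, Hc, E, !Z.mul_0_r. reflexivity. }
  exists g, (a1, b1, c1). split; [|split; [|lia]].
  - exists (x' * x, x' * y, y')%Z. simpl.
    apply Z.mul_reg_l with g; [exact Hg|].
    rewrite Z.mul_1_r.
    transitivity (x' * (x * a + y * b) + y' * c)%Z.
    + rewrite Ha, Hb, Hc. ring.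
    + rewrite Hxy. exact Hxy'.
  - simpl. f_equal; [f_equal|]; lia.
Qed.

(** * Norms on integer vectors *)

(* For P1 = Q^r1 and P2 = Q^r2 (so P1 * P2 = Q), [vnorm] and [wnorm] are the sup norms, in
   the expanded lattice at (alpha, beta) and in its dual, of the integer point
   v = (p1, p2, q) and of the integer line w = (A, B, C), i.e. A x + B y + C = 0. *)
Definition vnorm (P1 P2 al be : R) (v : Z3) : R :=
  let '(p1, p2, q) := v in
  Rmax (Rmax (Rabs (P1 * (IZR q * al - IZR p1))) (Rabs (P2 * (IZR q * be - IZR p2))))
       (Rabs (IZR q / (P1 * P2))).

Definition wnorm (P1 P2 al be : R) (w : Z3) : R :=
  let '(A, B, C) := w in
  Rmax (Rmax (Rabs (IZR A / P1)) (Rabs (IZR B / P2)))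
       (Rabs (P1 * P2 * (IZR A * al + IZR B * be + IZR C))).

Lemma Rmax3_bounds (a b c : R) :
  a <= Rmax (Rmax a b) c /\ b <= Rmax (Rmax a b) c /\ c <= Rmax (Rmax a b) c.
Proof.
  pose proof (Rmax_l (Rmax a b) c). pose proof (Rmax_r (Rmax a b) c).
  pose proof (Rmax_l a b). pose proof (Rmax_r a b). lra.
Qed.

Lemma Rmax3_lub (a b c m : R) : a <= m -> b <= m -> c <= m -> Rmax (Rmax a b) c <= m.
Proof. intros. repeat apply Rmax_lub; assumption. Qed.

Lemma Rmax3_lub_lt (a b c m : R) : a < m -> b < m -> c < m -> Rmax (Rmax a b) c < m.
Proof. intros. repeat apply Rmax_lub_lt; assumption. Qed.

Lemma Rabs_le_bounds (x y : R) : Rabs x <= y -> - y <= x <= y.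
Proof. intros H. unfold Rabs in H. destruct (Rcase_abs x); lra. Qed.

Lemma Rabs_minus_le (a b : R) : Rabs (a - b) <= Rabs a + Rabs b.
Proof. unfold Rminus. rewrite <- (Rabs_Ropp b). apply Rabs_triang. Qed.

Lemma Rabs_mult_le (a b m n : R) : Rabs a <= m -> Rabs b <= n -> Rabs (a * b) <= m * n.
Proof. intros. rewrite Rabs_mult. apply Rmult_le_compat; auto using Rabs_pos. Qed.

Lemma Rdiv_mult_cancel (x y : R) : 0 < y -> x / y * y = x.
Proof. intros. field. lra. Qed.

Lemma Rinv_nonneg (x : R) : 0 < x -> 0 <= / x.
Proof. intros. left. apply Rinv_0_lt_compat. assumption. Qed.

Lemma Rdiv_nonneg (x y : R) : 0 <= x -> 0 < y -> 0 <= x / y.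
Proof. intros. apply Rmult_le_pos; auto using Rinv_nonneg. Qed.

Lemma Rabs_IZR_ge_1 (n : Z) : n <> 0%Z -> 1 <= Rabs (IZR n).
Proof. intros. rewrite <- abs_IZR. apply IZR_le. lia. Qed.

Lemma Rabs_det_le (a b c d m n : R) :
  Rabs a <= m -> Rabs b <= m -> Rabs c <= n -> Rabs d <= n ->
  Rabs (a * d - b * c) <= 2 * m * n.
Proof.
  intros Ha Hb Hc Hd.
  assert (Rabs (a * d) <= m * n)
    by (apply Rabs_mult_le; assumption).
  assert (Rabs (b * c) <= m * n)
    by (apply Rabs_mult_le; assumption).
  eapply Rle_trans; [apply Rabs_minus_le|]. lra.
Qed.

Lemma vnorm_zscal (P1 P2 al be : R) (k : Z) (v : Z3) :
  vnorm P1 P2 al be (zscal k v) = Rabs (IZR k) * vnorm P1 P2 al be v.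
Proof.
  destruct v as [[p1 p2] q]; simpl.
  rewrite !mult_IZR, <- !RmaxRmult by apply Rabs_pos.
  rewrite <- !Rabs_mult. unfold Rdiv.
  f_equal; [f_equal|]; f_equal; ring.
Qed.

Lemma wnorm_zscal (P1 P2 al be : R) (k : Z) (w : Z3) :
  wnorm P1 P2 al be (zscal k w) = Rabs (IZR k) * wnorm P1 P2 al be w.
Proof.
  destruct w as [[p1 p2] q]; simpl.
  rewrite !mult_IZR, <- !RmaxRmult by apply Rabs_pos.
  rewrite <- !Rabs_mult. unfold Rdiv.
  f_equal; [f_equal|]; f_equal; ring.
Qed.

(** The expanded coordinates are dual up to sign, so the integer [zdot w v] is [c z - a x - b y]:
    three products, each at most the product of the two norms, while a nonzero integer is at least 1
    in absolute value. *)
Lemma norm_pairing (P1 P2 al be : R) (w v : Z3) :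
  0 < P1 -> 0 < P2 -> zdot w v <> 0%Z ->
  1 <= 3 * (wnorm P1 P2 al be w * vnorm P1 P2 al be v).
Proof.
  intros H1 H2. destruct w as [[A B] C], v as [[p1 p2] q].
  intros Hd. simpl in Hd.
  assert (Hz : 1 <= Rabs (IZR (A * p1 + B * p2 + C * q))).
  { apply Rabs_IZR_ge_1; lia. }
  unfold wnorm, vnorm.
  set (a := IZR A / P1). set (b := IZR B / P2).
  set (c := P1 * P2 * (IZR A * al + IZR B * be + IZR C)).
  set (x := P1 * (IZR q * al - IZR p1)). set (y := P2 * (IZR q * be - IZR p2)).
  set (z := IZR q / (P1 * P2)).
  assert (E : IZR (A * p1 + B * p2 + C * q) = c * z - a * x - b * y).
  { rewrite !plus_IZR, !mult_IZR. unfold a, b, c, x, y, z. field. lra. }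
  rewrite E in Hz.
  destruct (Rmax3_bounds (Rabs a) (Rabs b) (Rabs c)) as [Ba [Bb Bc]].
  destruct (Rmax3_bounds (Rabs x) (Rabs y) (Rabs z)) as [Bx [By Bz]].
  set (M := Rmax (Rmax (Rabs a) (Rabs b)) (Rabs c)) in *.
  set (N := Rmax (Rmax (Rabs x) (Rabs y)) (Rabs z)) in *.
  assert (Rabs (c * z) <= M * N)
    by (apply Rabs_mult_le; assumption).
  assert (Rabs (a * x) <= M * N)
    by (apply Rabs_mult_le; assumption).
  assert (Rabs (b * y) <= M * N)
    by (apply Rabs_mult_le; assumption).
  assert (Rabs (c * z - a * x - b * y) <= Rabs (c * z) + Rabs (a * x) + Rabs (b * y)).
  { eapply Rle_trans; [apply Rabs_minus_le|]. apply Rplus_le_compat_r.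
    eapply Rle_trans; [apply Rabs_triang|]. rewrite Rabs_Ropp. lra. }
  lra.
Qed.

(** The change of coordinates has determinant of absolute value one, so it carries cross products to
    cross products in the dual coordinates, up to sign; each coordinate is a two by two minor,
    whence the factor 2. *)
Lemma wnorm_zcross (P1 P2 al be : R) (u v : Z3) :
  0 < P1 -> 0 < P2 ->
  wnorm P1 P2 al be (zcross u v) <= 2 * vnorm P1 P2 al be u * vnorm P1 P2 al be v.
Proof.
  intros H1 H2. destruct u as [[m1 m2] n], v as [[p1 p2] q].
  unfold zcross, wnorm, vnorm. rewrite !minus_IZR, !mult_IZR.
  set (x := P1 * (IZR q * al - IZR p1)). set (y := P2 * (IZR q * be - IZR p2)).
  set (z := IZR q / (P1 * P2)).
  set (x' := P1 * (IZR n * al - IZR m1)). set (y' := P2 * (IZR n * be - IZR m2)).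
  set (z' := IZR n / (P1 * P2)).
  destruct (Rmax3_bounds (Rabs x) (Rabs y) (Rabs z)) as [Bx [By Bz]].
  destruct (Rmax3_bounds (Rabs x') (Rabs y') (Rabs z')) as [Bx' [By' Bz']].
  set (M := Rmax (Rmax (Rabs x) (Rabs y)) (Rabs z)) in *.
  set (N := Rmax (Rmax (Rabs x') (Rabs y')) (Rabs z')) in *.
  apply Rmax3_lub.
  - replace ((IZR m2 * IZR q - IZR n * IZR p2) / P1) with (z' * y - y' * z).
    + apply Rabs_det_le; assumption.
    + unfold x, y, z, x', y', z'. field. lra.
  - replace ((IZR n * IZR p1 - IZR m1 * IZR q) / P2) with (x' * z - z' * x).
    + apply Rabs_det_le; assumption.
    + unfold x, y, z, x', y', z'. field. lra.
  - replace (P1 * P2 * _) with (x' * y - y' * x).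
    + apply Rabs_det_le; assumption.
    + unfold x, y, z, x', y', z'. field.
Qed.

Lemma vnorm_zcross (P1 P2 al be : R) (u v : Z3) :
  0 < P1 -> 0 < P2 ->
  vnorm P1 P2 al be (zcross u v) <= 2 * wnorm P1 P2 al be u * wnorm P1 P2 al be v.
Proof.
  intros H1 H2. destruct u as [[A' B'] C'], v as [[A B] C].
  unfold zcross, wnorm, vnorm. rewrite !minus_IZR, !mult_IZR.
  set (a := IZR A / P1). set (b := IZR B / P2).
  set (c := P1 * P2 * (IZR A * al + IZR B * be + IZR C)).
  set (a' := IZR A' / P1). set (b' := IZR B' / P2).
  set (c' := P1 * P2 * (IZR A' * al + IZR B' * be + IZR C')).
  destruct (Rmax3_bounds (Rabs a) (Rabs b) (Rabs c)) as [Bx [By Bz]].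
  destruct (Rmax3_bounds (Rabs a') (Rabs b') (Rabs c')) as [Bx' [By' Bz']].
  set (M := Rmax (Rmax (Rabs a) (Rabs b)) (Rabs c)) in *.
  set (N := Rmax (Rmax (Rabs a') (Rabs b')) (Rabs c')) in *.
  apply Rmax3_lub.
  - replace (P1 * _) with (c' * b - b' * c).
    + apply Rabs_det_le; assumption.
    + unfold a, b, c, a', b', c'. field. lra.
  - replace (P2 * _) with (a' * c - c' * a).
    + apply Rabs_det_le; assumption.
    + unfold a, b, c, a', b', c'. field. lra.
  - replace (_ / (P1 * P2)) with (a' * b - b' * a).
    + apply Rabs_det_le; assumption.
    + unfold a, b, c, a', b', c'. field. lra.
Qed.

(** * Almost critical lattices *)

(* A lattice with a vector close to e_2 and a dual vector close to e_3 orthogonal to it is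
   close to a critical lattice of the cube. *)
Lemma critical_avoids_box (P1 P2 al be sg e : R) (p1 p2 q A B C : Z) :
  0 < P1 -> 0 < P2 -> 0 <= e -> sg * (1 + 2 * e) < 1 - e -> 0 < sg ->
  zprimitive (p1, p2, q) -> zprimitive (A, B, C) -> zdot (A, B, C) (p1, p2, q) = 0%Z ->
  Rabs (P1 * (IZR q * al - IZR p1)) <= e ->
  1 - e <= Rabs (P2 * (IZR q * be - IZR p2)) <= 1 + e ->
  Rabs (IZR A / P1) <= e -> Rabs (IZR B / P2) <= e ->
  1 - e <= Rabs (P1 * P2 * (IZR A * al + IZR B * be + IZR C)) <= 1 + e ->
  forall m1 m2 n : Z, (1 <= n)%Z ->
    Rabs (P1 * (IZR n * al - IZR m1)) < sg -> Rabs (P2 * (IZR n * be - IZR m2)) < sg ->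
    IZR n / (P1 * P2) < sg -> False.
Proof.
  intros H1 H2 He Hsg Hsg0 Hpv Hpw Hwv Hx Hy Ha Hb Hc m1 m2 n Hn Hmx Hmy Hmz.
  assert (Hmz0 : 0 <= IZR n / (P1 * P2)).
  { apply Rmult_le_pos; [apply IZR_le; lia|]. apply Rlt_le, Rinv_0_lt_compat.
    apply Rmult_lt_0_compat; assumption. }
  (* The pairing of the point in the box with the dual vector is an integer of absolute value at
     most [sg * (1 + 3 * e) < 1]. *)
  assert (Hm : zdot (A, B, C) (m1, m2, n) = 0%Z).
  { destruct (Z.eq_dec (zdot (A, B, C) (m1, m2, n)) 0) as [E|E]; [exact E|exfalso].
    simpl in E.
    assert (Hz : 1 <= Rabs (IZR (A * m1 + B * m2 + C * n))).
    { apply Rabs_IZR_ge_1; lia. }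
    assert (E2 : IZR (A * m1 + B * m2 + C * n) =
      P1 * P2 * (IZR A * al + IZR B * be + IZR C) * (IZR n / (P1 * P2))
      - IZR A / P1 * (P1 * (IZR n * al - IZR m1)) - IZR B / P2 * (P2 * (IZR n * be - IZR m2))).
    { rewrite !plus_IZR, !mult_IZR. field. lra. }
    rewrite E2 in Hz.
    set (a := IZR A / P1) in *. set (b := IZR B / P2) in *.
    set (c := P1 * P2 * (IZR A * al + IZR B * be + IZR C)) in *.
    set (x := P1 * (IZR n * al - IZR m1)) in *. set (y := P2 * (IZR n * be - IZR m2)) in *.
    set (z := IZR n / (P1 * P2)) in *.
    assert (Rabs (c * z) <= (1 + e) * sg).
    { rewrite Rabs_mult. rewrite (Rabs_pos_eq z) by assumption.
      apply Rmult_le_compat; auto using Rabs_pos; lra. }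
    assert (Rabs (a * x) <= e * sg).
    { rewrite Rabs_mult. apply Rmult_le_compat; auto using Rabs_pos; lra. }
    assert (Rabs (b * y) <= e * sg).
    { rewrite Rabs_mult. apply Rmult_le_compat; auto using Rabs_pos; lra. }
    assert (Rabs (c * z - a * x - b * y) <= Rabs (c * z) + Rabs (a * x) + Rabs (b * y)).
    { eapply Rle_trans; [apply Rabs_minus_le|]. apply Rplus_le_compat_r.
      eapply Rle_trans; [apply Rabs_triang|]. rewrite Rabs_Ropp. lra. }
    nra. }
  destruct (zcross_primitive_0 (zcross (m1, m2, n) (p1, p2, q)) (A, B, C) Hpw) as [k Hk].
  { apply zcross_zcross_0; assumption. }
  (* The third dual coordinates are compared: that of the cross product is at most
     [sg * (1 + 2 * e) < 1 - e], that of a nonzero multiple of (A, B, C) is at least [1 - e]. *)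
  assert (Hk0 : k = 0%Z).
  { simpl in Hk. injection Hk as K1 K2 K3.
    apply (f_equal IZR) in K1, K2, K3.
    rewrite ?minus_IZR, ?mult_IZR in K1, K2, K3.
    assert (E : P1 * (IZR n * al - IZR m1) * (P2 * (IZR q * be - IZR p2))
      - P2 * (IZR n * be - IZR m2) * (P1 * (IZR q * al - IZR p1))
      = IZR k * (P1 * P2 * (IZR A * al + IZR B * be + IZR C))).
    { transitivity (P1 * P2 * (al * (IZR k * IZR A) + be * (IZR k * IZR B) + IZR k * IZR C));
      [rewrite <- K1, <- K2, <- K3; ring | ring]. }
    destruct (Z.eq_dec k 0) as [?|Hne]; [assumption|exfalso].
    assert (Hz : 1 <= Rabs (IZR k)) by (apply Rabs_IZR_ge_1; lia).
    apply (f_equal Rabs) in E. rewrite (Rabs_mult (IZR k)) in E.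
    set (c := Rabs (P1 * P2 * (IZR A * al + IZR B * be + IZR C))) in *.
    set (x := P1 * (IZR n * al - IZR m1)) in *. set (y := P2 * (IZR n * be - IZR m2)) in *.
    set (x' := P1 * (IZR q * al - IZR p1)) in *. set (y' := P2 * (IZR q * be - IZR p2)) in *.
    assert (Rabs (x * y') <= sg * (1 + e)).
    { rewrite Rabs_mult. apply Rmult_le_compat; auto using Rabs_pos; lra. }
    assert (Rabs (y * x') <= sg * e).
    { rewrite Rabs_mult. apply Rmult_le_compat; auto using Rabs_pos; lra. }
    assert (Rabs (x * y' - y * x') <= Rabs (x * y') + Rabs (y * x')).
    { eapply Rle_trans; [apply Rabs_minus_le|]. lra. }
    assert (c <= Rabs (IZR k) * c) by (assert (0 <= c) by apply Rabs_pos; nra).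
    lra. }
  rewrite Hk0, zscal_0_l in Hk.
  (* The point is now a multiple of (p1, p2, q), a nonzero one because [1 <= n], so its second
     coordinate is at least [1 - e > sg]. *)
  destruct (zcross_primitive_0 _ _ Hpv Hk) as [j Hj].
  simpl in Hj. injection Hj as J1 J2 J3.
  destruct (Z.eq_dec j 0) as [E|Hne].
  { rewrite E in J3. lia. }
  assert (Hz : 1 <= Rabs (IZR j)) by (apply Rabs_IZR_ge_1; lia).
  rewrite J2, J3, !mult_IZR in Hmy.
  replace (P2 * (IZR j * IZR q * be - IZR j * IZR p2))
    with (IZR j * (P2 * (IZR q * be - IZR p2))) in Hmy by ring.
  rewrite Rabs_mult in Hmy.
  set (y' := Rabs (P2 * (IZR q * be - IZR p2))) in *.
  assert (y' <= Rabs (IZR j) * y') by (assert (0 <= y') by apply Rabs_pos; nra).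
  assert (0 <= sg * e) by (apply Rmult_le_pos; lra).
  lra.
Qed.

(** * Finite interval covers *)

Definition total_length (l : list (R * R)) : R :=
  fold_right (fun I acc => (snd I - fst I) + acc) 0 l.

(** An outer Jordan content. It applies to arbitrary sets, so no measurability has to be established
    for the exceptional sets at each scale. *)
Definition covered (E : R -> Prop) (m : R) : Prop :=
  exists l : list (R * R),
    (forall I, In I l -> fst I <= snd I) /\
    (forall s, E s -> exists I, In I l /\ fst I <= s <= snd I) /\
    total_length l <= m.

Lemma total_length_app (l1 l2 : list (R * R)) :
  total_length (l1 ++ l2) = total_length l1 + total_length l2.
Proof. induction l1 as [|I l1 IH]; simpl; [ring | rewrite IH; ring]. Qed.

Lemma covered_mono (E F : R -> Prop) (m n : R) :
  covered F m -> (forall s, E s -> F s) -> m <= n -> covered E n.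
Proof.
  intros [l [H1 [H2 H3]]] HEF Hmn. exists l. repeat split; auto. lra.
Qed.

Lemma covered_union (E F : R -> Prop) (m n : R) :
  covered E m -> covered F n -> covered (fun s => E s \/ F s) (m + n).
Proof.
  intros [l [H1 [H2 H3]]] [l' [H1' [H2' H3']]]. exists (l ++ l'). split; [|split].
  - intros I HI. apply in_app_or in HI. destruct HI; auto.
  - intros s [Hs|Hs]; [destruct (H2 s Hs) as [I [? ?]] | destruct (H2' s Hs) as [I [? ?]]];
      exists I; split; auto; apply in_or_app; auto.
  - rewrite total_length_app. lra.
Qed.

Lemma covered_empty (E : R -> Prop) (m : R) :
  0 <= m -> (forall s, ~ E s) -> covered E m.
Proof.
  intros Hm HE. exists nil. split; [|split]; simpl; [tauto | | assumption].
  intros s Hs. exfalso. exact (HE s Hs).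
Qed.

Lemma covered_interval (a b : R) : a <= b -> covered (fun s => a <= s <= b) (b - a).
Proof.
  intros Hab. exists ((a, b) :: nil). split; [|split]; simpl.
  - intros I [<-|[]]; simpl; assumption.
  - intros s Hs. exists (a, b). simpl. tauto.
  - lra.
Qed.

Lemma infimum (E : R -> Prop) (x : R) :
  (forall s, E s -> x <= s) -> (exists s, E s) ->
  exists m, x <= m /\ (forall s, E s -> m <= s) /\
    forall d, 0 < d -> exists s, E s /\ s < m + d.
Proof.
  intros Hx [s0 Hs0].
  destruct (completeness (fun t => E (- t))) as [M [HM1 HM2]].
  - exists (- x). intros t Ht. specialize (Hx _ Ht). lra.
  - exists (- s0). rewrite Ropp_involutive. exact Hs0.
  - exists (- M). split; [|split].
    + assert (M <= - x); [|lra]. apply HM2. intros t Ht. specialize (Hx _ Ht). lra.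
    + intros s Hs. assert (- s <= M); [|lra]. apply HM1. rewrite Ropp_involutive. exact Hs.
    + intros d Hd. apply NNPP. intros Hn.
      assert (M <= M - d); [|lra]. apply HM2. intros t Ht.
      apply Rnot_lt_le. intros Hlt. apply Hn. exists (- t). split; [exact Ht|lra].
Qed.

Fixpoint chain (E : R -> Prop) (d : R) (n : nat) (x : R) : Prop :=
  match n with
  | O => True
  | S k => exists s, E s /\ x <= s /\ chain E d k (s + d)
  end.

(** Greedy choice from the left: [s0] in E within [d] of the infimum [m], so that [[m, m + 2 d]]
    contains all of E up to [s0 + d], and beyond it only shorter chains are left. The factor 2 pays
    for an infimum that is not attained. *)
Lemma covered_no_chain (E : R -> Prop) (d : R) (n : nat) (x : R) :
  0 < d -> ~ chain E d (S n) x ->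
  covered (fun s => E s /\ x <= s) (2 * INR n * d).
Proof.
  intros Hd. revert x. induction n as [|n IH]; intros x Hn.
  - apply covered_empty; [simpl; lra|]. intros s [Hs1 Hs2]. apply Hn. simpl. exists s. tauto.
  - destruct (classic (exists s, E s /\ x <= s)) as [Hex|Hex].
    + destruct (infimum (fun s => E s /\ x <= s) x) as [m [Hm1 [Hm2 Hm3]]]; [tauto|exact Hex|].
      destruct (Hm3 d Hd) as [s0 [[Hs0 Hxs0] Hs0d]].
      specialize (Hm2 s0 (conj Hs0 Hxs0)) as Hms0.
      assert (Hc : ~ chain E d (S n) (s0 + d)).
      { intros Hc. apply Hn. exists s0. split; [exact Hs0|]. split; assumption. }
      apply IH in Hc.
      apply covered_mono with (1 := covered_union _ _ _ _
        (covered_interval m (m + 2 * d) ltac:(lra)) Hc).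
      * intros s [Hs1 Hs2]. specialize (Hm2 s (conj Hs1 Hs2)).
        destruct (Rle_dec (s0 + d) s); [right; tauto|left; lra].
      * rewrite (S_INR n). lra.
    + apply covered_empty; [|intros s Hs; apply Hex; exists s; exact Hs].
      apply Rmult_le_pos; [|lra]. apply Rmult_le_pos; [lra|apply pos_INR].
Qed.

(** * Quantitative nondivergence *)

(* The Kleinbock--Margulis scheme in rank three, along bisected intervals. [N true] and
   [N false] are the norms on a lattice and on its dual; an interval is bisected until some
   primitive vector is small on all of it, and then again for the vectors orthogonal to
   the one found. A point where the vectors so found are not too small has no short
   vector at all. *)

Record norm_system (lo hi rho eta K : R) (N : bool -> R -> Z3 -> R) : Prop := {
  ns_pos : forall i s u, 0 <= N i s u;
  ns_scal : forall i s k u, N i s (zscal k u) = Rabs (IZR k) * N i s u;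
  ns_pair : forall i s u v, zdot u v <> 0%Z -> 1 <= 3 * (N i s u * N (negb i) s v);
  ns_cross : forall i s u v, N (negb i) s (zcross u v) <= 2 * N i s u * N i s v;
  ns_good : forall i u a b, u <> zzero -> lo <= a -> a < b -> b <= hi ->
    (exists s, a <= s <= b /\ rho < N i s u) ->
    covered (fun s => a <= s <= b /\ N i s u < eta) (K * (b - a));
  ns_dist : exists l, 0 < l /\ forall i s t u, lo <= s <= hi -> lo <= t <= hi ->
    Rabs (s - t) <= l -> N i s u <= 2 * N i t u;
  ns_top : forall i u, u <> zzero -> exists s, lo <= s <= hi /\ rho < N i s u }.

Arguments ns_pos {_ _ _ _ _ _} _.
Arguments ns_scal {_ _ _ _ _ _} _.
Arguments ns_pair {_ _ _ _ _ _} _.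
Arguments ns_cross {_ _ _ _ _ _} _.
Arguments ns_good {_ _ _ _ _ _} _.
Arguments ns_dist {_ _ _ _ _ _} _.
Arguments ns_top {_ _ _ _ _ _} _.

Section Nondivergence.

Variables (lo hi rho eta K : R) (N : bool -> R -> Z3 -> R).
Hypothesis HN : norm_system lo hi rho eta K N.
Hypothesis Heta : 0 < eta.
Hypothesis Hrho : eta <= rho / 2.
Hypothesis Hrho4 : rho <= 1 / 4.
Hypothesis HK : 0 <= K.

Definition short_at (s : R) : Prop := exists i u, u <> zzero /\ N i s u < eta.

(** The second choice of the marking scheme: a companion of [u] of the other kind, orthogonal to it
    and of norm between [eta] and [rho], or none below [rho / 2]. Together [u] and its companion are
    a line in a plane, that is a flag. *)
Definition flagged (i : bool) (u : Z3) (s : R) : Prop :=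
  (forall t, zprimitive t -> zdot u t = 0%Z -> rho / 2 <= N (negb i) s t) \/
  (exists t, zprimitive t /\ zdot u t = 0%Z /\ eta <= N (negb i) s t <= rho).

Lemma norm_multiple (i : bool) (s : R) (k : Z) (u : Z3) :
  zscal k u <> zzero -> N i s u <= N i s (zscal k u).
Proof.
  intros Hk. rewrite (ns_scal HN).
  pose proof (ns_pos HN i s u).
  assert (1 <= Rabs (IZR k)); [|nra].
  rewrite <- abs_IZR. apply IZR_le.
  assert (k <> 0)%Z by (intros ->; apply Hk, zscal_0_l). lia.
Qed.

(* A vector of the same kind as u that is not a multiple of u spans with u a plane, given
   by a dual vector orthogonal to u. *)
Lemma short_cross (i : bool) (u v : Z3) (s : R) :
  zprimitive u -> v <> zzero -> N i s v < eta -> N i s u <= rho ->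
  eta <= N i s u ->
  zcross u v <> zzero /\ exists t, zprimitive t /\ zdot u t = 0%Z /\ zdot v t = 0%Z /\
    N (negb i) s t <= 2 * rho * N i s v.
Proof.
  intros Hu Hv Hvs Hur Hue.
  assert (Hc : zcross u v <> zzero).
  { intros E. destruct (zcross_primitive_0 v u Hu (zcross_comm_0 u v E)) as [k Hk]. subst v.
    pose proof (norm_multiple i s k u Hv). lra. }
  split; [exact Hc|].
  destruct (primitive_factor _ Hc) as [k [t [Ht [Hkt Hk]]]].
  exists t. repeat split; [exact Ht| | |].
  - pose proof (zdot_zcross_l u v) as E. rewrite Hkt, zdot_zscal_r in E.
    apply Z.mul_eq_0 in E. lia.
  - assert (E : zdot v (zcross u v) = 0%Z)
      by (destruct u as [[? ?] ?], v as [[? ?] ?]; simpl; ring).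
    rewrite Hkt, zdot_zscal_r in E. apply Z.mul_eq_0 in E. lia.
  - pose proof (ns_cross HN i s u v) as E.
    assert (N (negb i) s t <= N (negb i) s (zcross u v)).
    { rewrite Hkt. apply norm_multiple. rewrite <- Hkt. exact Hc. }
    pose proof (ns_pos HN i s v). nra.
Qed.

(** A short vector inside the flag would be a multiple of a flag vector, whose norm is at least
    [eta]. Outside the flag, its pairing with a flag vector would be a nonzero integer at most
    [3 rho eta < 1], or its cross product with one would yield an orthogonal vector of norm at most
    [2 rho eta <= eta / 2]. Both numerical bounds come from [rho <= 1 / 4]. *)
Lemma flagged_not_short (i : bool) (u : Z3) (s : R) :
  zprimitive u -> eta <= N i s u <= rho -> flagged i u s -> ~ short_at s.
Proof.
  intros Hu [Hue Hur] Hfl [j [v [Hv Hvs]]].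
  destruct (Bool.bool_dec j i) as [->|Hji].
  - destruct (short_cross i u v s Hu Hv Hvs Hur Hue) as [Hc [t [Ht [Hut [Hvt Hts]]]]].
    destruct Hfl as [Hall|[t' [Ht' [Hut' [Hte Htr]]]]].
    + specialize (Hall t Ht Hut). nra.
    + destruct (Z.eq_dec (zdot v t') 0) as [E|E].
      * destruct (common_normal u v t t') as [k Hk]; try assumption.
        assert (Hk0 : zscal k t' <> zzero)
          by (rewrite <- Hk; apply primitive_neq_0; exact Ht).
        pose proof (norm_multiple (negb i) s k t' Hk0) as Hm. rewrite <- Hk in Hm. nra.
      * pose proof (ns_pair HN i s v t' E). 
        nra.
  - assert (Hj : j = negb i) by (destruct i, j; simpl; congruence). subst j. clear Hji.
    destruct (Z.eq_dec (zdot u v) 0) as [E|E].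
    2:{ pose proof (ns_pair HN i s u v E). nra. }
    destruct Hfl as [Hall|[t [Ht [Hut [Hte Htr]]]]].
    + destruct (primitive_factor v Hv) as [k [v' [Hv' [Hk Hk1]]]].
      assert (E' : zdot u v' = 0%Z).
      { rewrite Hk, zdot_zscal_r in E. apply Z.mul_eq_0 in E. lia. }
      specialize (Hall v' Hv' E').
      pose proof (norm_multiple (negb i) s k v') as Hm. rewrite <- Hk in Hm.
      specialize (Hm Hv). lra.
    + destruct (short_cross (negb i) t v s Ht Hv Hvs Htr Hte)
        as [Hc [t' [Ht' [Htt' [Hvt' Hs]]]]].
      destruct (common_normal t v t' u) as [k Hk]; try assumption;
        try (rewrite zdot_comm; assumption).
      assert (Hk0 : zscal k u <> zzero)
        by (rewrite <- Hk; apply primitive_neq_0; exact Ht').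
      pose proof (norm_multiple i s k u Hk0) as Hm. rewrite <- Hk in Hm.
      rewrite Bool.negb_involutive in Hs.
      nra.
Qed.

(** A stopping time argument. Halving ends when an interval becomes [small] or its parent is shorter
    than [l], and the covers of the pieces add up. The parent [[A, A + 2 h]] is carried along
    because it is the last interval known not to be small, and the goodness estimate is applied
    there. *)
Lemma bisection_cover (P : R -> Prop) (small : R -> R -> Prop) (l c : R) :
  0 <= c ->
  (forall a h A, lo <= A -> A <= a -> a + h <= A + 2 * h -> A + 2 * h <= hi -> 0 < h ->
     ~ small A (A + 2 * h) -> 2 * h <= l -> forall s, a <= s <= a + h -> ~ P s) ->
  (forall a h A, lo <= A -> A <= a -> a + h <= A + 2 * h -> A + 2 * h <= hi -> 0 < h ->
     ~ small A (A + 2 * h) -> small a (a + h) ->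
     covered (fun s => a <= s <= a + h /\ P s) (c * h)) ->
  forall n a h A, lo <= A -> A <= a -> a + h <= A + 2 * h -> A + 2 * h <= hi -> 0 < h ->
    ~ small A (A + 2 * h) -> 2 * h <= 2 ^ n * l ->
    covered (fun s => a <= s <= a + h /\ P s) (c * h).
Proof.
  intros Hc Hbase Hsmall n. induction n as [|n IH]; intros a h A H1 H2 H3 H4 H5 H6 H7.
  - apply covered_empty; [apply Rmult_le_pos; lra|]. intros s [Hs HP].
    apply (Hbase a h A) with (s := s); auto. simpl in H7. lra.
  - destruct (classic (small a (a + h))) as [Hs|Hs]; [apply (Hsmall a h A); assumption|].
    simpl in H7.
    assert (E : a + h = a + 2 * (h / 2)) by field. rewrite E in Hs.
    assert (C1 : covered (fun s => a <= s <= a + h / 2 /\ P s) (c * (h / 2)))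
      by (apply (IH a (h / 2) a); auto; lra).
    assert (C2 : covered (fun s => a + h / 2 <= s <= a + h / 2 + h / 2 /\ P s) (c * (h / 2)))
      by (apply (IH (a + h / 2) (h / 2) a); auto; lra).
    apply covered_mono with (1 := covered_union _ _ _ _ C1 C2); [|lra].
    intros s [Hs1 HP]. destruct (Rle_dec s (a + h / 2)); [left|right]; split; try exact HP; lra.
Qed.

Lemma exists_pow2_ge (x l : R) : 0 < l -> exists n, x <= 2 ^ n * l.
Proof.
  intros Hl. destruct (Pow_x_infinity 2 ltac:(rewrite Rabs_pos_eq; lra) (x / l)) as [n Hn].
  exists n. specialize (Hn n (Nat.le_refl n)).
  rewrite Rabs_pos_eq in Hn by (apply pow_le; lra).
  apply Rge_le in Hn. apply Rmult_le_compat_r with (r := l) in Hn; [|lra].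
  unfold Rdiv in Hn. rewrite Rmult_assoc, Rinv_l in Hn by lra. lra.
Qed.

(** An interval that stops carries an orthogonal [t] that is at most [rho] on it but exceeds [rho]
    somewhere on the parent, so off a set of proportion [2 K] the second alternative of [flagged]
    holds. At the final scale norms vary by at most a factor 2, which gives the first alternative
    with [rho / 2]. *)
Lemma not_flagged_cover (i : bool) (u : Z3) (a h A : R) :
  lo <= A -> A <= a -> a + h <= A + 2 * h -> A + 2 * h <= hi -> 0 < h ->
  (forall t, zprimitive t -> exists s, A <= s <= A + 2 * h /\ rho < N (negb i) s t) ->
  covered (fun s => a <= s <= a + h /\ ~ flagged i u s) (2 * K * h).
Proof.
  intros H1 H2 H3 H4 H5 H6.
  destruct (ns_dist HN) as [l [Hl Hdist]].
  destruct (exists_pow2_ge (2 * h) l Hl) as [n Hn].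
  apply (bisection_cover (fun s => ~ flagged i u s)
    (fun x y => exists t, zprimitive t /\ zdot u t = 0%Z /\
       forall s, x <= s <= y -> N (negb i) s t <= rho) l (2 * K)) with (n := n) (A := A);
    auto; [lra| | |].
  - clear a h A H1 H2 H3 H4 H5 H6 n Hn.
    intros a h A H1 H2 H3 H4 H5 H6 H7 s Hs Hnf. apply Hnf. left. intros t Ht Hut.
    apply Rnot_lt_le. intros Hlt. apply H6. exists t. split; [exact Ht|]. split; [exact Hut|].
    intros s' Hs'.
    assert (N (negb i) s' t <= 2 * N (negb i) s t); [|lra].
    apply Hdist; try lra. apply Rabs_le. lra.
  - clear a h A H1 H2 H3 H4 H5 H6 n Hn.
    intros a h A H1 H2 H3 H4 H5 H6 [t [Ht [Hut Hsm]]].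
    assert (Hg : covered (fun s => A <= s <= A + 2 * h /\ N (negb i) s t < eta)
                   (K * (A + 2 * h - A))).
    { apply (ns_good HN); auto using primitive_neq_0; try lra.
      apply NNPP. intros Hn. apply H6. exists t. split; [exact Ht|]. split; [exact Hut|].
      intros s Hs. apply Rnot_lt_le. intros Hlt. apply Hn. exists s. tauto. }
    apply covered_mono with (1 := Hg); [|lra].
    intros s [Hs Hnf]. split; [lra|]. apply Rnot_le_lt. intros Hle. apply Hnf. right.
    exists t. repeat split; auto.
  - intros [t [Ht [Hut Hsm]]]. destruct (H6 t Ht) as [s [Hs Hs']].
    specialize (Hsm s Hs). lra.
Qed.

(** Of [4 K], one half is for the points where the marked [u] is below [eta], the other for those
    that are not flagged. The parent of a half is the whole interval, on which [ns_top] says that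
    nothing is small. *)
Lemma short_cover_half (a h : R) :
  lo <= a -> a + h <= hi -> 0 < h -> hi = lo + 2 * h ->
  covered (fun s => a <= s <= a + h /\ short_at s) (4 * K * h).
Proof.
  intros H1 H2 H3 H4.
  destruct (ns_dist HN) as [l [Hl Hdist]].
  destruct (exists_pow2_ge (2 * h) l Hl) as [n Hn].
  apply (bisection_cover short_at
    (fun x y => exists i u, zprimitive u /\ forall s, x <= s <= y -> N i s u <= rho)
    l (4 * K)) with (n := n) (A := lo);
    auto; try lra; clear n Hn.
  - clear a h H1 H2 H3 H4.
    intros a h A H1 H2 H3 H4 H5 H6 H7 s Hs [i [u [Hu Hus]]].
    destruct (primitive_factor u Hu) as [k [t [Ht [Hk Hk1]]]].
    apply H6. exists i, t. split; [exact Ht|]. intros s' Hs'.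
    assert (N i s' t <= 2 * N i s t) by (apply Hdist; try lra; apply Rabs_le; lra).
    pose proof (norm_multiple i s k t) as Hm. rewrite <- Hk in Hm. specialize (Hm Hu). lra.
  - clear a h H1 H2 H3 H4.
    intros a h A H1 H2 H3 H4 H5 H6 [i [u [Hu Hsm]]].
    assert (Hbig : forall j t, zprimitive t -> exists s, A <= s <= A + 2 * h /\ rho < N j s t).
    { intros j t Ht. apply NNPP. intros Hn. apply H6. exists j, t. split; [exact Ht|].
      intros s Hs. apply Rnot_lt_le. intros Hlt. apply Hn. exists s. tauto. }
    assert (Hg : covered (fun s => A <= s <= A + 2 * h /\ N i s u < eta)
                   (K * (A + 2 * h - A))).
    { apply (ns_good HN); auto using primitive_neq_0; lra. }
    assert (Hf : covered (fun s => a <= s <= a + h /\ ~ flagged i u s) (2 * K * h)).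
    { apply not_flagged_cover with (A := A); auto. }
    apply covered_mono with (1 := covered_union _ _ _ _ Hg Hf); [|lra].
    intros s [Hs Hsh].
    destruct (Rlt_le_dec (N i s u) eta) as [Hlt|Hle]; [left; split; [lra|exact Hlt]|].
    right. split; [exact Hs|]. intros Hfl.
    apply (flagged_not_short i u s); auto.
  - intros [i [u [Hu Hsm]]].
    destruct (ns_top HN i u (primitive_neq_0 u Hu)) as [s [Hs Hs']].
    assert (N i s u <= rho) by (apply Hsm; lra). lra.
Qed.

Lemma short_cover :
  lo < hi -> covered (fun s => lo <= s <= hi /\ short_at s) (4 * K * (hi - lo)).
Proof.
  intros H. set (h := (hi - lo) / 2).
  assert (C1 := short_cover_half lo h ltac:(unfold h; lra) ltac:(unfold h; lra)
                  ltac:(unfold h; lra) ltac:(unfold h; lra)).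
  assert (C2 := short_cover_half (lo + h) h ltac:(unfold h; lra) ltac:(unfold h; lra)
                  ltac:(unfold h; lra) ltac:(unfold h; lra)).
  apply covered_mono with (1 := covered_union _ _ _ _ C1 C2); [|unfold h; lra].
  intros s [Hs Hsh]. destruct (Rle_dec s (lo + h)); [left|right]; split; auto; unfold h in *; lra.
Qed.

End Nondivergence.

(** * Curves with uniform estimates, and nondivergence along them *)

(** The common interface of lines and curves. The first coordinate carries the expansion: [nc_low]
    keeps it moving and [nc_dir] makes it dominate. [nc_good] says that an affine function of the
    curve behaves like a polynomial of degree two. [nc_top] excludes integer lines that stay close
    to the whole piece; for it, lines use the badly approximable point and curves the Wronskian. *)
Record nice_curve (r1 r2 : R) (f g f' g' : R -> R) (lo hi c1 C rho0 Q0 : R) : Prop := {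
  nc_lt : lo < hi;
  nc_c1 : 0 < c1;
  nc_C : 1 <= C;
  nc_low : forall s t, lo <= s <= hi -> lo <= t <= hi -> c1 * Rabs (t - s) <= Rabs (f t - f s);
  nc_lipf : forall s t, lo <= s <= hi -> lo <= t <= hi -> Rabs (f t - f s) <= C * Rabs (t - s);
  nc_lipg : forall s t, lo <= s <= hi -> lo <= t <= hi -> Rabs (g t - g s) <= C * Rabs (t - s);
  nc_f' : forall s, lo <= s <= hi -> c1 <= Rabs (f' s) <= C;
  nc_g' : forall s, lo <= s <= hi -> Rabs (g' s) <= C;
  nc_taylorf : forall s t, lo <= s <= hi -> lo <= t <= hi ->
    Rabs (f t - f s - f' s * (t - s)) <= C * (t - s) ^ 2;
  nc_taylorg : forall s t, lo <= s <= hi -> lo <= t <= hi ->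
    Rabs (g t - g s - g' s * (t - s)) <= C * (t - s) ^ 2;
  nc_dir : r2 <= r1 \/ forall s, lo <= s <= hi -> g s = g lo /\ g' s = 0;
  nc_good : forall A B D a b e d s1 s2 s3 s4, lo <= a -> b <= hi -> 0 <= e -> 0 < d ->
    a <= s1 -> s1 + d <= s2 -> s2 + d <= s3 -> s3 + d <= s4 -> s4 <= b ->
    Rabs (A * f s1 + B * g s1 + D) <= e -> Rabs (A * f s2 + B * g s2 + D) <= e ->
    Rabs (A * f s3 + B * g s3 + D) <= e -> Rabs (A * f s4 + B * g s4 + D) <= e ->
    forall s, a <= s <= b -> Rabs (A * f s + B * g s + D) <= C * e * ((b - a) / d) ^ 2;
  nc_rho0 : 0 < rho0;
  nc_top : forall Q w, Q0 <= Q -> 1 <= Q -> w <> zzero ->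
    exists s, lo <= s <= hi /\ rho0 < wnorm (Rpower Q r1) (Rpower Q r2) (f s) (g s) w }.

Arguments nc_lt {_ _ _ _ _ _ _ _ _ _ _ _} _.
Arguments nc_c1 {_ _ _ _ _ _ _ _ _ _ _ _} _.
Arguments nc_C {_ _ _ _ _ _ _ _ _ _ _ _} _.
Arguments nc_low {_ _ _ _ _ _ _ _ _ _ _ _} _.
Arguments nc_lipf {_ _ _ _ _ _ _ _ _ _ _ _} _.
Arguments nc_lipg {_ _ _ _ _ _ _ _ _ _ _ _} _.
Arguments nc_f' {_ _ _ _ _ _ _ _ _ _ _ _} _.
Arguments nc_g' {_ _ _ _ _ _ _ _ _ _ _ _} _.
Arguments nc_taylorf {_ _ _ _ _ _ _ _ _ _ _ _} _.
Arguments nc_taylorg {_ _ _ _ _ _ _ _ _ _ _ _} _.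
Arguments nc_dir {_ _ _ _ _ _ _ _ _ _ _ _} _.
Arguments nc_good {_ _ _ _ _ _ _ _ _ _ _ _} _.
Arguments nc_rho0 {_ _ _ _ _ _ _ _ _ _ _ _} _.
Arguments nc_top {_ _ _ _ _ _ _ _ _ _ _ _} _.

Lemma Rpower_ge_1 (Q r : R) : 1 <= Q -> 0 <= r -> 1 <= Rpower Q r.
Proof. intros HQ Hr. rewrite <- (Rpower_O Q) by lra. apply Rle_Rpower; assumption. Qed.

Lemma Rpower_pos (x y : R) : 0 < Rpower x y.
Proof. apply exp_pos. Qed.

Lemma Rabs_div_pos (a b : R) : 0 < b -> Rabs (a / b) = Rabs a / b.
Proof.
  intros Hb. unfold Rdiv. rewrite Rabs_mult, (Rabs_pos_eq (/ b)); [reflexivity|].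
  apply Rinv_nonneg. exact Hb.
Qed.

Section NiceNorms.

Variables (r1 r2 : R) (f g f' g' : R -> R) (lo hi c1 C rho0 Q0 : R).
Hypothesis Hr1 : 0 < r1.
Hypothesis Hr2 : 0 < r2.
Hypothesis Hr : r1 + r2 = 1.
Hypothesis HC : nice_curve r1 r2 f g f' g' lo hi c1 C rho0 Q0.

Lemma Rpower_r1_r2 (Q : R) : 0 < Q -> Rpower Q r1 * Rpower Q r2 = Q.
Proof. intros HQ. rewrite <- Rpower_plus, Hr. apply Rpower_1. exact HQ. Qed.

Definition curve_norm (Q : R) (i : bool) (s : R) (u : Z3) : R :=
  if i then vnorm (Rpower Q r1) (Rpower Q r2) (f s) (g s) u
  else wnorm (Rpower Q r1) (Rpower Q r2) (f s) (g s) u.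

(** For integer points no arithmetic input is required: smallness at both ends, where [f] differs by
    at least [c1 (hi - lo)], forces [q = 0], and then [p1] and [p2] are integers of absolute value
    below 1. *)
Lemma vnorm_top (Q rho : R) (u : Z3) :
  1 <= Q -> rho <= 1 / 4 -> rho <= c1 * (hi - lo) / 8 -> u <> zzero ->
  exists s, lo <= s <= hi /\ rho < vnorm (Rpower Q r1) (Rpower Q r2) (f s) (g s) u.
Proof.
  intros HQ Hrho Hrho' Hu. apply NNPP. intros Hn.
  assert (Hall : forall s, lo <= s <= hi ->
    vnorm (Rpower Q r1) (Rpower Q r2) (f s) (g s) u <= rho).
  { intros s Hs. apply Rnot_lt_le. intros Hlt. apply Hn. exists s. tauto. }
  assert (HP1 := Rpower_ge_1 Q r1 HQ ltac:(lra)).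
  assert (HP2 := Rpower_ge_1 Q r2 HQ ltac:(lra)).
  pose proof (nc_lt HC) as Hlt.
  pose proof (nc_c1 HC) as Hc1.
  assert (Hl := Hall lo ltac:(lra)). assert (Hh := Hall hi ltac:(lra)).
  pose proof (nc_low HC lo hi ltac:(lra) ltac:(lra)) as Hlow.
  destruct u as [[p1 p2] q]. unfold vnorm in Hl, Hh.
  set (P1 := Rpower Q r1) in *. set (P2 := Rpower Q r2) in *.
  pose proof (Rmax3_bounds (Rabs (P1 * (IZR q * f lo - IZR p1)))
    (Rabs (P2 * (IZR q * g lo - IZR p2))) (Rabs (IZR q / (P1 * P2)))) as [L1 [L2 _]].
  pose proof (Rmax3_bounds (Rabs (P1 * (IZR q * f hi - IZR p1)))
    (Rabs (P2 * (IZR q * g hi - IZR p2))) (Rabs (IZR q / (P1 * P2)))) as [U1 [U2 _]].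
  assert (HqR : Rabs (IZR q) * (c1 * (hi - lo)) <= 2 * rho).
  { rewrite (Rabs_pos_eq (hi - lo)) in Hlow by lra.
    assert (Rabs (P1 * (IZR q * f hi - IZR p1) - P1 * (IZR q * f lo - IZR p1)) <= 2 * rho).
    { eapply Rle_trans; [apply Rabs_minus_le|]. lra. }
    replace (P1 * (IZR q * f hi - IZR p1) - P1 * (IZR q * f lo - IZR p1))
      with (P1 * (IZR q * (f hi - f lo))) in H by ring.
    rewrite !Rabs_mult, (Rabs_pos_eq P1) in H by lra.
    assert (0 <= Rabs (IZR q)) by apply Rabs_pos.
    assert (0 <= Rabs (IZR q) * Rabs (f hi - f lo))
      by (apply Rmult_le_pos; apply Rabs_pos).
    nra. }
  assert (Hq : (q = 0)%Z).
  { destruct (Z.eq_dec q 0) as [?|Hne]; [assumption|exfalso].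
    assert (1 <= Rabs (IZR q)) by (apply Rabs_IZR_ge_1; lia).
    assert (0 < c1 * (hi - lo)) by (apply Rmult_lt_0_compat; lra). nra. }
  subst q.
  assert (Hp : forall P p x, 1 <= P -> Rabs (P * (0 * x - IZR p)) <= rho -> (p = 0)%Z).
  { intros P p x HP Hb. destruct (Z.eq_dec p 0) as [?|Hne]; [assumption|exfalso].
    assert (1 <= Rabs (IZR p)) by (apply Rabs_IZR_ge_1; lia).
    replace (P * (0 * x - IZR p)) with (- (P * IZR p)) in Hb by ring.
    rewrite Rabs_Ropp, Rabs_mult, (Rabs_pos_eq P) in Hb by lra. nra. }
  apply Hu. unfold zzero.
  rewrite (Hp P1 p1 (f lo)), (Hp P2 p2 (g lo)) by (try assumption; lra). reflexivity.
Qed.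

(** The crude scale [1 / (2 C Q^2)] depends on Q. This is harmless, since it only makes the
    bisection terminate and does not enter the measure bound. *)
Lemma curve_norm_dist (Q : R) : 1 <= Q -> exists l, 0 < l /\ forall i s t u,
  lo <= s <= hi -> lo <= t <= hi ->
  Rabs (s - t) <= l -> curve_norm Q i s u <= 2 * curve_norm Q i t u.
Proof.
  intros HQ.
  assert (HP1 := Rpower_ge_1 Q r1 HQ ltac:(lra)).
  assert (HP2 := Rpower_ge_1 Q r2 HQ ltac:(lra)).
  assert (HPQ := Rpower_r1_r2 Q ltac:(lra)).
  pose proof (nc_C HC) as HCC.
  exists (/ (2 * C * (Q * Q))).
  assert (HD : 0 < 2 * C * (Q * Q)) by nra.
  split; [apply Rinv_0_lt_compat; exact HD|].
  intros i s t u Hs Ht Hst.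
  pose proof (nc_lipf HC t s Ht Hs) as Lf.
  pose proof (nc_lipg HC t s Ht Hs) as Lg.
  assert (HCd : C * Rabs (s - t) <= / (2 * (Q * Q))).
  { apply Rle_trans with (C * / (2 * C * (Q * Q))); [apply Rmult_le_compat_l; lra|].
    right. field. lra. }
  set (d := / (2 * (Q * Q))) in *.
  assert (Hdpos : 0 < d) by (apply Rinv_0_lt_compat; nra).
  assert (HdQ : Q * Q * d = 1 / 2) by (unfold d; field; lra).
  assert (Df : Rabs (f s - f t) <= d) by lra.
  assert (Dg : Rabs (g s - g t) <= d) by lra.
  assert (Hstep : forall a b k, Rabs (a - b) <= k -> Rabs a <= Rabs b + k).
  { intros a b k Hk. replace a with (b + (a - b)) by ring.
    eapply Rle_trans; [apply Rabs_triang|]. lra. }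
  destruct u as [[u1 u2] u3]. unfold curve_norm. destruct i; unfold vnorm, wnorm.
  - set (P1 := Rpower Q r1) in *. set (P2 := Rpower Q r2) in *.
    destruct (Rmax3_bounds (Rabs (P1 * (IZR u3 * f t - IZR u1)))
      (Rabs (P2 * (IZR u3 * g t - IZR u2))) (Rabs (IZR u3 / (P1 * P2)))) as [B1 [B2 B3]].
    set (M := Rmax _ _) in *.
    assert (Hu3 : Rabs (IZR u3) <= M * Q).
    { rewrite <- HPQ. rewrite Rabs_div_pos in B3 by (rewrite HPQ; lra).
      apply Rmult_le_compat_r with (r := P1 * P2) in B3; [|nra].
      unfold Rdiv in B3. rewrite Rmult_assoc, Rinv_l in B3 by nra. lra. }
    assert (HM : 0 <= M) by (eapply Rle_trans; [apply Rabs_pos|exact B1]).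
    assert (Hinc : forall P, 1 <= P -> P <= Q -> P * (Rabs (IZR u3) * d) <= M).
    { intros P HP HP'. pose proof (Rabs_pos (IZR u3)).
      apply Rle_trans with (Q * (M * Q * d)).
      - apply Rmult_le_compat; try nra.
      - replace (Q * (M * Q * d)) with (M * (Q * Q * d)) by ring. rewrite HdQ. lra. }
    apply Rmax3_lub.
    + apply Rle_trans with (Rabs (P1 * (IZR u3 * f t - IZR u1)) + M); [|lra].
      apply Hstep.
      replace (P1 * (IZR u3 * f s - IZR u1) - P1 * (IZR u3 * f t - IZR u1))
        with (P1 * (IZR u3 * (f s - f t))) by ring.
      rewrite !Rabs_mult, (Rabs_pos_eq P1) by lra.
      eapply Rle_trans; [|apply (Hinc P1); nra].
      apply Rmult_le_compat_l; [lra|]. apply Rmult_le_compat_l; [apply Rabs_pos|exact Df].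
    + apply Rle_trans with (Rabs (P2 * (IZR u3 * g t - IZR u2)) + M); [|lra].
      apply Hstep.
      replace (P2 * (IZR u3 * g s - IZR u2) - P2 * (IZR u3 * g t - IZR u2))
        with (P2 * (IZR u3 * (g s - g t))) by ring.
      rewrite !Rabs_mult, (Rabs_pos_eq P2) by lra.
      eapply Rle_trans; [|apply (Hinc P2); nra].
      apply Rmult_le_compat_l; [lra|]. apply Rmult_le_compat_l; [apply Rabs_pos|exact Dg].
    + lra.
  - set (P1 := Rpower Q r1) in *. set (P2 := Rpower Q r2) in *.
    destruct (Rmax3_bounds (Rabs (IZR u1 / P1)) (Rabs (IZR u2 / P2))
      (Rabs (P1 * P2 * (IZR u1 * f t + IZR u2 * g t + IZR u3)))) as [B1 [B2 B3]].
    set (M := Rmax _ _) in *.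
    assert (HM : 0 <= M) by (eapply Rle_trans; [apply Rabs_pos|exact B1]).
    assert (Hu : forall P u, 1 <= P -> P <= Q -> Rabs (IZR u / P) <= M -> Rabs (IZR u) <= M * Q).
    { intros P u HP HP' HB. rewrite Rabs_div_pos in HB by lra.
      apply Rmult_le_compat_r with (r := P) in HB; [|lra].
      unfold Rdiv in HB. rewrite Rmult_assoc, Rinv_l in HB by lra. nra. }
    assert (Hu1 := Hu P1 u1 HP1 ltac:(nra) B1). assert (Hu2 := Hu P2 u2 HP2 ltac:(nra) B2).
    apply Rmax3_lub; [lra|lra|].
    apply Rle_trans with (Rabs (P1 * P2 * (IZR u1 * f t + IZR u2 * g t + IZR u3)) + M); [|lra].
    apply Hstep. rewrite HPQ.
    replace (Q * (IZR u1 * f s + IZR u2 * g s + IZR u3) - Q * (IZR u1 * f t + IZR u2 * g t + IZR u3))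
      with (Q * (IZR u1 * (f s - f t) + IZR u2 * (g s - g t))) by ring.
    rewrite Rabs_mult, (Rabs_pos_eq Q) by lra.
    assert (Rabs (IZR u1 * (f s - f t)) <= M * Q * d)
      by (apply Rabs_mult_le; assumption).
    assert (Rabs (IZR u2 * (g s - g t)) <= M * Q * d)
      by (apply Rabs_mult_le; assumption).
    apply Rle_trans with (Q * (2 * (M * Q * d))).
    + apply Rmult_le_compat_l; [lra|]. eapply Rle_trans; [apply Rabs_triang|]. lra.
    + replace (Q * (2 * (M * Q * d))) with (2 * M * (Q * Q * d)) by ring. rewrite HdQ. lra.
Qed.

(** The loss [C] for dual vectors plus the loss [1 + 2 C / c1] for integer points, so that one
    threshold serves both kinds. *)
Definition goodness_const : R := C + (1 + 2 * C / c1).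

Lemma goodness_const_ge : C <= goodness_const /\ 1 + 2 * C / c1 <= goodness_const /\
  1 <= goodness_const.
Proof.
  unfold goodness_const. pose proof (nc_C HC).
  pose proof (nc_c1 HC).
  assert (0 <= 2 * C / c1).
  { apply Rmult_le_pos; [lra|]. apply Rinv_nonneg. lra. }
  lra.
Qed.

(** By contraposition: four points with gaps [la (b - a)] where the norm is below the threshold
    would keep it at most [rho] on all of [[a, b]]. The square of [la] in the threshold compensates
    the square in [nc_good], and [6 la] is the cover of a set without such a chain, three intervals
    of twice the gap. *)
Lemma curve_norm_good (Q rho la : R) (i : bool) (u : Z3) (a b : R) :
  1 <= Q -> 0 < rho -> 0 < la <= 1 -> lo <= a -> a < b -> b <= hi ->
  (exists s, a <= s <= b /\ rho < curve_norm Q i s u) ->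
  covered (fun s => a <= s <= b /\ curve_norm Q i s u < rho * la ^ 2 / goodness_const)
    (6 * la * (b - a)).
Proof.
  intros HQ Hrho [Hla Hla1] Ha Hab Hb [s0 [Hs0 Hs0']].
  assert (HP1 := Rpower_ge_1 Q r1 HQ ltac:(lra)).
  assert (HP2 := Rpower_ge_1 Q r2 HQ ltac:(lra)).
  assert (HPQ := Rpower_r1_r2 Q ltac:(lra)).
  pose proof (nc_C HC) as HCC.
  pose proof (nc_c1 HC) as Hc1.
  destruct goodness_const_ge as [G1 [G2 G3]].
  set (e := rho * la ^ 2 / goodness_const).
  assert (He : goodness_const * e = rho * la ^ 2) by (unfold e; field; lra).
  assert (Hla2 : 0 < la ^ 2 <= la) by (simpl; nra).
  assert (He0 : 0 < e).
  { unfold e. apply Rdiv_lt_0_compat; [apply Rmult_lt_0_compat; lra|lra]. }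
  assert (Herho : e <= rho) by nra.
  set (d := la * (b - a)). assert (Hd : 0 < d) by (apply Rmult_lt_0_compat; lra).
  apply covered_mono with (F := fun s => (a <= s <= b /\ curve_norm Q i s u < e) /\ a <= s)
    (m := 2 * INR 3 * d).
  2: { intros s Hs. tauto. }
  2: { unfold d. simpl. lra. }
  apply covered_no_chain; [exact Hd|].
  intros [s1 [[Hs1 N1] [O1 [s2 [[Hs2 N2] [O2 [s3 [[Hs3 N3] [O3 [s4 [[Hs4 N4] [O4 _]]]]]]]]]]]].
  apply Rlt_not_le in Hs0'. apply Hs0'. clear Hs0'.
  destruct u as [[u1 u2] u3]. unfold curve_norm in *. destruct i; unfold vnorm, wnorm in *.
  - set (P1 := Rpower Q r1) in *. set (P2 := Rpower Q r2) in *.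
    destruct (Rmax3_bounds (Rabs (P1 * (IZR u3 * f s1 - IZR u1)))
      (Rabs (P2 * (IZR u3 * g s1 - IZR u2))) (Rabs (IZR u3 / (P1 * P2)))) as [B1 [B2 B3]].
    destruct (Rmax3_bounds (Rabs (P1 * (IZR u3 * f s2 - IZR u1)))
      (Rabs (P2 * (IZR u3 * g s2 - IZR u2))) (Rabs (IZR u3 / (P1 * P2)))) as [B1' _].
    assert (Hq : P1 * Rabs (IZR u3) * (c1 * d) <= 2 * e).
    { pose proof (nc_low HC s1 s2 ltac:(lra) ltac:(lra)) as Hlow.
      rewrite (Rabs_pos_eq (s2 - s1)) in Hlow by lra.
      assert (Rabs (P1 * (IZR u3 * f s2 - IZR u1) - P1 * (IZR u3 * f s1 - IZR u1)) <= 2 * e).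
      { eapply Rle_trans; [apply Rabs_minus_le|]. lra. }
      replace (P1 * (IZR u3 * f s2 - IZR u1) - P1 * (IZR u3 * f s1 - IZR u1))
        with (P1 * IZR u3 * (f s2 - f s1)) in H by ring.
      rewrite !Rabs_mult, (Rabs_pos_eq P1) in H by lra.
      eapply Rle_trans; [|exact H]. apply Rmult_le_compat_l.
      - apply Rmult_le_pos; [lra|apply Rabs_pos].
      - apply Rle_trans with (c1 * (s2 - s1)); [|exact Hlow].
        apply Rmult_le_compat_l; lra. }
    assert (Hq' : P1 * Rabs (IZR u3) * (C * (b - a)) <= 2 * C / c1 * e / la).
    { apply Rle_trans with (P1 * Rabs (IZR u3) * (c1 * d) * (C / (c1 * la))).
      - right. unfold d. field. lra.
      - apply Rle_trans with (2 * e * (C / (c1 * la))).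
        + apply Rmult_le_compat_r; [|exact Hq].
          apply Rlt_le, Rdiv_lt_0_compat; [lra|]. apply Rmult_lt_0_compat; lra.
        + right. field. lra. }
    assert (Hla_inv : e / la <= rho / goodness_const).
    { unfold e. apply Rle_trans with (rho * la / goodness_const).
      - right. field. lra.
      - apply Rmult_le_compat_r; [apply Rinv_nonneg; lra|]. nra. }
    assert (Hfin : e + 2 * C / c1 * e / la <= rho).
    { apply Rle_trans with ((1 + 2 * C / c1) * (e / la)).
      - rewrite Rmult_plus_distr_r. apply Rplus_le_compat.
        + apply Rle_trans with (e * 1); [lra|]. unfold Rdiv. rewrite Rmult_1_l.
          apply Rmult_le_compat_l; [lra|]. rewrite <- Rinv_1. apply Rinv_le_contravar; lra.
        + right. field. lra.
      - apply Rle_trans with (goodness_const * (rho / goodness_const)).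
        + apply Rmult_le_compat; try lra.
          * assert (0 < 2 * C / c1) by (apply Rdiv_lt_0_compat; lra). lra.
          * apply Rdiv_nonneg; lra.
        + right. field. lra. }
    assert (Hstep : forall P x y p, 0 <= P -> Rabs (P * (IZR u3 * x - p)) <= e ->
      P * Rabs (IZR u3) * Rabs (y - x) <= 2 * C / c1 * e / la ->
      Rabs (P * (IZR u3 * y - p)) <= rho).
    { intros P x y p HP Hx Hy.
      replace (P * (IZR u3 * y - p)) with (P * (IZR u3 * x - p) + P * IZR u3 * (y - x)) by ring.
      eapply Rle_trans; [apply Rabs_triang|].
      rewrite (Rabs_mult (P * IZR u3)), (Rabs_mult P (IZR u3)), (Rabs_pos_eq P) by lra. lra. }
    assert (Habs : Rabs (s0 - s1) <= b - a) by (apply Rabs_le; lra).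
    pose proof (Rabs_pos (IZR u3)) as Hu3.
    apply Rmax3_lub.
    + apply (Hstep P1 (f s1)); [lra|lra|].
      eapply Rle_trans; [|exact Hq']. apply Rmult_le_compat_l; [nra|].
      eapply Rle_trans; [apply (nc_lipf HC s1 s0); lra|].
      apply Rmult_le_compat_l; lra.
    + apply (Hstep P2 (g s1)); [lra|lra|].
      (* The second coordinate borrows the bound of the first: either [Q^r2 <= Q^r1], or [g] does
         not move at all. *)
      destruct (nc_dir HC) as [Hdir|Hdir].
      * eapply Rle_trans; [|exact Hq']. apply Rmult_le_compat; [nra|apply Rabs_pos| |].
        -- apply Rmult_le_compat_r; [lra|]. apply Rle_Rpower; assumption.
        -- eapply Rle_trans; [apply (nc_lipg HC s1 s0); lra|].
           apply Rmult_le_compat_l; lra.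
      * destruct (Hdir s0 ltac:(lra)) as [-> _]. destruct (Hdir s1 ltac:(lra)) as [-> _].
        rewrite Rminus_diag, Rabs_R0, Rmult_0_r.
        apply Rlt_le. repeat apply Rmult_lt_0_compat; try lra; apply Rinv_0_lt_compat; lra.
    + lra.
  - set (P1 := Rpower Q r1) in *. set (P2 := Rpower Q r2) in *.
    destruct (Rmax3_bounds (Rabs (IZR u1 / P1)) (Rabs (IZR u2 / P2))
      (Rabs (P1 * P2 * (IZR u1 * f s1 + IZR u2 * g s1 + IZR u3)))) as [B1 [B2 _]].
    assert (HF : forall s, Rmax (Rmax (Rabs (IZR u1 / P1)) (Rabs (IZR u2 / P2)))
        (Rabs (P1 * P2 * (IZR u1 * f s + IZR u2 * g s + IZR u3))) < e ->
        Rabs (IZR u1 * f s + IZR u2 * g s + IZR u3) <= e / Q).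
    { intros s Hs.
      destruct (Rmax3_bounds (Rabs (IZR u1 / P1)) (Rabs (IZR u2 / P2))
        (Rabs (P1 * P2 * (IZR u1 * f s + IZR u2 * g s + IZR u3)))) as [_ [_ B]].
      rewrite HPQ, Rabs_mult, (Rabs_pos_eq Q) in B by lra.
      apply Rmult_le_reg_l with Q; [lra|].
      replace (Q * (e / Q)) with e by (field; lra). rewrite HPQ in Hs.
      rewrite Rabs_mult, (Rabs_pos_eq Q) in Hs by lra. lra. }
    apply HF in N2 as F2. apply HF in N3 as F3. apply HF in N4 as F4. apply HF in N1 as F1.
    assert (He' : 0 <= e / Q) by (apply Rdiv_nonneg; lra).
    pose proof (nc_good HC (IZR u1) (IZR u2) (IZR u3) a b (e / Q) d
      s1 s2 s3 s4 Ha Hb He' Hd ltac:(lra) O2 O3 O4 ltac:(lra) F1 F2 F3 F4 s0 Hs0) as Hg.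
    apply Rmax3_lub; [lra|lra|].
    rewrite HPQ, Rabs_mult, (Rabs_pos_eq Q) by lra.
    apply Rle_trans with (Q * (C * (e / Q) * ((b - a) / d) ^ 2)).
    + apply Rmult_le_compat_l; lra.
    + replace (Q * (C * (e / Q) * ((b - a) / d) ^ 2)) with (C * (e / la ^ 2))
        by (unfold d; field; lra).
      unfold e.
      replace (C * (rho * la ^ 2 / goodness_const / la ^ 2)) with (rho * (C / goodness_const))
        by (field; lra).
      rewrite <- (Rmult_1_r rho) at 2. apply Rmult_le_compat_l; [lra|].
      apply Rmult_le_reg_r with goodness_const; [lra|].
      rewrite Rdiv_mult_cancel by lra. lra.
Qed.

Lemma curve_norm_system (Q rho la : R) :
  Q0 <= Q -> 1 <= Q -> 0 < rho -> rho <= rho0 -> rho <= 1 / 4 ->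
  rho <= c1 * (hi - lo) / 8 -> 0 < la <= 1 ->
  norm_system lo hi rho (rho * la ^ 2 / goodness_const) (6 * la) (curve_norm Q).
Proof.
  intros HQ0 HQ Hrho Hr0 Hr4 Hr8 Hla.
  assert (HP1 := Rpower_pos Q r1). assert (HP2 := Rpower_pos Q r2).
  constructor.
  - intros [] s [[u1 u2] u3]; unfold curve_norm, vnorm, wnorm;
      (eapply Rle_trans; [apply Rabs_pos|apply Rmax_r]).
  - intros [] s k u; unfold curve_norm; [apply vnorm_zscal|apply wnorm_zscal].
  - intros [] s u v Huv; unfold curve_norm; simpl.
    + rewrite Rmult_comm with (r1 := vnorm _ _ _ _ _).
      apply norm_pairing; auto. rewrite zdot_comm. exact Huv.
    + apply norm_pairing; auto.
  - intros [] s u v; unfold curve_norm; simpl; [apply wnorm_zcross|apply vnorm_zcross]; auto.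
  - intros i u a b _ Ha Hab Hb Hex. apply curve_norm_good; assumption.
  - apply curve_norm_dist. exact HQ.
  - intros [] u Hu; unfold curve_norm.
    + apply vnorm_top; assumption.
    + destruct (nc_top HC Q u HQ0 HQ Hu) as [s [Hs Hs']].
      exists s. split; [exact Hs|lra].
Qed.

Definition short_vector (Q eta s : R) : Prop :=
  exists u, u <> zzero /\
    (vnorm (Rpower Q r1) (Rpower Q r2) (f s) (g s) u < eta \/
     wnorm (Rpower Q r1) (Rpower Q r2) (f s) (g s) u < eta).

Lemma nondivergence (m : R) : 0 < m ->
  exists eta, 0 < eta /\ forall Q, Q0 <= Q -> 1 <= Q ->
    covered (fun s => lo <= s <= hi /\ short_vector Q eta s) m.
Proof.
  intros Hm.
  pose proof (nc_lt HC) as Hlt.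
  pose proof (nc_c1 HC) as Hc1.
  pose proof (nc_rho0 HC) as Hr0.
  destruct goodness_const_ge as [_ [_ G3]].
  set (rho := Rmin rho0 (Rmin (1 / 4) (c1 * (hi - lo) / 8))).
  assert (Hrho : 0 < rho).
  { unfold rho. assert (0 < c1 * (hi - lo)) by (apply Rmult_lt_0_compat; lra).
    repeat apply Rmin_glb_lt; lra. }
  assert (Ha : rho <= rho0) by apply Rmin_l.
  assert (Hb : rho <= 1 / 4) by (unfold rho; eapply Rle_trans; [apply Rmin_r|apply Rmin_l]).
  assert (Hc : rho <= c1 * (hi - lo) / 8)
    by (unfold rho; eapply Rle_trans; [apply Rmin_r|apply Rmin_r]).
  (* The 24 is 4 times 6: four from the two-stage marking, six from the goodness estimate. *)
  set (la := Rmin (1 / 2) (m / (24 * (hi - lo)))).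
  assert (Hla : 0 < la).
  { apply Rmin_glb_lt; [lra|]. apply Rdiv_lt_0_compat; lra. }
  assert (Hla1 : la <= 1 / 2) by apply Rmin_l.
  assert (Hlam : 24 * la * (hi - lo) <= m).
  { assert (la <= m / (24 * (hi - lo))) by apply Rmin_r.
    apply Rmult_le_compat_r with (r := 24 * (hi - lo)) in H; [|lra].
    unfold Rdiv in H. rewrite Rmult_assoc, Rinv_l in H by lra. lra. }
  assert (Hla2 : 0 < la ^ 2 <= 1 / 4) by (simpl; nra).
  exists (rho * la ^ 2 / goodness_const). split.
  { apply Rdiv_lt_0_compat; [apply Rmult_lt_0_compat|]; lra. }
  intros Q HQ0 HQ.
  pose proof (curve_norm_system Q rho la HQ0 HQ Hrho Ha Hb Hc ltac:(lra)) as HS.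
  assert (Hcov := short_cover lo hi rho (rho * la ^ 2 / goodness_const) (6 * la) (curve_norm Q) HS).
  apply covered_mono with (m := 4 * (6 * la) * (hi - lo))
    (F := fun s => lo <= s <= hi /\ short_at (rho * la ^ 2 / goodness_const) (curve_norm Q) s).
  - apply Hcov; try lra.
    + apply Rdiv_lt_0_compat; [apply Rmult_lt_0_compat|]; lra.
    + apply Rle_trans with (rho * la ^ 2 / 1).
      * apply Rmult_le_compat_l; [nra|]. apply Rinv_le_contravar; lra.
      * nra.
  - intros s [Hs [u [Hu [Hv|Hw]]]]; split; try exact Hs; [exists true, u|exists false, u]; tauto.
  - lra.
Qed.

End NiceNorms.

(** * Pigeonhole: Dirichlet approximation and orthogonal integer vectors *)

Lemma pigeonhole (h : nat -> nat) (n k : nat) :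
  (forall i, (i < n)%nat -> (h i < k)%nat) -> (k < n)%nat ->
  exists i j, (i < j)%nat /\ (j < n)%nat /\ h i = h j.
Proof.
  intros Hh Hkn. apply NNPP. intros Hn.
  assert (Hnd : NoDup (map h (seq 0 n))).
  { apply NoDup_map_NoDup_ForallPairs; [|apply seq_NoDup].
    intros i j Hi Hj Hij. apply in_seq in Hi, Hj.
    destruct (Nat.lt_trichotomy i j) as [H|[H|H]]; [|exact H|]; exfalso; apply Hn.
    - exists i, j. repeat split; auto; lia.
    - exists j, i. repeat split; auto; lia. }
  assert (Hincl : incl (map h (seq 0 n)) (seq 0 k)).
  { intros x Hx. apply in_map_iff in Hx. destruct Hx as [i [<- Hi]]. apply in_seq in Hi.
    apply in_seq. specialize (Hh i ltac:(lia)). lia. }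
  pose proof (NoDup_incl_length Hnd Hincl) as Hl. rewrite length_map, !length_seq in Hl. lia.
Qed.

Definition natfloor (x : R) : nat := Z.to_nat (Int_part x).

Lemma natfloor_spec (x : R) : 0 <= x -> INR (natfloor x) <= x < INR (natfloor x) + 1.
Proof.
  intros Hx. destruct (base_Int_part x) as [H1 H2].
  assert (0 <= Int_part x)%Z.
  { assert (-1 < Int_part x)%Z; [|lia]. apply lt_IZR. lra. }
  unfold natfloor. rewrite INR_IZR_INZ, Z2Nat.id by assumption. lra.
Qed.

Lemma natfloor_le (x y : R) : 0 <= x -> x <= y -> (natfloor x <= natfloor y)%nat.
Proof.
  intros Hx Hxy. destruct (natfloor_spec x Hx). destruct (natfloor_spec y ltac:(lra)).
  assert (natfloor x < S (natfloor y))%nat; [|lia]. apply INR_lt. rewrite S_INR. lra.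
Qed.

Lemma natfloor_eq (x y : R) : 0 <= x -> 0 <= y -> natfloor x = natfloor y -> Rabs (x - y) <= 1.
Proof.
  intros Hx Hy E. destruct (natfloor_spec x Hx). destruct (natfloor_spec y Hy).
  rewrite E in *. apply Rabs_le. lra.
Qed.

Lemma pair_code_inj (N i j i' j' : nat) :
  (j < N)%nat -> (j' < N)%nat -> (i * N + j = i' * N + j')%nat -> i = i' /\ j = j'.
Proof.
  intros Hj Hj' E.
  assert (i = i').
  { apply (f_equal (fun t => t / N)%nat) in E.
    rewrite !Nat.div_add_l, !Nat.div_small in E by lia. lia. }
  subst. split; [reflexivity|lia].
Qed.

Lemma pair_code_lt (N M i j : nat) : (i < M)%nat -> (j < N)%nat -> (i * N + j < M * N)%nat.
Proof. intros. nia. Qed.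

(** The box argument for fractional parts of the multiples of (al, be), sorted by the first
    coordinate and by the sheared second one. Before scaling by [w], the latter ranges over an
    interval of length [1 + 2 |ka|], which explains the count. *)
Lemma dirichlet (al be ka u w : R) (n : nat) :
  0 < u -> 0 < w -> (1 / u + 1) * ((1 + 2 * Rabs ka) / w + 1) < INR n ->
  exists q p1 p2 : Z, (0 < q)%Z /\ IZR q < INR n /\
    Rabs (IZR q * al - IZR p1) <= u /\
    Rabs ((IZR q * be - IZR p2) - ka * (IZR q * al - IZR p1)) <= w.
Proof.
  intros Hu Hw Hn.
  set (fr := fun (x : R) (i : nat) => INR i * x - IZR (Int_part (INR i * x))).
  assert (Hfr : forall x i, 0 <= fr x i < 1).
  { intros x i. unfold fr. destruct (base_Int_part (INR i * x)). lra. }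
  set (X := fun i => fr al i / u).
  set (Y := fun i => (fr be i - ka * fr al i + Rabs ka) / w).
  assert (HX : forall i, 0 <= X i <= 1 / u).
  { intros i. specialize (Hfr al i). unfold X. split.
    - apply Rmult_le_pos; [lra|]. apply Rinv_nonneg. lra.
    - apply Rmult_le_compat_r; [|lra]. apply Rinv_nonneg. lra. }
  assert (HY : forall i, 0 <= Y i <= (1 + 2 * Rabs ka) / w).
  { intros i. pose proof (Hfr al i) as Ha. pose proof (Hfr be i) as Hb. unfold Y.
    assert (Rabs (ka * fr al i) <= Rabs ka).
    { rewrite Rabs_mult, (Rabs_pos_eq (fr al i)) by lra.
      pose proof (Rabs_pos ka). nra. }
    apply Rabs_le_bounds in H. split.
    - apply Rmult_le_pos; [lra|]. apply Rinv_nonneg. lra.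
    - apply Rmult_le_compat_r; [|lra]. apply Rinv_nonneg. lra. }
  set (N1 := S (natfloor (1 / u))). set (N2 := S (natfloor ((1 + 2 * Rabs ka) / w))).
  assert (HN : (N1 * N2 < n)%nat).
  { apply INR_lt. rewrite mult_INR. unfold N1, N2. rewrite !S_INR.
    eapply Rle_lt_trans; [|exact Hn].
    assert (0 < 1 / u) by (apply Rdiv_lt_0_compat; lra).
    assert (0 < (1 + 2 * Rabs ka) / w).
    { apply Rdiv_lt_0_compat; [|lra]. pose proof (Rabs_pos ka). lra. }
    destruct (natfloor_spec (1 / u)); [lra|].
    destruct (natfloor_spec ((1 + 2 * Rabs ka) / w)); [lra|].
    apply Rmult_le_compat; try lra; apply Rplus_le_le_0_compat; try lra; apply pos_INR. }
  destruct (pigeonhole (fun i => natfloor (X i) * N2 + natfloor (Y i))%nat n (N1 * N2))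
    as [i [j [Hij [Hjn E]]]]; [|exact HN|].
  { intros i _. apply pair_code_lt; apply Nat.lt_succ_r; apply natfloor_le;
      first [apply HX | apply HY]. }
  apply pair_code_inj in E;
    [| apply Nat.lt_succ_r; apply natfloor_le; apply HY
     | apply Nat.lt_succ_r; apply natfloor_le; apply HY].
  destruct E as [EX EY].
  apply natfloor_eq in EX; [|apply HX|apply HX]. apply natfloor_eq in EY; [|apply HY|apply HY].
  exists (Z.of_nat j - Z.of_nat i)%Z,
    (Int_part (INR j * al) - Int_part (INR i * al))%Z,
    (Int_part (INR j * be) - Int_part (INR i * be))%Z.
  rewrite !minus_IZR, <- !INR_IZR_INZ.
  split; [lia|]. split.
  { apply lt_INR in Hjn. pose proof (pos_INR i). lra. }
  split.
  - replace ((INR j - INR i) * al - (IZR (Int_part (INR j * al)) - IZR (Int_part (INR i * al))))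
      with (- (u * (X i - X j))) by (unfold X, fr; field; lra).
    rewrite Rabs_Ropp, Rabs_mult, (Rabs_pos_eq u) by lra. nra.
  - replace (_ - ka * _) with (- (w * (Y i - Y j))) by (unfold Y, fr; field; lra).
    rewrite Rabs_Ropp, Rabs_mult, (Rabs_pos_eq w) by lra. nra.
Qed.

(** Siegel's lemma for one equation: there are more than [U V >= q] pairs (A, B) in the box, so two
    of them give the same residue of [A p1 + B p2] modulo [q], and C absorbs the multiple of [q]. A
    number [t] encodes the pair [(t / N, t mod N)]. *)
Lemma orthogonal_pigeonhole (p1 p2 q : Z) (U V : R) :
  (0 < q)%Z -> 0 <= U -> 0 <= V -> IZR q <= U * V ->
  exists A B C : Z, (A, B, C) <> zzero /\ zdot (A, B, C) (p1, p2, q) = 0%Z /\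
    Rabs (IZR A) <= U /\ Rabs (IZR B) <= V.
Proof.
  intros Hq HU HV HUV.
  set (M := S (natfloor U)). set (N := S (natfloor V)).
  destruct (natfloor_spec U HU) as [U1 U2]. destruct (natfloor_spec V HV) as [V1 V2].
  assert (HN : (Z.to_nat q < M * N)%nat).
  { apply INR_lt. rewrite mult_INR. unfold M, N. rewrite !S_INR.
    rewrite INR_IZR_INZ, Z2Nat.id by lia.
    
    eapply Rle_lt_trans; [exact HUV|].
    apply Rle_lt_trans with (U * (INR (natfloor V) + 1)); [apply Rmult_le_compat_l; lra|].
    apply Rmult_lt_compat_r; lra. }
  set (val := fun t : nat => (Z.of_nat (t / N) * p1 + Z.of_nat (t mod N) * p2)%Z).
  destruct (pigeonhole (fun t => Z.to_nat (val t mod q)) (M * N) (Z.to_nat q))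
    as [i [j [Hij [Hjn E]]]]; [|exact HN|].
  { intros t _. cbv beta. pose proof (Z.mod_pos_bound (val t) q Hq). lia. }
  assert (E' : (val j mod q = val i mod q)%Z).
  { cbv beta in E. pose proof (Z.mod_pos_bound (val i) q Hq). pose proof (Z.mod_pos_bound (val j) q Hq). lia. }
  pose proof (Z.div_mod (val i) q ltac:(lia)) as Di.
  pose proof (Z.div_mod (val j) q ltac:(lia)) as Dj.
  exists (Z.of_nat (j / N) - Z.of_nat (i / N))%Z, (Z.of_nat (j mod N) - Z.of_nat (i mod N))%Z,
    (val i / q - val j / q)%Z.
  assert (HjM : (j / N < M)%nat) by (apply Nat.Div0.div_lt_upper_bound; lia).
  assert (HiM : (i / N < M)%nat) by (apply Nat.Div0.div_lt_upper_bound; lia).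
  assert (HjN : (j mod N < N)%nat) by (apply Nat.mod_upper_bound; unfold N; lia).
  assert (HiN : (i mod N < N)%nat) by (apply Nat.mod_upper_bound; unfold N; lia).
  pose proof (Nat.div_mod_eq i N) as Ei. pose proof (Nat.div_mod_eq j N) as Ej.
  assert (Habs : forall (a b c : nat) (x : R), (a < S c)%nat -> (b < S c)%nat -> INR c <= x ->
    Rabs (IZR (Z.of_nat a - Z.of_nat b)) <= x).
  { intros a b c x Ha Hb Hx. rewrite minus_IZR, <- !INR_IZR_INZ.
    assert (Ha' : (a <= c)%nat) by lia. assert (Hb' : (b <= c)%nat) by lia.
    apply le_INR in Ha', Hb'.
    pose proof (pos_INR a). pose proof (pos_INR b). apply Rabs_le. lra. }
  split; [|split; [|split]].
  - intros H. unfold zzero in H.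
    pose proof (f_equal (fun t : Z3 => fst (fst t)) H) as H1. cbn beta iota delta [fst] in H1.
    pose proof (f_equal (fun t : Z3 => snd (fst t)) H) as H2. cbn beta iota delta [fst snd] in H2.
    assert (G1 : (j / N = i / N)%nat) by lia. assert (G2 : (j mod N = i mod N)%nat) by lia.
    rewrite G1, G2 in Ej. lia.
  - unfold zdot.
    transitivity (val j - val i - q * (val j / q) + q * (val i / q))%Z; [|lia].
    unfold val at 3 4. ring.
  - apply (Habs _ _ (natfloor U)); assumption.
  - apply (Habs _ _ (natfloor V)); assumption.
Qed.

(** * From nondivergence to an almost critical lattice *)

Lemma Rpower_inv (x r : R) : 0 < x -> Rpower (/ x) r = / Rpower x r.
Proof.
  intros Hx. assert (H := Rpower_mult_distr x (/ x) r Hx (Rinv_0_lt_compat _ Hx)).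
  rewrite Rinv_r in H by lra.
  assert (E : Rpower 1 r = 1) by (unfold Rpower; rewrite ln_1, Rmult_0_r; apply exp_0).
  rewrite E in H. pose proof (Rpower_pos x r).
  apply Rmult_eq_reg_l with (Rpower x r); [|lra]. rewrite H. field. lra.
Qed.

Lemma Rpower_le_mono (x y r : R) : 0 < x -> x <= y -> 0 <= r -> Rpower x r <= Rpower y r.
Proof. intros. apply Rle_Rpower_l; [assumption|split; assumption]. Qed.

Lemma small_power (r l : R) : 0 < r -> 0 < l ->
  exists T, 0 < T <= 1 /\ forall t, 0 < t <= T -> Rpower t r <= l.
Proof.
  intros Hr Hl. exists (Rmin 1 (Rpower l (/ r))).
  assert (H := Rpower_pos l (/ r)).
  split; [split; [apply Rmin_glb_lt; lra|apply Rmin_l]|].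
  intros t [Ht1 Ht2].
  apply Rle_trans with (Rpower (Rpower l (/ r)) r).
  - apply Rpower_le_mono; [lra| |lra]. eapply Rle_trans; [exact Ht2|apply Rmin_r].
  - rewrite Rpower_mult, Rinv_l, Rpower_1 by lra. lra.
Qed.

Lemma large_power (r L : R) : 0 < r -> exists T, forall Q, T <= Q -> 1 <= Q -> L <= Rpower Q r.
Proof.
  intros Hr.
  destruct (small_power r (/ (Rabs L + 1)) Hr) as [T [[HT _] Hs]].
  { apply Rinv_0_lt_compat. pose proof (Rabs_pos L). lra. }
  exists (/ T). intros Q HQ HQ1.
  specialize (Hs (/ Q)). rewrite Rpower_inv in Hs by lra.
  assert (/ Rpower Q r <= / (Rabs L + 1)).
  { apply Hs. split; [apply Rinv_0_lt_compat; lra|].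
    rewrite <- (Rinv_inv T). apply Rinv_le_contravar; [apply Rinv_0_lt_compat; lra|lra]. }
  apply Rinv_le_contravar in H; [|apply Rinv_0_lt_compat, Rpower_pos].
  rewrite !Rinv_inv in H. pose proof (Rle_abs L). lra.
Qed.

Section Core.

Variables r1 r2 : R.
Hypothesis Hr1 : 0 < r1.
Hypothesis Hr2 : 0 < r2.
Hypothesis Hr : r1 + r2 = 1.

(** By Mahler's criterion, the lattice at time Q lies in a compact set that depends on [eta]
    only. *)
Definition no_short (al be Q eta : R) : Prop :=
  forall u, u <> zzero -> eta <= vnorm (Rpower Q r1) (Rpower Q r2) al be u /\
    eta <= wnorm (Rpower Q r1) (Rpower Q r2) al be u.

Lemma Rpower_time (Q t r : R) : 0 < Q -> 0 < t -> Rpower (Q * t) r = Rpower Q r * Rpower t r.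
Proof. intros. symmetry. apply Rpower_mult_distr; assumption. Qed.

(* In each of the next three lemmas, the flow of time t would make the excluded vector short. *)
Lemma no_dual_near_third (eta K : R) : 0 < eta -> 0 < K ->
  exists t nu, 0 < t /\ 0 < nu /\ forall al be Q A B C, 0 < Q ->
    no_short al be (Q * t) eta -> (A, B, C) <> zzero ->
    Rabs (IZR A / Rpower Q r1) <= nu -> Rabs (IZR B / Rpower Q r2) <= nu ->
    Rabs (Q * (IZR A * al + IZR B * be + IZR C)) <= K -> False.
Proof.
  (* Backward flow: the third dual coordinate is multiplied by [t], while the first two grow at most
     by the factor [1 / t]. *)
  intros Heta HK. set (t := Rmin 1 (eta / (2 * K))).
  assert (Ht : 0 < t) by (apply Rmin_glb_lt; [lra|apply Rdiv_lt_0_compat; lra]).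
  assert (Ht1 : t <= 1) by apply Rmin_l.
  assert (HtK : t * K <= eta / 2).
  { apply Rle_trans with (eta / (2 * K) * K); [apply Rmult_le_compat_r; [lra|apply Rmin_r]|].
    right. field. lra. }
  exists t, (eta * t / 2). split; [exact Ht|]. split; [nra|].
  intros al be Q A B C HQ Hns Hw Ha Hb Hc.
  destruct (Hns _ Hw) as [_ H]. apply Rle_not_lt in H. apply H. clear H.
  unfold wnorm. rewrite !Rpower_time by assumption.
  assert (Hp : forall r, 0 < r < 1 -> t <= Rpower t r).
  { intros r Hr'. assert (Hit := Rinv_0_lt_compat t Ht).
    replace (Rpower t r) with (/ Rpower (/ t) r)
      by (rewrite Rpower_inv by exact Ht; apply Rinv_inv).
    apply Rle_trans with (/ Rpower (/ t) 1).
    - right. rewrite Rpower_1, Rinv_inv by exact Hit. reflexivity.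
    - apply Rinv_le_contravar; [apply Rpower_pos|]. apply Rle_Rpower; [|lra].
      rewrite <- Rinv_1. apply Rinv_le_contravar; lra. }
  assert (Hq : forall r x P, 0 < r < 1 -> 0 < P -> Rabs (x / P) <= eta * t / 2 ->
    Rabs (x / (P * Rpower t r)) < eta).
  { intros r x P Hr' HP Hx. pose proof (Hp r Hr'). pose proof (Rpower_pos t r).
    replace (x / (P * Rpower t r)) with (x / P / Rpower t r) by (field; lra).
    rewrite Rabs_div_pos by assumption.
    apply Rmult_lt_reg_r with (Rpower t r); [assumption|].
    rewrite Rdiv_mult_cancel by lra. nra. }
  apply Rmax3_lub_lt.
  - apply Hq; [lra|apply Rpower_pos|exact Ha].
  - apply Hq; [lra|apply Rpower_pos|exact Hb].
  - replace (Rpower Q r1 * Rpower t r1 * (Rpower Q r2 * Rpower t r2))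
      with (Rpower Q r1 * Rpower Q r2 * (Rpower t r1 * Rpower t r2)) by ring.
    rewrite !Rpower_r1_r2 by assumption.
    replace (Q * t * _) with (t * (Q * (IZR A * al + IZR B * be + IZR C))) by ring.
    rewrite Rabs_mult, (Rabs_pos_eq t) by lra. nra.
Qed.

Lemma no_dual_near_plane (eta K : R) : 0 < eta -> 0 < K ->
  exists t nu, 0 < t /\ 0 < nu /\ forall al be Q A B C, 0 < Q ->
    no_short al be (Q * t) eta -> (A, B, C) <> zzero ->
    Rabs (IZR A / Rpower Q r1) <= K -> Rabs (IZR B / Rpower Q r2) <= K ->
    Rabs (Q * (IZR A * al + IZR B * be + IZR C)) <= nu -> False.
Proof.
  intros Heta HK.
  assert (Hl : 0 < eta / (2 * K)) by (apply Rdiv_lt_0_compat; lra).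
  destruct (small_power r1 _ Hr1 Hl) as [T1 [HT1 S1]].
  destruct (small_power r2 _ Hr2 Hl) as [T2 [HT2 S2]].
  set (T := Rmin T1 T2). assert (HT : 0 < T) by (apply Rmin_glb_lt; lra).
  assert (HTl : T <= T1) by apply Rmin_l. assert (HTr : T <= T2) by apply Rmin_r.
  assert (HiT : 0 < / T) by (apply Rinv_0_lt_compat; lra).
  (* Forward flow: the first two dual coordinates shrink by the factors [T^r1] and [T^r2], and the
     third grows by [1 / T], for which [eta * T / 2] leaves room. *)
  exists (/ T), (eta * T / 2). split; [exact HiT|]. split; [nra|].
  intros al be Q A B C HQ Hns Hw Ha Hb Hc.
  destruct (Hns _ Hw) as [_ H]. apply Rle_not_lt in H. apply H. clear H.
  unfold wnorm. rewrite !Rpower_time by assumption.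
  assert (Hq : forall r x P, Rpower T r <= eta / (2 * K) -> 0 < P -> Rabs (x / P) <= K ->
    Rabs (x / (P * Rpower (/ T) r)) < eta).
  { intros r x P Hr' HP Hx. pose proof (Rpower_pos T r). rewrite Rpower_inv by assumption.
    replace (x / (P * / Rpower T r)) with (Rpower T r * (x / P)) by (field; lra).
    rewrite Rabs_mult, (Rabs_pos_eq (Rpower T r)) by lra.
    apply Rle_lt_trans with (eta / (2 * K) * K).
    - apply Rmult_le_compat; auto using Rabs_pos. lra.
    - replace (eta / (2 * K) * K) with (eta / 2) by (field; lra). lra. }
  apply Rmax3_lub_lt.
  - apply Hq; [apply S1; lra|apply Rpower_pos|exact Ha].
  - apply Hq; [apply S2; lra|apply Rpower_pos|exact Hb].
  - replace (Rpower Q r1 * Rpower (/ T) r1 * (Rpower Q r2 * Rpower (/ T) r2))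
      with (Rpower Q r1 * Rpower Q r2 * (Rpower (/ T) r1 * Rpower (/ T) r2)) by ring.
    rewrite !Rpower_r1_r2 by assumption.
    replace (Q * / T * _) with (/ T * (Q * (IZR A * al + IZR B * be + IZR C))) by ring.
    rewrite Rabs_mult, (Rabs_pos_eq (/ T)) by lra.
    apply Rle_lt_trans with (/ T * (eta * T / 2)); [apply Rmult_le_compat_l; lra|].
    replace (/ T * (eta * T / 2)) with (eta / 2) by (field; lra). lra.
Qed.

Lemma no_vector_near_plane (eta K : R) : 0 < eta -> 0 < K ->
  exists t nu, 0 < t /\ 0 < nu /\ forall al be Q p1 p2 q, 0 < Q ->
    no_short al be (Q * t) eta -> (p1, p2, q) <> zzero ->
    Rabs (Rpower Q r1 * (IZR q * al - IZR p1)) <= K ->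
    Rabs (Rpower Q r2 * (IZR q * be - IZR p2)) <= K ->
    Rabs (IZR q / Q) <= nu -> False.
Proof.
  intros Heta HK.
  assert (Hl : 0 < eta / (2 * K)) by (apply Rdiv_lt_0_compat; lra).
  destruct (small_power r1 _ Hr1 Hl) as [T1 [HT1 S1]].
  destruct (small_power r2 _ Hr2 Hl) as [T2 [HT2 S2]].
  set (T := Rmin T1 T2). assert (HT : 0 < T) by (apply Rmin_glb_lt; lra).
  assert (HTl : T <= T1) by apply Rmin_l. assert (HTr : T <= T2) by apply Rmin_r.
  exists T, (eta * T / 2). split; [exact HT|]. split; [nra|].
  intros al be Q p1 p2 q HQ Hns Hv Hx Hy Hz.
  destruct (Hns _ Hv) as [H _]. apply Rle_not_lt in H. apply H. clear H.
  unfold vnorm. rewrite !Rpower_time by assumption.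
  assert (Hq : forall r x P, Rpower T r <= eta / (2 * K) -> 0 < P -> Rabs (P * x) <= K ->
    Rabs (P * Rpower T r * x) < eta).
  { intros r x P Hr' HP Hxx. pose proof (Rpower_pos T r).
    replace (P * Rpower T r * x) with (Rpower T r * (P * x)) by ring.
    rewrite Rabs_mult, (Rabs_pos_eq (Rpower T r)) by lra.
    apply Rle_lt_trans with (eta / (2 * K) * K).
    - apply Rmult_le_compat; auto using Rabs_pos. lra.
    - replace (eta / (2 * K) * K) with (eta / 2) by (field; lra). lra. }
  apply Rmax3_lub_lt.
  - apply Hq; [apply S1; lra|apply Rpower_pos|exact Hx].
  - apply Hq; [apply S2; lra|apply Rpower_pos|exact Hy].
  - replace (Rpower Q r1 * Rpower T r1 * (Rpower Q r2 * Rpower T r2))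
      with (Rpower Q r1 * Rpower Q r2 * (Rpower T r1 * Rpower T r2)) by ring.
    rewrite !Rpower_r1_r2 by assumption.
    replace (IZR q / (Q * T)) with (IZR q / Q / T) by (field; lra).
    rewrite Rabs_div_pos by exact HT.
    apply Rmult_lt_reg_r with T; [exact HT|].
    rewrite Rdiv_mult_cancel by lra. nra.
Qed.

(* The time at which a vector with second coordinate y gets second coordinate 1. *)
Definition exit_time (y : R) : R := Rpower y (- / r2).

Lemma exit_time_r2 (y : R) : 0 < y -> Rpower (exit_time y) r2 = / y.
Proof.
  intros Hy. unfold exit_time. rewrite Rpower_mult.
  replace (- / r2 * r2) with (- (1)) by (field; lra).
  rewrite Rpower_Ropp, Rpower_1 by exact Hy. reflexivity.
Qed.

Lemma exit_time_r1 (y : R) : 0 < y -> Rpower (exit_time y) r1 = / Rpower y (r1 / r2).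
Proof.
  intros Hy. unfold exit_time. rewrite Rpower_mult, <- Rpower_Ropp.
  f_equal. field. lra.
Qed.

Lemma exit_time_pos (y : R) : 0 < exit_time y.
Proof. apply Rpower_pos. Qed.

Lemma exit_time_le (y y' : R) : 0 < y -> y <= y' -> exit_time y' <= exit_time y.
Proof.
  intros Hy Hyy. unfold exit_time. rewrite !Rpower_Ropp.
  apply Rinv_le_contravar; [apply Rpower_pos|]. apply Rpower_le_mono; try assumption.
  apply Rinv_nonneg. exact Hr2.
Qed.

Lemma exit_time_ge_1 (y : R) : 0 < y -> y <= 1 -> 1 <= exit_time y.
Proof.
  intros Hy Hy1. replace 1 with (exit_time 1); [apply exit_time_le; assumption|].
  unfold exit_time, Rpower. rewrite ln_1, Rmult_0_r. apply exp_0.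
Qed.

(* The expansion makes the unipotent x -> x + s z available, up to the shear
   (x, y) -> (x, y - ka x), so that y - ka x is the coordinate that it leaves invariant. *)
Lemma find_dual (eps eta K Z0 km : R) :
  0 < eps -> 0 < eta -> 0 < K -> 0 < Z0 -> 0 <= km ->
  exists t de, 0 < t /\ 0 < de <= 1 /\ forall al be Q ka x y z p1 p2 q,
    0 < Q -> Rabs ka <= km -> no_short al be (Q * t) eta -> (0 < q)%Z ->
    x = Rpower Q r1 * (IZR q * al - IZR p1) -> y = Rpower Q r2 * (IZR q * be - IZR p2) ->
    z = IZR q / Q ->
    0 < Rabs (y - ka * x) <= de -> z <= Z0 -> Rabs x * Rabs (y - ka * x) <= K ->
    exists A B C, zprimitive (A, B, C) /\ zdot (A, B, C) (p1, p2, q) = 0%Z /\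
      let a := IZR A / Rpower Q r1 + ka * (IZR B / Rpower Q r2) in
      let U := Rpower (exit_time (Rabs (y - ka * x))) r1 in
      Rabs a <= eps * U /\
      2 / eps ^ 2 * (z * Rabs (y - ka * x)) <= Rabs a /\
      Rabs (IZR B / Rpower Q r2) * U <= 2 / eps * z.
Proof.
  intros Heps Heta HK HZ0 Hkm.
  assert (Heps2 : 0 < eps ^ 2) by (apply pow_lt; exact Heps).
  assert (H2e : 0 < 2 / eps) by (apply Rdiv_lt_0_compat; lra).
  assert (H2e2 : 0 < 2 / eps ^ 2) by (apply Rdiv_lt_0_compat; lra).
  (* The bound on the third coordinate [c] of w in case [a + ka b] is too small, read off from
     [c z = (a + ka b) x + b (y - ka x)], one summand per term. *)
  set (K1 := 2 / eps ^ 2 * K + 2 / eps).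
  assert (HK1 : 0 < K1) by (unfold K1; nra).
  destruct (no_dual_near_third eta K1 Heta HK1) as [t [nu [Ht [Hnu Hexcl]]]].
  (* A bound for [1 / U], reached once the invariant coordinate is small: it makes [|ka b|] at most
     [eps / 2], and both [|b|] and [|ka b|] at most [nu / 2]. *)
  set (l := Rmin 1 (Rmin (eps / 2 / (km * (2 / eps) * Z0 + 1))
                         (nu / 2 / ((1 + km) * (2 / eps) * Z0)))).
  assert (HkZ : 0 <= km * (2 / eps) * Z0) by (apply Rmult_le_pos; nra).
  assert (HkZ' : 0 < (1 + km) * (2 / eps) * Z0)
    by (apply Rmult_lt_0_compat; [apply Rmult_lt_0_compat|]; lra).
  assert (Hl : 0 < l).
  { unfold l. repeat apply Rmin_glb_lt; [lra| |]; apply Rdiv_lt_0_compat; lra. }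
  assert (Hl1 : l <= 1) by apply Rmin_l.
  assert (Hl2 : l * (km * (2 / eps) * Z0) <= eps / 2).
  { apply Rle_trans with (l * (km * (2 / eps) * Z0 + 1)); [apply Rmult_le_compat_l; lra|].
    apply Rle_trans with (eps / 2 / (km * (2 / eps) * Z0 + 1) * (km * (2 / eps) * Z0 + 1)).
    - apply Rmult_le_compat_r; [lra|]. unfold l. eapply Rle_trans; [apply Rmin_r|apply Rmin_l].
    - right. field. split; [lra|]. apply Rgt_not_eq.
      replace (km * 2 * Z0 + eps) with (eps * (km * (2 / eps) * Z0 + 1)) by (field; lra).
      apply Rmult_lt_0_compat; lra. }
  assert (Hl3 : l * ((1 + km) * (2 / eps) * Z0) <= nu / 2).
  { apply Rle_trans with (nu / 2 / ((1 + km) * (2 / eps) * Z0) * ((1 + km) * (2 / eps) * Z0)).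
    - apply Rmult_le_compat_r; [lra|]. unfold l. eapply Rle_trans; [apply Rmin_r|apply Rmin_r].
    - right. field. lra. }
  destruct (small_power (r1 / r2) l (Rdiv_lt_0_compat _ _ Hr1 Hr2) Hl) as [d1 [Hd1 Hsm]].
  set (de := Rmin d1 (nu / 2 / (2 / eps ^ 2 * Z0))).
  assert (Hde : 0 < de).
  { apply Rmin_glb_lt; [lra|]. apply Rdiv_lt_0_compat; [lra|]. apply Rmult_lt_0_compat; lra. }
  assert (Hde1 : de <= d1) by apply Rmin_l.
  assert (Hde2 : 2 / eps ^ 2 * Z0 * de <= nu / 2).
  { apply Rle_trans with (2 / eps ^ 2 * Z0 * (nu / 2 / (2 / eps ^ 2 * Z0))).
    - apply Rmult_le_compat_l; [nra|apply Rmin_r].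
    - right. field. lra. }
  exists t, de. split; [exact Ht|]. split; [lra|].
  intros al be Q ka x y z p1 p2 q HQ Hka Hns Hq Ex Ey Ez HY HzZ HxY.
  set (Y := Rabs (y - ka * x)) in *.
  set (U := Rpower (exit_time Y) r1).
  assert (HU : 0 < U) by apply Rpower_pos.
  assert (HUl : / U <= l).
  { unfold U. rewrite exit_time_r1, Rinv_inv by lra. apply Hsm. lra. }
  assert (HiU : 0 < / U) by (apply Rinv_0_lt_compat; exact HU).
  assert (HU1 : 1 <= U).
  { rewrite <- (Rinv_inv U), <- Rinv_1. apply Rinv_le_contravar; lra. }
  assert (HqR : 0 < IZR q) by (apply IZR_lt; exact Hq).
  assert (Hz : 0 < z) by (rewrite Ez; apply Rdiv_lt_0_compat; assumption).
  assert (HP1 := Rpower_pos Q r1). assert (HP2 := Rpower_pos Q r2).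
  assert (HPQ := Rpower_r1_r2 r1 r2 Hr Q HQ).
  set (P1 := Rpower Q r1) in *. set (P2 := Rpower Q r2) in *.
  (* In expanded coordinates the sides are [eps U / 2], to be divided by [U] up to the exit time,
     and [2 z / (eps U)]; their product is [z], exactly what the pigeonhole demands. *)
  destruct (orthogonal_pigeonhole p1 p2 q (eps / 2 * U * P1) (2 / eps * (z / U) * P2))
    as [A0 [B0 [C0 [Hw0 [Hdot0 [HA0 HB0]]]]]].
  { exact Hq. }
  { apply Rlt_le. repeat apply Rmult_lt_0_compat; lra. }
  { apply Rlt_le. repeat apply Rmult_lt_0_compat; try lra; apply Rinv_0_lt_compat; lra. }
  { right. replace (eps / 2 * U * P1 * (2 / eps * (z / U) * P2)) with (z * (P1 * P2))
      by (field; lra). rewrite HPQ, Ez. field. lra. }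
  destruct (primitive_factor _ Hw0) as [k [[[A B] C] [Hw [Hk Hk1]]]].
  exists A, B, C. split; [exact Hw|].
  assert (Hdot : zdot (A, B, C) (p1, p2, q) = 0%Z).
  { rewrite Hk in Hdot0. rewrite zdot_comm, zdot_zscal_r in Hdot0.
    apply Z.mul_eq_0 in Hdot0. rewrite zdot_comm. lia. }
  split; [exact Hdot|].
  unfold zscal in Hk. injection Hk as EA EB EC.
  assert (Hk' : forall b c m, c = (k * b)%Z -> Rabs (IZR c) <= m -> Rabs (IZR b) <= m).
  { intros b c m -> Hm. rewrite mult_IZR, Rabs_mult in Hm.
    assert (1 <= Rabs (IZR k)) by (apply Rabs_IZR_ge_1; lia).
    pose proof (Rabs_pos (IZR b)). nra. }
  apply (Hk' A) in HA0; [|exact EA]. apply (Hk' B) in HB0; [|exact EB].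
  set (a := IZR A / P1). set (b := IZR B / P2).
  assert (Ha : Rabs a <= eps / 2 * U).
  { unfold a. rewrite Rabs_div_pos by exact HP1.
    apply Rmult_le_reg_r with P1; [exact HP1|].
    rewrite Rdiv_mult_cancel by lra. lra. }
  assert (Hb : Rabs b <= 2 / eps * z * / U).
  { unfold b. rewrite Rabs_div_pos by exact HP2.
    apply Rmult_le_reg_r with P2; [exact HP2|].
    rewrite Rdiv_mult_cancel by lra. unfold Rdiv in HB0 |- *. lra. }
  assert (Hkb : Rabs (ka * b) <= km * (2 / eps * Z0 * / U)).
  { apply Rabs_mult_le; auto using Rabs_pos.
    eapply Rle_trans; [exact Hb|]. apply Rmult_le_compat_r; [lra|].
    apply Rmult_le_compat_l; lra. }
  cbv zeta.
  split; [|split].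
  - eapply Rle_trans; [apply Rabs_triang|].
    assert (km * (2 / eps * Z0 * / U) <= eps / 2).
    { replace (km * (2 / eps * Z0 * / U)) with (/ U * (km * (2 / eps) * Z0)) by ring.
      eapply Rle_trans; [|exact Hl2]. apply Rmult_le_compat_r; assumption. }
    assert (eps / 2 <= eps / 2 * U) by nra. lra.
  (* Were [a + ka b] smaller, w would be within [nu] of the third axis with third coordinate at most
     [K1], which the lattice at time [Q t] forbids. *)
  - apply Rnot_lt_le. intros Hlt.
    apply (Hexcl al be Q A B C HQ Hns (primitive_neq_0 _ Hw)).
    + fold P1 a. replace a with (a + ka * b + - (ka * b)) by ring.
      eapply Rle_trans; [apply Rabs_triang|]. rewrite Rabs_Ropp.
      assert (2 / eps ^ 2 * (z * Y) <= nu / 2).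
      { eapply Rle_trans; [|exact Hde2]. rewrite Rmult_assoc.
        apply Rmult_le_compat_l; [lra|]. apply Rmult_le_compat; lra. }
      assert (km * (2 / eps * Z0 * / U) <= nu / 2).
      { eapply Rle_trans; [|exact Hl3].
        replace (km * (2 / eps * Z0 * / U)) with (/ U * (km * (2 / eps) * Z0)) by ring.
        apply Rmult_le_compat; try lra.
        apply Rmult_le_compat_r; [lra|]. apply Rmult_le_compat_r; lra. }
      lra.
    + fold P2 b. eapply Rle_trans; [exact Hb|].
      apply Rle_trans with (l * ((1 + km) * (2 / eps) * Z0)); [|lra].
      replace (2 / eps * z * / U) with (/ U * (1 * (2 / eps) * z)) by ring.
      apply Rmult_le_compat; try lra.
      * apply Rlt_le. repeat apply Rmult_lt_0_compat; lra.
      * apply Rmult_le_compat; try lra. apply Rmult_le_compat_r; lra.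
    + set (c := Q * (IZR A * al + IZR B * be + IZR C)).
      assert (Hcz : c * z = (a + ka * b) * x + b * (y - ka * x)).
      { unfold zdot in Hdot. apply (f_equal IZR) in Hdot.
        rewrite !plus_IZR, !mult_IZR in Hdot.
        transitivity (a * x + b * y); [|ring].
        unfold c, a, b. rewrite Ex, Ey, Ez.
        transitivity ((IZR A * al + IZR B * be + IZR C) * IZR q); [field; lra|].
        transitivity (IZR A * (IZR q * al - IZR p1) + IZR B * (IZR q * be - IZR p2)
          + (IZR A * IZR p1 + IZR B * IZR p2 + IZR C * IZR q)); [ring|].
        rewrite Hdot. field. lra. }
      apply Rmult_le_reg_r with z; [exact Hz|].
      replace (Rabs c * z) with (Rabs (c * z)) by (rewrite Rabs_mult, (Rabs_pos_eq z); lra).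
      rewrite Hcz. eapply Rle_trans; [apply Rabs_triang|].
      rewrite !Rabs_mult. fold Y.
      assert (Rabs (a + ka * b) * Rabs x <= 2 / eps ^ 2 * K * z).
      { apply Rle_trans with (2 / eps ^ 2 * (z * Y) * Rabs x).
        - apply Rmult_le_compat_r; [apply Rabs_pos|]. apply Rlt_le. exact Hlt.
        - replace (2 / eps ^ 2 * (z * Y) * Rabs x) with (2 / eps ^ 2 * z * (Rabs x * Y)) by ring.
          replace (2 / eps ^ 2 * K * z) with (2 / eps ^ 2 * z * K) by ring.
          apply Rmult_le_compat_l; [nra|exact HxY]. }
      assert (Rabs b * Y <= 2 / eps * z).
      { apply Rle_trans with (2 / eps * z * / U * 1).
        - apply Rmult_le_compat; auto using Rabs_pos; lra.
        - rewrite Rmult_1_r. rewrite <- (Rmult_1_r (2 / eps * z)) at 2.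
          apply Rmult_le_compat_l; [nra|]. lra. }
      unfold K1. lra.
  - fold P2 b. apply Rle_trans with (2 / eps * z * / U * U).
    + apply Rmult_le_compat_r; [lra|exact Hb].
    + right. field. lra.
Qed.

(** The alternative on [ka] says that the shear commutes with the flow, so that it can be applied
    before scaling. The factor 4 absorbs the two roundings in [dirichlet], both counts being at
    least 1. *)
Lemma dirichlet_scaled (al be Q ka R0 de : R) (n : nat) :
  1 <= Q -> ka = 0 \/ r1 = r2 -> 0 < R0 -> 0 < de <= 1 -> R0 <= Rpower Q r1 ->
  4 * (1 + 2 * Rabs ka) * Q / (R0 * de) < INR n ->
  exists p1 p2 q, zprimitive (p1, p2, q) /\ (0 < q)%Z /\ IZR q < INR n /\
    Rabs (Rpower Q r1 * (IZR q * al - IZR p1)) <= R0 /\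
    Rabs (Rpower Q r2 * (IZR q * be - IZR p2) - ka * (Rpower Q r1 * (IZR q * al - IZR p1)))
      <= de.
Proof.
  intros HQ Hka HR [Hde Hde1] HP1R Hn.
  assert (HP2 := Rpower_ge_1 Q r2 HQ ltac:(lra)).
  assert (HPQ := Rpower_r1_r2 r1 r2 Hr Q ltac:(lra)).
  assert (Hkk : ka * Rpower Q r1 = ka * Rpower Q r2).
  { destruct Hka as [->|E]; [ring|]. rewrite E. reflexivity. }
  set (P1 := Rpower Q r1) in *. set (P2 := Rpower Q r2) in *.
  pose proof (Rabs_pos ka) as Hka0.
  destruct (dirichlet al be ka (R0 / P1) (de / P2) n) as [q0 [a1 [a2 [Hq0 [Hqn [Hx Hy]]]]]].
  { apply Rdiv_lt_0_compat; lra. }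
  { apply Rdiv_lt_0_compat; lra. }
  { eapply Rle_lt_trans; [|exact Hn].
    replace (1 / (R0 / P1)) with (P1 / R0) by (field; lra).
    replace ((1 + 2 * Rabs ka) / (de / P2)) with ((1 + 2 * Rabs ka) * (P2 / de)) by (field; lra).
    assert (1 <= P1 / R0).
    { apply Rmult_le_reg_r with R0; [lra|].
      rewrite Rdiv_mult_cancel by lra. lra. }
    assert (1 <= P2 / de).
    { apply Rmult_le_reg_r with de; [lra|].
      rewrite Rdiv_mult_cancel by lra. lra. }
    replace (4 * (1 + 2 * Rabs ka) * Q / (R0 * de))
      with ((2 * (P1 / R0)) * (2 * ((1 + 2 * Rabs ka) * (P2 / de)))).
    - apply Rmult_le_compat; try lra; nra.
    - rewrite <- HPQ. field. lra. }
  destruct (primitive_factor (a1, a2, q0)) as [k [[[p1 p2] q] [Hv [Hk Hk1]]]].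
  { unfold zzero. intros H. injection H as _ _ H. lia. }
  exists p1, p2, q. split; [exact Hv|].
  unfold zscal in Hk. injection Hk as E1 E2 E3.
  assert (Hk1R : 1 <= IZR k) by (apply IZR_le; exact Hk1).
  assert (Hq : (0 < q)%Z) by nia.
  assert (HqR : 0 < IZR q) by (apply IZR_lt; exact Hq).
  split; [exact Hq|]. split.
  { rewrite E3, mult_IZR in Hqn. nra. }
  rewrite E1, E3, !mult_IZR in Hx. rewrite E1, E2, E3, !mult_IZR in Hy.
  assert (Hdiv : forall t m P, 0 < P -> Rabs (IZR k * t) <= m / P -> Rabs (P * t) <= m).
  { intros t m P HP H. rewrite Rabs_mult in H. rewrite (Rabs_pos_eq (IZR k)) in H by lra.
    rewrite Rabs_mult, (Rabs_pos_eq P) by lra.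
    apply Rmult_le_compat_l with (r := P) in H; [|lra].
    replace (P * (m / P)) with m in H by (field; lra).
    assert (0 <= P * Rabs t) by (apply Rmult_le_pos; [lra|apply Rabs_pos]). nra. }
  split.
  - apply Hdiv; [lra|]. replace (IZR k * (IZR q * al - IZR p1))
      with (IZR k * IZR q * al - IZR k * IZR p1) by ring. exact Hx.
  - replace (P2 * (IZR q * be - IZR p2) - ka * (P1 * (IZR q * al - IZR p1)))
      with (P2 * (IZR q * be - IZR p2) - (ka * P1) * (IZR q * al - IZR p1)) by ring.
    rewrite Hkk.
    replace (P2 * (IZR q * be - IZR p2) - (ka * P2) * (IZR q * al - IZR p1))
      with (P2 * ((IZR q * be - IZR p2) - ka * (IZR q * al - IZR p1))) by ring.
    apply Hdiv; [lra|].
    replace (IZR k * (IZR q * be - IZR p2 - ka * (IZR q * al - IZR p1)))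
      with (IZR k * IZR q * be - IZR k * IZR p2 - ka * (IZR k * IZR q * al - IZR k * IZR p1))
      by ring. exact Hy.
Qed.

End Core.

Section CoreFlag.

Variables r1 r2 : R.
Hypothesis Hr1 : 0 < r1.
Hypothesis Hr2 : 0 < r2.
Hypothesis Hr : r1 + r2 = 1.

Lemma Rabs_shear (ka km x y m n : R) :
  Rabs ka <= km -> Rabs x <= m -> Rabs (y - ka * x) <= n -> Rabs y <= n + km * m.
Proof.
  intros Hka Hx Hy. replace y with ((y - ka * x) + ka * x) by ring.
  eapply Rle_trans; [apply Rabs_triang|]. rewrite (Rabs_mult ka).
  assert (Rabs ka * Rabs x <= km * m) by (apply Rmult_le_compat; auto using Rabs_pos). lra.
Qed.

(* A vector v = (x, y, z) and a dual vector w = (a, b, c) orthogonal to it; [y - ka x] and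
   [a + ka b] are their coordinates after the shear. *)
Definition good_flag (eps ym zm X0 Z0 al be Q ka : R) (p1 p2 q A B C : Z) : Prop :=
  let x := Rpower Q r1 * (IZR q * al - IZR p1) in
  let y := Rpower Q r2 * (IZR q * be - IZR p2) - ka * x in
  let a := IZR A / Rpower Q r1 + ka * (IZR B / Rpower Q r2) in
  let U := Rpower (exit_time r2 (Rabs y)) r1 in
  zprimitive (p1, p2, q) /\ zprimitive (A, B, C) /\ zdot (A, B, C) (p1, p2, q) = 0%Z /\
  ym <= Rabs y <= 1 /\ zm <= IZR q / Q <= Z0 /\ Rabs x <= X0 /\
  Rabs a <= eps * U /\ 2 / eps ^ 2 * (IZR q / Q * Rabs y) <= Rabs a /\
  Rabs (IZR B / Rpower Q r2) * U <= 2 / eps * (IZR q / Q).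

(** One time for each excluded degeneracy: w too close to the third axis and [z] too small, for each
    of two candidates v, and both candidates having too small an invariant coordinate. The number of
    times is part of the statement because the exceptional measure has to be shared among them
    before [eta] is known. *)
Lemma exists_good_flag (eps eta km : R) :
  0 < eps -> 0 < eta -> 0 <= km ->
  exists ts ym zm X0 Z0 Q1, length ts = 5%nat /\ (forall t, In t ts -> 0 < t) /\
    0 < ym /\ 0 < zm /\ 0 < X0 /\ 0 < Z0 /\
    forall al be Q ka, Q1 <= Q -> 1 <= Q -> Rabs ka <= km -> ka = 0 \/ r1 = r2 ->
      (forall t, In t ts -> no_short r1 r2 al be (Q * t) eta) ->
      exists p1 p2 q A B C, good_flag eps ym zm X0 Z0 al be Q ka p1 p2 q A B C.
Proof.
  intros Heps Heta Hkm.
  (* The bound on [q / Q] that Dirichlet's theorem gives for a box of area [R1 * de1 = 1]. *)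
  set (Z0 := 4 * (1 + 2 * km)). assert (HZ0 : 4 <= Z0) by (unfold Z0; lra).
  destruct (find_dual r1 r2 Hr1 Hr2 Hr eps eta 1 Z0 km) as [t1 [de1 [Ht1 [Hde1 F1]]]];
    try lra.
  set (R1 := / de1).
  assert (HR1 : 0 < R1) by (apply Rinv_0_lt_compat; lra).
  assert (HRd1 : R1 * de1 = 1) by (apply Rinv_l; lra).
  set (V1 := R1 + (de1 + km * R1) + Z0).
  assert (HkR1 : 0 <= km * R1) by nra.
  destruct (no_vector_near_plane r1 r2 Hr1 Hr2 Hr eta V1) as [t2 [zm1 [Ht2 [Hzm1 F2]]]];
    [lra|unfold V1; lra|].
  (* The area of the second box, so large that the bound on [q'] becomes [zm1 * Q / 2], which is
     below [q]; this makes the second vector independent of the first. *)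
  set (K2 := 2 * Z0 / zm1).
  assert (HK2 : 0 < K2) by (apply Rdiv_lt_0_compat; lra).
  destruct (find_dual r1 r2 Hr1 Hr2 Hr eps eta K2 Z0 km) as [t3 [de2 [Ht3 [Hde2 F3]]]];
    try lra.
  set (R2 := K2 / de2).
  assert (HR2 : 0 < R2) by (apply Rdiv_lt_0_compat; lra).
  assert (HRd2 : R2 * de2 = K2) by (unfold R2; field; lra).
  set (V2 := R2 + (de2 + km * R2) + Z0).
  assert (HkR2 : 0 <= km * R2) by nra.
  assert (HV1 : 0 < V1) by (unfold V1; lra). assert (HV2 : 0 < V2) by (unfold V2; lra).
  destruct (no_dual_near_plane r1 r2 Hr1 Hr2 Hr eta (2 * V1 * V2))
    as [t4 [nu [Ht4 [Hnu F4]]]]; [lra|nra|].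
  destruct (no_vector_near_plane r1 r2 Hr1 Hr2 Hr eta V2) as [t5 [zm2 [Ht5 [Hzm2 F5]]]];
    [lra|lra|].
  (* If both invariant coordinates were below [ym], the cross product of the two vectors would have
     third dual coordinate at most [(V1 + V2) * ym = nu]. *)
  set (ym := nu / (V1 + V2)).
  assert (Hym : 0 < ym) by (apply Rdiv_lt_0_compat; lra).
  destruct (large_power r1 (R1 + R2) Hr1) as [Q1 HQ1].
  exists (t1 :: t2 :: t3 :: t4 :: t5 :: nil), ym, (Rmin zm1 zm2), (R1 + R2), Z0, Q1.
  split; [reflexivity|]. split.
  { intros t Hin. simpl in Hin. intuition (subst; assumption). }
  split; [exact Hym|]. split; [apply Rmin_glb_lt; assumption|]. split; [lra|].
  split; [lra|].
  intros al be Q ka HQ HQge Hka Hkr Hns.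
  assert (HP1 := HQ1 Q HQ HQge).
  assert (HQ0 : 0 < Q) by lra.
  assert (Hn1 := Hns t1 ltac:(simpl; tauto)). assert (Hn2 := Hns t2 ltac:(simpl; tauto)).
  assert (Hn3 := Hns t3 ltac:(simpl; tauto)). assert (Hn4 := Hns t4 ltac:(simpl; tauto)).
  assert (Hn5 := Hns t5 ltac:(simpl; tauto)). clear Hns.
  assert (HB : 4 * (1 + 2 * Rabs ka) * Q <= Z0 * Q).
  { apply Rmult_le_compat_r; [lra|]. unfold Z0. lra. }
  destruct (dirichlet_scaled r1 r2 Hr1 Hr2 Hr al be Q ka R1 de1 (S (natfloor (Z0 * Q))))
    as [p1 [p2 [q [Hv [Hq [Hqn [Hx HY]]]]]]]; try assumption; try lra.
  { rewrite HRd1, Rdiv_1_r, S_INR. destruct (natfloor_spec (Z0 * Q)); [nra|]. lra. }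
  assert (HqR : 0 < IZR q) by (apply IZR_lt; exact Hq).
  assert (HzZ : IZR q <= Z0 * Q).
  { destruct (natfloor_spec (Z0 * Q)); [nra|].
    assert (IZR q <= INR (natfloor (Z0 * Q))); [|lra].
    rewrite INR_IZR_INZ in Hqn |- *. apply lt_IZR in Hqn. apply IZR_le. lia. }
  assert (Hz0 : 0 < IZR q / Q <= Z0).
  { split; [apply Rdiv_lt_0_compat; lra|]. apply Rmult_le_reg_r with Q; [lra|].
    rewrite Rdiv_mult_cancel by lra. lra. }
  assert (Hpos : forall p1 p2 q, zprimitive (p1, p2, q) -> (p1, p2, q) <> zzero)
    by (intros; apply primitive_neq_0; assumption).
  set (x := Rpower Q r1 * (IZR q * al - IZR p1)) in *.
  set (y := Rpower Q r2 * (IZR q * be - IZR p2)) in *.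
  assert (Hy1 : Rabs y <= de1 + km * R1) by (apply (Rabs_shear ka km x); assumption).
  assert (Hzlow : zm1 < IZR q / Q).
  { apply Rnot_le_lt. intros Hle. apply (F2 al be Q p1 p2 q HQ0 Hn2 (Hpos _ _ _ Hv)).
    - fold x. unfold V1. lra.
    - fold y. unfold V1. lra.
    - rewrite Rabs_pos_eq; lra. }
  assert (Hmin1 := Rmin_l zm1 zm2). assert (Hmin2 := Rmin_r zm1 zm2).
  destruct (Rle_lt_dec ym (Rabs (y - ka * x))) as [HYbig|HYsmall].
  - destruct (F1 al be Q ka x y (IZR q / Q) p1 p2 q) as [A [B [C [Hw [Hdot [O1 [O2 O3]]]]]]];
      try assumption; try reflexivity; try lra.
    { rewrite <- HRd1. apply Rmult_le_compat; auto using Rabs_pos. }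
    exists p1, p2, q, A, B, C. unfold good_flag. cbv zeta. fold x y.
    repeat split; try assumption; try lra.
  - (* A vector almost in the kernel of the invariant coordinate, but not parallel to v;
       parallel vectors have third coordinate at least that of v. *)
    destruct (dirichlet_scaled r1 r2 Hr1 Hr2 Hr al be Q ka R2 de2 (Z.to_nat q))
      as [p1' [p2' [q' [Hv' [Hq' [Hqn' [Hx' HY']]]]]]]; try assumption; try lra.
    { rewrite HRd2, INR_IZR_INZ, Z2Nat.id by lia.
      apply Rle_lt_trans with (Z0 * Q / K2).
      - apply Rmult_le_compat_r; [|exact HB]. apply Rinv_nonneg. lra.
      - apply Rlt_le_trans with (zm1 * Q).
        + unfold K2. replace (Z0 * Q / (2 * Z0 / zm1)) with (zm1 * Q / 2) by (field; lra).
          assert (0 < zm1 * Q) by nra. lra.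
        + apply Rlt_le. apply Rmult_lt_reg_r with (/ Q); [apply Rinv_0_lt_compat; lra|].
          rewrite Rmult_assoc, Rinv_r, Rmult_1_r by lra. exact Hzlow. }
    rewrite INR_IZR_INZ, Z2Nat.id in Hqn' by lia.
    assert (HqR' : 0 < IZR q') by (apply IZR_lt; exact Hq').
    set (x' := Rpower Q r1 * (IZR q' * al - IZR p1')) in *.
    set (y' := Rpower Q r2 * (IZR q' * be - IZR p2')) in *.
    assert (Hz0' : 0 < IZR q' / Q <= Z0).
    { split; [apply Rdiv_lt_0_compat; lra|]. eapply Rle_trans; [|apply Hz0].
      apply Rmult_le_compat_r; [|lra]. apply Rinv_nonneg. lra. }
    assert (Hy2 : Rabs y' <= de2 + km * R2) by (apply (Rabs_shear ka km x'); assumption).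
    assert (HYbig : ym <= Rabs (y' - ka * x')).
    { apply Rnot_lt_le. intros HYsmall'.
      assert (Hc : zcross (p1, p2, q) (p1', p2', q') <> zzero).
      { intros E.
        destruct (zcross_primitive_0 _ _ Hv (zcross_comm_0 _ _ E)) as [k Hk]. unfold zscal in Hk.
        assert (Hk' : (q' = k * q)%Z) by congruence.
        apply lt_IZR in Hqn'. destruct (Z_le_gt_dec k 0); nia. }
      simpl zcross in Hc.
      assert (HPQ := Rpower_r1_r2 r1 r2 Hr Q HQ0).
      assert (HP2p := Rpower_pos Q r2).
      apply (F4 al be Q _ _ _ HQ0 Hn4 Hc); rewrite !minus_IZR, !mult_IZR.
      - replace ((IZR p2 * IZR q' - IZR q * IZR p2') / Rpower Q r1)
          with (IZR q / Q * y' - y * (IZR q' / Q)).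
        + apply Rabs_det_le; try (rewrite Rabs_pos_eq by lra); unfold V1, V2; lra.
        + unfold y, y'. set (P1 := Rpower Q r1) in *. set (P2 := Rpower Q r2) in *.
          rewrite <- HPQ. field. lra.
      - replace ((IZR q * IZR p1' - IZR p1 * IZR q') / Rpower Q r2)
          with (x * (IZR q' / Q) - x' * (IZR q / Q)).
        + replace (x * (IZR q' / Q) - x' * (IZR q / Q))
            with (x * (IZR q' / Q) - (IZR q / Q) * x') by ring.
          apply Rabs_det_le; try (rewrite Rabs_pos_eq by lra); unfold V1, V2; lra.
        + unfold x, x'. set (P1 := Rpower Q r1) in *. set (P2 := Rpower Q r2) in *.
          rewrite <- HPQ. field. lra.
      - replace (Q * _) with (x * (y' - ka * x') - (y - ka * x) * x').
        + eapply Rle_trans; [apply Rabs_minus_le|]. rewrite !Rabs_mult.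
          assert (Rabs x * Rabs (y' - ka * x') <= V1 * ym).
          { apply Rmult_le_compat; auto using Rabs_pos; unfold V1; lra. }
          assert (Rabs (y - ka * x) * Rabs x' <= ym * V2).
          { apply Rmult_le_compat; auto using Rabs_pos; unfold V2; lra. }
          assert (V1 * ym + ym * V2 = nu) by (unfold ym; field; lra). lra.
        + unfold x, y, x', y'. set (P1 := Rpower Q r1) in *. set (P2 := Rpower Q r2) in *.
          rewrite <- HPQ. ring. }
    assert (Hzlow' : zm2 < IZR q' / Q).
    { apply Rnot_le_lt. intros Hle. apply (F5 al be Q p1' p2' q' HQ0 Hn5 (Hpos _ _ _ Hv')).
      - fold x'. unfold V2. lra.
      - fold y'. unfold V2. lra.
      - rewrite Rabs_pos_eq; lra. }
    destruct (F3 al be Q ka x' y' (IZR q' / Q) p1' p2' q')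
      as [A [B [C [Hw [Hdot [O1 [O2 O3]]]]]]]; try assumption; try reflexivity; try lra.
    { rewrite <- HRd2. apply Rmult_le_compat; auto using Rabs_pos. }
    exists p1', p2', q', A, B, C. unfold good_flag. cbv zeta. fold x' y'.
    repeat split; try assumption; try lra.
Qed.

End CoreFlag.

Lemma Rle_mult_r (x y : R) : 0 <= x -> 1 <= y -> x <= x * y.
Proof. nra. Qed.

Lemma Rabs_le_mult_div (x y k : R) : 0 < y -> Rabs x <= k * y -> Rabs (x / y) <= k.
Proof.
  intros Hy H. rewrite Rabs_div_pos by exact Hy. apply Rmult_le_reg_r with y; [exact Hy|].
  rewrite Rdiv_mult_cancel by lra. lra.
Qed.

(* U and W are the expansion factors up to the exit time t = U W of the vector, and the shift
   s0 brings the third dual coordinate to 1 at that time. *)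
Lemma flag_at_exit (eps km ka U W a b x y z c : R) :
  0 < eps <= 1 -> 0 <= km -> Rabs ka <= km -> 1 <= U -> 0 < W -> 0 < z ->
  W * Rabs y = 1 -> ka = 0 \/ U = W ->
  Rabs (a + ka * b) <= eps * U -> 2 / eps ^ 2 * (z * Rabs y) <= Rabs (a + ka * b) ->
  Rabs b * U <= 2 / eps * z -> c * z = (a + ka * b) * x + b * y ->
  let s0 := (/ (U * W) - c) / (a + ka * b) in
  0 < Rabs (a + ka * b) /\ Rabs (b / W) <= eps /\ Rabs (a / U) <= (1 + km) * eps /\
  Rabs (U * (x + z * s0)) <= 2 * eps /\ c + (a + ka * b) * s0 = / (U * W).
Proof.
  intros Heps Hkm Hka HU HW Hz HWy HUW H2 H3 H4 H5 s0.
  assert (Heps2 : 0 < eps ^ 2) by (apply pow_lt; lra).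
  assert (Hy : 0 < Rabs y) by nra.
  set (at' := a + ka * b) in *.
  assert (Hzy : z * Rabs y <= eps ^ 2 / 2 * Rabs at').
  { apply Rmult_le_reg_l with (2 / eps ^ 2); [apply Rdiv_lt_0_compat; lra|].
    replace (2 / eps ^ 2 * (eps ^ 2 / 2 * Rabs at')) with (Rabs at') by (field; lra). exact H3. }
  assert (Hat : 0 < Rabs at').
  { nra. }
  assert (Hat0 : at' <> 0) by (intros E; rewrite E, Rabs_R0 in Hat; lra).
  assert (D1 : Rabs b * Rabs y * U <= eps * Rabs at').
  { apply Rle_trans with (2 / eps * (z * Rabs y)).
    - replace (Rabs b * Rabs y * U) with (Rabs b * U * Rabs y) by ring.
      rewrite <- Rmult_assoc. apply Rmult_le_compat_r; lra.
    - apply Rle_trans with (2 / eps * (eps ^ 2 / 2 * Rabs at')).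
      + apply Rmult_le_compat_l; [|exact Hzy]. apply Rdiv_nonneg; lra.
      + right. field. lra. }
  assert (D2 : Rabs b * Rabs y <= eps * eps).
  { apply Rmult_le_reg_r with U; [lra|]. eapply Rle_trans; [exact D1|].
    rewrite Rmult_assoc. apply Rmult_le_compat_l; lra. }
  assert (Hyw : / W = Rabs y).
  { apply Rmult_eq_reg_l with W; [|lra]. rewrite Rinv_r by lra. lra. }
  assert (D2' : Rabs (b / W) <= eps * eps).
  { unfold Rdiv. rewrite Hyw, Rabs_mult, Rabs_Rabsolu. exact D2. }
  split; [exact Hat|]. split; [nra|]. split; [|split].
  - replace (a / U) with (at' / U - ka * (b / U)) by (unfold at'; field; lra).
    eapply Rle_trans; [apply Rabs_minus_le|].
    assert (Rabs (at' / U) <= eps) by (apply Rabs_le_mult_div; lra).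
    assert (Rabs (ka * (b / U)) <= km * eps); [|lra].
    destruct HUW as [ -> | -> ].
    + rewrite Rmult_0_l, Rabs_R0. nra.
    + apply Rabs_mult_le; auto using Rabs_pos. nra.
  (* One parameter serves two purposes: by the orthogonality [c z = at' x + b y], the shift that
     normalises the dual vector also cancels the main part of [x]. *)
  - assert (E : x + z * s0 = (z / (U * W) - b * y) / at').
    { unfold s0. apply Rmult_eq_reg_r with at'; [|exact Hat0].
      replace ((z / (U * W) - b * y) / at' * at') with (z / (U * W) - b * y) by (field; lra).
      replace ((x + z * ((/ (U * W) - c) / at')) * at')
        with (at' * x - c * z + z / (U * W)) by (field; lra).
      rewrite H5. ring. }
    rewrite E.
    replace (U * ((z / (U * W) - b * y) / at')) with ((z * / W - b * y * U) / at')
      by (field; lra).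
    rewrite Hyw. unfold Rdiv. rewrite Rabs_mult, Rabs_inv.
    apply Rmult_le_reg_r with (Rabs at'); [exact Hat|].
    rewrite Rmult_assoc, Rinv_l by lra.
    rewrite Rmult_1_r. eapply Rle_trans; [apply Rabs_minus_le|]. rewrite (Rabs_mult (b * y)), (Rabs_mult b), (Rabs_pos_eq U) by lra.
    rewrite (Rabs_pos_eq (z * Rabs y)) by nra.
    assert (eps ^ 2 / 2 * Rabs at' <= eps * Rabs at'); [|lra].
    apply Rmult_le_compat_r; [lra|]. simpl. nra.
  - unfold s0. field. repeat split; lra.
Qed.

(** * Intervals of the curve that are not improved *)

Section FreeInterval.

Variables (r1 r2 : R) (f g f' g' : R -> R) (lo hi c1 C rho0 Q0 : R).
Hypothesis Hr1 : 0 < r1.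
Hypothesis Hr2 : 0 < r2.
Hypothesis Hr : r1 + r2 = 1.
Hypothesis HC : nice_curve r1 r2 f g f' g' lo hi c1 C rho0 Q0.

(* The shear of the limiting unipotent flow: for r2 < r1 only the first coordinate moves. *)
Definition shear (s : R) : R := if Req_dec_T r1 r2 then g' s / f' s else 0.

Lemma slope_bound (s : R) : lo <= s <= hi -> Rabs (g' s / f' s) <= C / c1.
Proof.
  intros Hs. pose proof (nc_c1 HC).
  pose proof (nc_f' HC s Hs).
  pose proof (nc_g' HC s Hs).
  unfold Rdiv. rewrite Rabs_mult, Rabs_inv. apply Rmult_le_compat; auto using Rabs_pos.
  - apply Rinv_nonneg. lra.
  - apply Rinv_le_contravar; lra.
Qed.

Lemma shear_bound (s : R) : lo <= s <= hi -> Rabs (shear s) <= C / c1.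
Proof.
  intros Hs. unfold shear. destruct (Req_dec_T r1 r2); [apply slope_bound; exact Hs|].
  rewrite Rabs_R0. pose proof (nc_c1 HC).
  pose proof (nc_C HC). apply Rdiv_nonneg; lra.
Qed.

Lemma shear_cond (s : R) : shear s = 0 \/ r1 = r2.
Proof. unfold shear. destruct (Req_dec_T r1 r2); tauto. Qed.

(** The expanded curve moves with slope [g' / f' * Q^(r2 - r1)]. This is constant in Q for equal
    weights, tends to 0 uniformly in [s] for [r2 < r1], and vanishes if [g] is constant. *)
Lemma shear_limit (om : R) : 0 < om -> exists Q2, forall Q s, Q2 <= Q -> 1 <= Q -> lo <= s <= hi ->
  Rabs (g' s / f' s * (Rpower Q r2 / Rpower Q r1) - shear s) <= om.
Proof.
  intros Hom. unfold shear. destruct (Req_dec_T r1 r2) as [E|E].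
  - exists 0. intros Q s _ HQ Hs. rewrite E.
    replace (Rpower Q r2 / Rpower Q r2) with 1.
    + rewrite Rmult_1_r, Rminus_diag, Rabs_R0. lra.
    + field. apply Rgt_not_eq, Rpower_pos.
  - destruct (nc_dir HC) as [Hd|Hd].
    + destruct (large_power (r1 - r2) (C / c1 / om)) as [Q2 HQ2]; [lra|].
      exists Q2. intros Q s HQ HQ1 Hs. specialize (HQ2 Q HQ HQ1).
      rewrite Rminus_0_r, Rabs_mult.
      assert (E2 : Rpower Q r2 / Rpower Q r1 = / Rpower Q (r1 - r2)).
      { rewrite <- Rpower_Ropp. replace (- (r1 - r2)) with (r2 + - r1) by ring.
        rewrite Rpower_plus, Rpower_Ropp. reflexivity. }
      rewrite E2. pose proof (Rpower_pos Q (r1 - r2)) as HP.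
      rewrite (Rabs_pos_eq (/ _)) by (apply Rinv_nonneg; exact HP).
      apply Rle_trans with (C / c1 * / Rpower Q (r1 - r2)).
      * apply Rmult_le_compat_r; [apply Rinv_nonneg; exact HP|].
        apply slope_bound. exact Hs.
      * apply Rmult_le_reg_r with (Rpower Q (r1 - r2)); [exact HP|].
        rewrite Rmult_assoc, Rinv_l by lra.
        apply Rmult_le_compat_l with (r := om) in HQ2; [|lra].
        pose proof (nc_c1 HC).
        replace (om * (C / c1 / om)) with (C / c1) in HQ2 by (field; lra). lra.
    + exists 0. intros Q s _ HQ Hs. destruct (Hd s Hs) as [_ ->].
      unfold Rdiv. rewrite !Rmult_0_l, Rminus_0_r, Rabs_R0. lra.
Qed.

Definition improved_at (sg Q al be : R) : Prop :=
  exists (q : nat) (p1 p2 : Z), (1 <= q)%nat /\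
    dev q al p1 < sg * Rpower Q (- r1) /\
    dev q be p2 < sg * Rpower Q (- r2) /\
    INR q < sg * Q.

Lemma critical_not_improved (sg e Q al be : R) (p1 p2 q A B C' : Z) :
  0 < Q -> 0 <= e -> sg * (1 + 2 * e) < 1 - e -> 0 < sg ->
  zprimitive (p1, p2, q) -> zprimitive (A, B, C') -> zdot (A, B, C') (p1, p2, q) = 0%Z ->
  Rabs (Rpower Q r1 * (IZR q * al - IZR p1)) <= e ->
  1 - e <= Rabs (Rpower Q r2 * (IZR q * be - IZR p2)) <= 1 + e ->
  Rabs (IZR A / Rpower Q r1) <= e -> Rabs (IZR B / Rpower Q r2) <= e ->
  1 - e <= Rabs (Q * (IZR A * al + IZR B * be + IZR C')) <= 1 + e ->
  ~ improved_at sg Q al be.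
Proof.
  intros HQ He Hsg Hsg0 Hv Hw Hwv Hx Hy Ha Hb Hc [n [m1 [m2 [Hn [H1 [H2 H3]]]]]].
  assert (HP1 := Rpower_pos Q r1). assert (HP2 := Rpower_pos Q r2).
  assert (HPQ := Rpower_r1_r2 r1 r2 Hr Q HQ).
  assert (Hdev : forall r x m, dev n x m < sg * Rpower Q (- r) ->
    Rabs (Rpower Q r * (IZR (Z.of_nat n) * x - IZR m)) < sg).
  { intros r x m H. unfold dev in H. rewrite INR_IZR_INZ in H.
    assert (HP := Rpower_pos Q r). rewrite Rpower_Ropp in H.
    rewrite Rabs_mult, (Rabs_pos_eq (Rpower Q r)) by lra.
    apply Rmult_lt_compat_l with (r := Rpower Q r) in H; [|exact HP].
    replace (Rpower Q r * (sg * / Rpower Q r)) with sg in H by (field; lra). exact H. }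
  apply (critical_avoids_box (Rpower Q r1) (Rpower Q r2) al be sg e p1 p2 q A B C')
    with (m1 := m1) (m2 := m2) (n := Z.of_nat n); auto.
  - rewrite HPQ. exact Hc.
  - lia.
  - rewrite HPQ, <- INR_IZR_INZ. apply Rmult_lt_reg_r with Q; [exact HQ|].
    rewrite Rdiv_mult_cancel by lra. lra.
Qed.

(** Displacements are of order [1 / (Q P1)] and no coordinate is expanded by more than a multiple of
    [Q^2 P1], so the quadratic remainder is only of order [1 / P1] after the expansion. *)
Lemma taylor_error (s h S P1 Q P q F : R) (k : R -> R) (k' : R -> R) :
  0 <= S -> 1 <= P1 -> 0 < Q -> 0 <= F -> lo <= s <= hi -> lo <= s + h <= hi ->
  Rabs (k (s + h) - k s - k' s * h) <= C * h ^ 2 ->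
  Rabs h <= S / (c1 * (Q * P1)) -> Rabs (P * q) <= F * (Q ^ 2 * P1) ->
  Rabs (P * q * (k (s + h) - k s - k' s * h)) <= F * (C * (S / c1) ^ 2) / P1.
Proof.
  intros HS HP1 HQ HF Hs Hsh Hk Hh HPq.
  pose proof (nc_c1 HC). pose proof (nc_C HC).
  assert (Hh2 : h ^ 2 <= (S / (c1 * (Q * P1))) ^ 2).
  { rewrite <- (pow2_abs h). apply pow_incr. split; [apply Rabs_pos|exact Hh]. }
  rewrite Rabs_mult.
  apply Rle_trans with (F * (Q ^ 2 * P1) * (C * (S / (c1 * (Q * P1))) ^ 2)).
  - apply Rmult_le_compat; auto using Rabs_pos.
    eapply Rle_trans; [exact Hk|]. apply Rmult_le_compat_l; lra.
  - right. field. lra.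
Qed.

(** The parameter [u] is the time of the unipotent motion, a displacement of order [1 / (Q Q^r1)] on
    the curve. [eps] has to be fixed before [ym], [zm], [X0] and [Z0], which are produced for that
    [eps]; afterwards [th] and [Q2] may depend on all of them. *)
Lemma good_flag_free (sg : R) : 0 < sg < 1 ->
  exists eps, 0 < eps /\ forall ym zm X0 Z0, 0 < ym -> 0 < zm -> 0 < X0 -> 0 < Z0 ->
  exists th S Q2, 0 < th /\ 0 < S /\
  forall Q s p1 p2 q A B D, Q2 <= Q -> 1 <= Q -> lo <= s <= hi ->
    good_flag r1 r2 eps ym zm X0 Z0 (f s) (g s) Q (shear s) p1 p2 q A B D ->
    exists s0, Rabs s0 <= S /\ forall u, Rabs (u - s0) <= th ->
      let t := s + u / (f' s * (Q * Rpower Q r1)) in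
      lo <= t <= hi -> exists Q', Q <= Q' /\ ~ improved_at sg Q' (f t) (g t).
Proof.
  intros Hsg.
  pose proof (nc_c1 HC) as Hc1.
  pose proof (nc_C HC) as HCC.
  set (km := C / c1). assert (Hkm : 0 < km) by (apply Rdiv_lt_0_compat; lra).
  set (e := (1 - sg) / 4).
  assert (He : 0 < e < 1 / 4) by (unfold e; lra).
  assert (Hcrit : sg * (1 + 2 * e) < 1 - e) by (unfold e; nra).
  set (eps := e / (8 * (1 + km))).
  assert (Heps0 : 0 < eps) by (apply Rdiv_lt_0_compat; lra).
  assert (Heps : (1 + km) * eps = e / 8) by (unfold eps; field; lra).
  assert (Heps1 : eps <= e / 8) by nra.
  exists eps. split; [exact Heps0|].
  intros ym zm X0 Z0 Hym Hzm HX0 HZ0.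
  set (tm := exit_time r2 ym). set (Um := Rpower tm r1).
  assert (Htm : 0 < tm) by apply exit_time_pos.
  assert (HUm : 0 < Um) by apply Rpower_pos.
  assert (Hiy : 0 < / ym) by (apply Rinv_0_lt_compat; exact Hym).
  assert (HtU : 0 < tm * Um) by (apply Rmult_lt_0_compat; assumption).
  assert (HUZ : 0 < Um * Z0) by (apply Rmult_lt_0_compat; assumption).
  (* All factors by which an error [th] at time Q can grow up to the exit time: [tm], [Um] and
     [/ ym] for the three linearisations below, [tm * Um] and [Um * Z0] for replacing [s0] by
     [u]. *)
  set (G := tm * Um + tm + Um * Z0 + Um + / ym).
  assert (HG : 0 < G) by (unfold G; lra).
  set (th := e / (8 * (1 + km) * G)).
  assert (Hth : 0 < th).
  { apply Rdiv_lt_0_compat; [lra|]. apply Rmult_lt_0_compat; lra. }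
  assert (HthG : (1 + km) * (G * th) = e / 8) by (unfold th; field; lra).
  set (Bm := 2 / eps * Z0). assert (HBm : 0 < Bm).
  { apply Rmult_lt_0_compat; [apply Rdiv_lt_0_compat; lra|exact HZ0]. }
  set (am := 2 / eps ^ 2 * (zm * ym)). assert (Ham : 0 < am).
  { apply Rmult_lt_0_compat; [apply Rdiv_lt_0_compat; [lra|apply pow_lt; lra]|].
    apply Rmult_lt_0_compat; assumption. }
  set (cm := (Um * X0 + Bm) / zm).
  assert (Hcm : 0 < cm).
  { apply Rdiv_lt_0_compat; [|exact Hzm]. assert (0 < Um * X0) by (apply Rmult_lt_0_compat; lra).
    lra. }
  set (S0 := (1 + cm) / am). assert (HS0 : 0 < S0) by (apply Rdiv_lt_0_compat; lra).
  set (S := S0 + th).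
  set (Am := Um + km * Bm). assert (HAm : 0 < Am) by (unfold Am; nra).
  set (L := (Am + Bm + Z0) * (C * (S / c1) ^ 2)).
  set (om := th / (2 * ((Bm + Z0) * S + 1))).
  assert (HBS : 0 < (Bm + Z0) * S) by (apply Rmult_lt_0_compat; unfold S; lra).
  assert (Hom : 0 < om) by (apply Rdiv_lt_0_compat; lra).
  assert (Homth : (Bm + Z0) * S * om <= th / 2).
  { unfold om. apply Rle_trans with (((Bm + Z0) * S + 1) * (th / (2 * ((Bm + Z0) * S + 1)))).
    - apply Rmult_le_compat_r; [|lra]. apply Rdiv_nonneg; lra.
    - right. field. lra. }
  destruct (shear_limit om Hom) as [Qa HQa].
  destruct (large_power r1 (2 * L / th) Hr1) as [Qb HQb].
  exists th, S0, (Rmax Qa Qb). split; [exact Hth|]. split; [exact HS0|].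
  intros Q s p1 p2 q A B D HQ2 HQ Hs Hflag.
  assert (HQa' := HQa Q s (Rle_trans _ _ _ (Rmax_l _ _) HQ2) HQ Hs). clear HQa.
  assert (HQb' := HQb Q (Rle_trans _ _ _ (Rmax_r _ _) HQ2) HQ). clear HQb.
  assert (HP1 := Rpower_ge_1 Q r1 HQ ltac:(lra)).
  assert (HP2 := Rpower_ge_1 Q r2 HQ ltac:(lra)).
  assert (HPQ := Rpower_r1_r2 r1 r2 Hr Q ltac:(lra)).
  assert (HLP : L / Rpower Q r1 <= th / 2).
  { apply Rmult_le_reg_r with (Rpower Q r1); [lra|].
    rewrite Rdiv_mult_cancel by lra.
    apply Rmult_le_compat_l with (r := th / 2) in HQb'; [|lra].
    replace (th / 2 * (2 * L / th)) with L in HQb' by (field; lra). lra. }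
  unfold good_flag in Hflag. cbv zeta in Hflag.
  destruct Hflag as [Hv [Hw [Hdot [HY [Hz [Hx [O1 [O2 O3]]]]]]]].
  pose proof (shear_bound s Hs) as Hka. fold km in Hka.
  pose proof (shear_cond s) as Hkr.
  set (ka := shear s) in *.
  set (x := Rpower Q r1 * (IZR q * f s - IZR p1)) in *.
  set (y := Rpower Q r2 * (IZR q * g s - IZR p2) - ka * x) in *.
  set (tau := exit_time r2 (Rabs y)) in *.
  set (z := IZR q / Q) in *.
  set (a := IZR A / Rpower Q r1) in *. set (b := IZR B / Rpower Q r2) in *.
  set (U := Rpower tau r1) in *. set (W := Rpower tau r2).
  set (c := Q * (IZR A * f s + IZR B * g s + IZR D)).
  assert (Htau0 : 0 < tau) by apply exit_time_pos.
  assert (Htau1 : 1 <= tau) by (apply exit_time_ge_1; lra).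
  assert (Htaum : tau <= tm) by (apply exit_time_le; lra).
  assert (HU1 : 1 <= U) by (apply Rpower_ge_1; lra).
  assert (HUUm : U <= Um) by (apply Rpower_le_mono; lra).
  assert (HW : W * Rabs y = 1).
  { unfold W, tau. rewrite exit_time_r2 by lra. apply Rinv_l. lra. }
  assert (HW0 : 0 < W) by apply Rpower_pos.
  assert (HWm : W <= / ym).
  { unfold W, tau. rewrite exit_time_r2 by lra. apply Rinv_le_contravar; lra. }
  assert (HUWt : U * W = tau) by (apply Rpower_r1_r2; assumption).
  assert (HkUW : ka = 0 \/ U = W).
  { destruct Hkr as [->|E]; [left; reflexivity|right]. unfold U, W. rewrite E. reflexivity. }
  assert (Hcz : c * z = (a + ka * b) * x + b * y).
  { unfold zdot in Hdot. apply (f_equal IZR) in Hdot.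
    rewrite !plus_IZR, !mult_IZR in Hdot.
    unfold y, x, a, b, c, z.
    transitivity ((IZR A * f s + IZR B * g s + IZR D) * IZR q); [field; lra|].
    transitivity (IZR A * (IZR q * f s - IZR p1) + IZR B * (IZR q * g s - IZR p2)
      + (IZR A * IZR p1 + IZR B * IZR p2 + IZR D * IZR q)); [ring|].
    rewrite Hdot. field. lra. }
  assert (Hz0 : 0 < z) by lra.
  destruct (flag_at_exit eps km ka U W a b x y z c) as [Hat [Hb' [Ha' [Hx' Hc']]]];
    try assumption; try lra.
  set (at' := a + ka * b) in *.
  set (s0 := (/ (U * W) - c) / at') in *.
  assert (Hb : Rabs b <= Bm).
  { apply Rle_trans with (Rabs b * U); [apply Rle_mult_r; [apply Rabs_pos|lra]|].
    eapply Rle_trans; [exact O3|]. apply Rmult_le_compat_l; [|lra].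
    apply Rdiv_nonneg; lra. }
  assert (Hatm : Rabs at' <= Um).
  { eapply Rle_trans; [exact O1|]. apply Rle_trans with (1 * U); [|lra].
    apply Rmult_le_compat_r; lra. }
  assert (Ha : Rabs a <= Am).
  { replace a with (at' - ka * b) by (unfold at'; ring).
    eapply Rle_trans; [apply Rabs_minus_le|]. rewrite (Rabs_mult ka).
    assert (Rabs ka * Rabs b <= km * Bm) by (apply Rmult_le_compat; auto using Rabs_pos).
    unfold Am. lra. }
  assert (Hata : am <= Rabs at').
  { eapply Rle_trans; [|exact O2]. unfold am. apply Rmult_le_compat_l.
    - apply Rlt_le, Rdiv_lt_0_compat; [lra|apply pow_lt; lra].
    - apply Rmult_le_compat; lra. }
  assert (Hc : Rabs c <= cm).
  { apply Rmult_le_reg_r with z; [exact Hz0|].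
    replace (Rabs c * z) with (Rabs (c * z)) by (rewrite Rabs_mult, (Rabs_pos_eq z) by lra; reflexivity).
    rewrite Hcz. eapply Rle_trans; [apply Rabs_triang|]. rewrite !Rabs_mult.
    assert (Rabs at' * Rabs x <= Um * X0) by (apply Rmult_le_compat; auto using Rabs_pos).
    assert (Rabs b * Rabs y <= Bm * 1) by (apply Rmult_le_compat; auto using Rabs_pos; lra).
    apply Rle_trans with (cm * zm); [|apply Rmult_le_compat_l; lra].
    unfold cm. replace ((Um * X0 + Bm) / zm * zm) with (Um * X0 + Bm) by (field; lra). lra. }
  assert (Hs0 : Rabs s0 <= S0).
  { unfold s0, Rdiv. rewrite Rabs_mult, Rabs_inv. unfold S0, Rdiv.
    apply Rmult_le_compat; auto using Rabs_pos.
    - apply Rinv_nonneg. exact Hat.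
    - eapply Rle_trans; [apply Rabs_minus_le|].
      assert (Rabs (/ (U * W)) <= 1); [|lra].
      rewrite HUWt, Rabs_pos_eq by (apply Rinv_nonneg; lra).
      rewrite <- Rinv_1. apply Rinv_le_contravar; lra.
    - apply Rinv_le_contravar; lra. }
  exists s0. split; [exact Hs0|].
  intros u Hu t Ht.
  (* At this time the invariant coordinate has reached absolute value 1; [tau] lies between 1 and
     [tm] because [ym <= |y| <= 1]. *)
  exists (Q * tau). split; [apply Rle_mult_r; lra|].
  pose proof (nc_f' HC s Hs) as Hf'.
  assert (Hf'0 : f' s <> 0) by (intros E; rewrite E, Rabs_R0 in Hf'; lra).
  set (h := u / (f' s * (Q * Rpower Q r1))) in *.
  assert (HuS : Rabs u <= S).
  { replace u with (s0 + (u - s0)) by ring. eapply Rle_trans; [apply Rabs_triang|].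
    unfold S. lra. }
  assert (HQP : 0 < Q * Rpower Q r1) by (apply Rmult_lt_0_compat; lra).
  assert (Hh : Rabs h <= S / (c1 * (Q * Rpower Q r1))).
  { unfold h, Rdiv. rewrite Rabs_mult, Rabs_inv, Rabs_mult, (Rabs_pos_eq (Q * _)) by lra.
    apply Rmult_le_compat; auto using Rabs_pos.
    - left. apply Rinv_0_lt_compat. apply Rmult_lt_0_compat; lra.
    - apply Rinv_le_contravar; [apply Rmult_lt_0_compat; lra|].
      apply Rmult_le_compat_r; lra. }
  pose proof (nc_taylorf HC s t Hs Ht) as Tf.
  pose proof (nc_taylorg HC s t Hs Ht) as Tg.
  replace (t - s) with h in Tf, Tg by (unfold t; ring).
  assert (HS : 0 <= S) by (unfold S; lra).
  set (P1 := Rpower Q r1) in *. set (P2 := Rpower Q r2) in *.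
  set (ga := g' s / f' s * (P2 / P1) - ka) in *.
  assert (EA : IZR A = a * P1) by (unfold a; field; lra).
  assert (EB : IZR B = b * P2) by (unfold b; field; lra).
  assert (Eq : IZR q = z * Q) by (unfold z; field; lra).
  assert (HP2Q : P2 <= Q) by (rewrite <- HPQ, Rmult_comm; apply Rle_mult_r; lra).
  assert (HQQ : Q <= Q ^ 2)
    by (replace (Q ^ 2) with (Q * Q) by ring; apply Rle_mult_r; lra).
  assert (HQP2 : Q * P1 <= Q ^ 2 * P1) by (apply Rmult_le_compat_r; lra).
  assert (HQP3 : Q * P2 <= Q ^ 2 * P1).
  { apply Rle_trans with (Q * Q); [apply Rmult_le_compat_l; lra|].
    replace (Q ^ 2) with (Q * Q) by ring. apply Rle_mult_r; [apply Rmult_le_pos|]; lra. }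
  (* This bound and the next two say that at time Q the curve follows the unipotent motion up to
     [th]. The errors are the quadratic remainders, at most [L / P1] in total, and, for the dual and
     the second coordinate, the drift [ga] between the direction of the curve and the shear. *)
  assert (Ec : Rabs (Q * (IZR A * f t + IZR B * g t + IZR D) - (c + at' * u)) <= th).
  { replace (Q * (IZR A * f t + IZR B * g t + IZR D) - (c + at' * u))
      with (Q * IZR A * (f t - f s - f' s * h) + Q * IZR B * (g t - g s - g' s * h)
            + b * u * ga).
    - assert (T1 : Rabs (Q * IZR A * (f t - f s - f' s * h)) <= Am * (C * (S / c1) ^ 2) / P1).
      { apply (taylor_error s h S P1 Q Q (IZR A) Am f f'); try assumption; try lra.
        rewrite EA, !Rabs_mult, (Rabs_pos_eq Q), (Rabs_pos_eq P1) by lra.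
        replace (Q * (Rabs a * P1)) with (Rabs a * (Q * P1)) by ring.
        apply Rmult_le_compat; auto using Rabs_pos. lra. }
      assert (T2 : Rabs (Q * IZR B * (g t - g s - g' s * h)) <= Bm * (C * (S / c1) ^ 2) / P1).
      { apply (taylor_error s h S P1 Q Q (IZR B) Bm g g'); try assumption; try lra.
        rewrite EB, !Rabs_mult, (Rabs_pos_eq Q), (Rabs_pos_eq P2) by lra.
        replace (Q * (Rabs b * P2)) with (Rabs b * (Q * P2)) by ring.
        apply Rmult_le_compat; auto using Rabs_pos. apply Rmult_le_pos; lra. }
      assert (T3 : Rabs (b * u * ga) <= Bm * S * om).
      { rewrite !Rabs_mult. apply Rmult_le_compat; auto using Rabs_pos.
        - apply Rmult_le_pos; apply Rabs_pos.
        - apply Rmult_le_compat; auto using Rabs_pos. }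
      eapply Rle_trans; [apply Rabs_triang|].
      apply Rle_trans with (L / P1 + Bm * S * om).
      + apply Rplus_le_compat; [|exact T3]. eapply Rle_trans; [apply Rabs_triang|].
        eapply Rle_trans; [apply Rplus_le_compat; [exact T1|exact T2]|].
        unfold L, Rdiv. rewrite <- Rmult_plus_distr_r. apply Rmult_le_compat_r.
        * apply Rinv_nonneg. lra.
        * rewrite <- Rmult_plus_distr_r. apply Rmult_le_compat_r; [|lra].
          apply Rmult_le_pos; [lra|]. apply pow2_ge_0.
      + assert (0 <= Z0 * S * om) by (apply Rmult_le_pos; [apply Rmult_le_pos|]; lra). lra.
    - unfold ga, at', c, h. rewrite EA, EB, <- HPQ. field.
      repeat split; try assumption; lra. }
  assert (Ex : Rabs (P1 * (IZR q * f t - IZR p1) - (x + z * u)) <= th).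
  { replace (P1 * (IZR q * f t - IZR p1) - (x + z * u))
      with (P1 * IZR q * (f t - f s - f' s * h)).
    - assert (T1 : Rabs (P1 * IZR q * (f t - f s - f' s * h)) <= Z0 * (C * (S / c1) ^ 2) / P1).
      { apply (taylor_error s h S P1 Q P1 (IZR q) Z0 f f'); try assumption; try lra.
        rewrite Eq, !Rabs_mult, (Rabs_pos_eq Q), (Rabs_pos_eq P1), (Rabs_pos_eq z) by lra.
        replace (P1 * (z * Q)) with (z * (Q * P1)) by ring.
        apply Rmult_le_compat; lra. }
      eapply Rle_trans; [exact T1|]. apply Rle_trans with (L / P1); [|lra].
      unfold L, Rdiv. apply Rmult_le_compat_r; [apply Rinv_nonneg; lra|].
      apply Rmult_le_compat_r; [|lra]. apply Rmult_le_pos; [lra|]. apply pow2_ge_0.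
    - unfold x, h. rewrite Eq. field. repeat split; try assumption; lra. }
  assert (Ey : Rabs (P2 * (IZR q * g t - IZR p2) - (y + ka * (x + z * u))) <= th).
  { replace (P2 * (IZR q * g t - IZR p2) - (y + ka * (x + z * u)))
      with (P2 * IZR q * (g t - g s - g' s * h) + z * u * ga).
    - assert (T1 : Rabs (P2 * IZR q * (g t - g s - g' s * h)) <= Z0 * (C * (S / c1) ^ 2) / P1).
      { apply (taylor_error s h S P1 Q P2 (IZR q) Z0 g g'); try assumption; try lra.
        rewrite Eq, !Rabs_mult, (Rabs_pos_eq Q), (Rabs_pos_eq P2), (Rabs_pos_eq z) by lra.
        replace (P2 * (z * Q)) with (z * (Q * P2)) by ring.
        apply Rmult_le_compat; try lra. apply Rmult_le_pos; lra. }
      assert (T3 : Rabs (z * u * ga) <= Z0 * S * om).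
      { rewrite !Rabs_mult. apply Rmult_le_compat; auto using Rabs_pos.
        - apply Rmult_le_pos; apply Rabs_pos.
        - apply Rmult_le_compat; auto using Rabs_pos. rewrite Rabs_pos_eq; lra. }
      eapply Rle_trans; [apply Rabs_triang|].
      apply Rle_trans with (L / P1 + Z0 * S * om).
      + apply Rplus_le_compat; [|exact T3]. eapply Rle_trans; [exact T1|].
        unfold L, Rdiv. apply Rmult_le_compat_r; [apply Rinv_nonneg; lra|].
        apply Rmult_le_compat_r; [|lra]. apply Rmult_le_pos; [lra|]. apply pow2_ge_0.
      + assert (0 <= Bm * S * om) by (apply Rmult_le_pos; [apply Rmult_le_pos|]; lra). lra.
    - unfold y, x, ga, h. rewrite Eq. field. repeat split; try assumption; lra. }
  assert (Hth1 : 0 < tm * Um * th) by (apply Rmult_lt_0_compat; lra).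
  assert (Hth2 : 0 < tm * th) by (apply Rmult_lt_0_compat; lra).
  assert (Hth3 : 0 < Um * Z0 * th) by (apply Rmult_lt_0_compat; lra).
  assert (Hth4 : 0 < Um * th) by (apply Rmult_lt_0_compat; lra).
  assert (Hth5 : 0 < / ym * th) by (apply Rmult_lt_0_compat; lra).
  set (sum := tm * Um * th + tm * th + Um * Z0 * th + Um * th + / ym * th).
  assert (Hsum : (1 + km) * sum = e / 8) by (rewrite <- HthG; unfold sum, G; ring).
  assert (Hsum0 : 0 < sum) by (unfold sum; lra).
  assert (Hsum1 : sum <= e / 8)
    by (rewrite <- Hsum, Rmult_comm; apply Rle_mult_r; lra).
  assert (Hxu : Rabs (U * (x + z * u)) <= 2 * eps + sum).
  { replace (U * (x + z * u)) with (U * (x + z * s0) + U * z * (u - s0)) by ring.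
    eapply Rle_trans; [apply Rabs_triang|]. apply Rplus_le_compat; [exact Hx'|].
    rewrite !Rabs_mult, (Rabs_pos_eq U), (Rabs_pos_eq z) by lra.
    apply Rle_trans with (Um * Z0 * th); [|unfold sum; lra].
    apply Rmult_le_compat; try lra; [|apply Rabs_pos|apply Rmult_le_compat; lra].
    apply Rmult_le_pos; lra. }
  assert (HUth : U * th <= Um * th) by (apply Rmult_le_compat_r; lra).
  assert (HWth : W * th <= / ym * th) by (apply Rmult_le_compat_r; lra).
  assert (HP1t : Rpower (Q * tau) r1 = P1 * U) by (apply Rpower_time; lra).
  assert (HP2t : Rpower (Q * tau) r2 = P2 * W) by (apply Rpower_time; lra).
  apply (critical_not_improved sg e (Q * tau) (f t) (g t) p1 p2 q A B D);
    try assumption; try lra; rewrite ?HP1t, ?HP2t.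
  - apply Rmult_lt_0_compat; lra.
  - replace (P1 * U * (IZR q * f t - IZR p1))
      with (U * (P1 * (IZR q * f t - IZR p1) - (x + z * u)) + U * (x + z * u)) by ring.
    eapply Rle_trans; [apply Rabs_triang|]. rewrite (Rabs_mult U (_ - _)), (Rabs_pos_eq U) by lra.
    assert (U * Rabs (P1 * (IZR q * f t - IZR p1) - (x + z * u)) <= U * th)
      by (apply Rmult_le_compat_l; lra).
    assert (Um * th <= sum) by (unfold sum; lra). lra.
  - set (y2 := P2 * W * (IZR q * g t - IZR p2)).
    assert (Hy2 : Rabs (y2 - W * y) <= e).
    { replace (y2 - W * y) with
        (W * (P2 * (IZR q * g t - IZR p2) - (y + ka * (x + z * u))) + ka * (W * (x + z * u)))
        by (unfold y2; ring).
      eapply Rle_trans; [apply Rabs_triang|].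
      rewrite (Rabs_mult W (_ - _)), (Rabs_pos_eq W) by lra.
      assert (W * Rabs (P2 * (IZR q * g t - IZR p2) - (y + ka * (x + z * u))) <= W * th)
        by (apply Rmult_le_compat_l; lra).
      assert (Rabs (ka * (W * (x + z * u))) <= km * (2 * eps + sum)).
      { destruct HkUW as [->|E].
        - rewrite Rmult_0_l, Rabs_R0. apply Rmult_le_pos; lra.
        - rewrite <- E, Rabs_mult. apply Rmult_le_compat; auto using Rabs_pos. }
      assert (/ ym * th <= sum) by (unfold sum; lra).
      lra. }
    assert (HWy : Rabs (W * y) = 1) by (rewrite Rabs_mult, (Rabs_pos_eq W) by lra; exact HW).
    pose proof (Rabs_triang_inv y2 (W * y)). pose proof (Rabs_triang_inv (W * y) y2) as Hti.
    rewrite (Rabs_minus_sym (W * y) y2) in Hti. lra.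
  - replace (IZR A / (P1 * U)) with (a / U) by (unfold a; field; lra). lra.
  - replace (IZR B / (P2 * W)) with (b / W) by (unfold b; field; lra). lra.
  - set (c2 := Q * tau * (IZR A * f t + IZR B * g t + IZR D)).
    assert (Hc2 : Rabs (c2 - 1) <= e).
    { replace (c2 - 1) with
        (tau * (Q * (IZR A * f t + IZR B * g t + IZR D) - (c + at' * u)) + tau * at' * (u - s0)).
      - eapply Rle_trans; [apply Rabs_triang|].
        rewrite !Rabs_mult, (Rabs_pos_eq tau) by lra.
        assert (tau * Rabs (Q * (IZR A * f t + IZR B * g t + IZR D) - (c + at' * u)) <= tm * th)
          by (apply Rmult_le_compat; auto using Rabs_pos; lra).
        assert (tau * Rabs at' * Rabs (u - s0) <= tm * Um * th).
        { apply Rmult_le_compat; auto using Rabs_pos.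
          - apply Rmult_le_pos; lra.
          - apply Rmult_le_compat; lra. }
        assert (tm * th + tm * Um * th <= sum) by (unfold sum; lra). lra.
      - unfold c2. rewrite HUWt in Hc'.
        transitivity (Q * tau * (IZR A * f t + IZR B * g t + IZR D) - tau * (c + at' * s0));
          [ring|]. rewrite Hc'. field. lra. }
    pose proof (Rabs_triang_inv c2 1). pose proof (Rabs_triang_inv 1 c2) as Hti.
    rewrite (Rabs_minus_sym 1 c2) in Hti. rewrite Rabs_R1 in *. lra.
Qed.

End FreeInterval.

(** * Null sets *)

Definition lsum {T : Type} (f : T -> R) (l : list T) : R :=
  fold_right (fun x acc => f x + acc) 0 l.

Lemma lsum_app {T : Type} (f : T -> R) (l l' : list T) :
  lsum f (l ++ l') = lsum f l + lsum f l'.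
Proof. induction l as [|x l IH]; simpl; [ring|rewrite IH; ring]. Qed.

Lemma lsum_le {T : Type} (f g : T -> R) (l : list T) :
  (forall x, In x l -> f x <= g x) -> lsum f l <= lsum g l.
Proof.
  induction l as [|x l IH]; simpl; intros H; [lra|].
  apply Rplus_le_compat; [apply H; auto|apply IH; auto].
Qed.

Lemma lsum_lin {T : Type} (f g : T -> R) (a b : R) (l : list T) :
  lsum (fun x => a * f x + b * g x) l = a * lsum f l + b * lsum g l.
Proof. induction l as [|x l IH]; simpl; [ring|rewrite IH; ring]. Qed.

Lemma lsum_swap {T S : Type} (f : T -> S -> R) (l : list T) (l' : list S) :
  lsum (fun x => lsum (f x) l') l = lsum (fun y => lsum (fun x => f x y) l) l'.
Proof.
  induction l as [|x l IH]; simpl.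
  - induction l' as [|y l' IH']; simpl; [reflexivity|rewrite <- IH'; ring].
  - rewrite IH. clear IH. induction l' as [|y l' IH']; simpl; [ring|rewrite <- IH'; ring].
Qed.

Lemma lsum_incl {T : Type} (f : T -> R) (l l' : list T) :
  (forall x, 0 <= f x) -> NoDup l -> incl l l' -> lsum f l <= lsum f l'.
Proof.
  intros Hf. revert l'. induction l as [|x l IH]; intros l' Hnd Hincl; simpl.
  - induction l' as [|y l' IH']; simpl; [lra|]. specialize (Hf y).
    assert (0 <= lsum f l'); [|lra]. apply IH'. intros z [].
  - inversion Hnd as [|? ? Hx Hnd']; subst.
    destruct (in_split x l' (Hincl x (or_introl eq_refl))) as [l1 [l2 ->]].
    rewrite lsum_app. simpl.
    assert (lsum f l <= lsum f (l1 ++ l2)).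
    { apply IH; [exact Hnd'|]. intros z Hz.
      assert (Hz' := Hincl z (or_intror Hz)). apply in_app_or in Hz'. apply in_or_app.
      destruct Hz' as [Hz'|[->|Hz']]; tauto. }
    rewrite lsum_app in H. lra.
Qed.

Lemma lsum_seq (f : nat -> R) (N : nat) : sum_f_R0 f N = lsum f (seq 0 (S N)).
Proof.
  induction N as [|N IH]; [simpl; ring|].
  rewrite (seq_S (S N) 0), lsum_app, <- IH. simpl. ring.
Qed.

Lemma lsum_telescope (c : nat -> R) (n : nat) :
  lsum (fun k => c (S k) - c k) (seq 0 n) = c n - c 0%nat.
Proof.
  induction n as [|n IH]; [simpl; ring|].
  rewrite seq_S, lsum_app, IH. simpl. ring.
Qed.

(** Lebesgue outer measure bounded by [m], phrased so that [null_set E] unfolds to [outer_le E eps]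
    for every positive [eps]. *)
Definition outer_le (E : R -> Prop) (m : R) : Prop :=
  exists a b : nat -> R,
    (forall n, a n <= b n) /\
    (forall x, E x -> exists n, a n < x < b n) /\
    (forall N, sum_f_R0 (fun n => b n - a n) N <= m).

Lemma outer_le_mono (E F : R -> Prop) (m n : R) :
  outer_le F m -> (forall s, E s -> F s) -> m <= n -> outer_le E n.
Proof.
  intros [a [b [H1 [H2 H3]]]] HEF Hmn. exists a, b. split; [exact H1|]. split; [auto|].
  intros N. specialize (H3 N). lra.
Qed.

(** One cover is chosen for each set, and all are enumerated by the Cantor pairing. Neither
    component of a pair exceeds its code, so a partial sum up to N is dominated by the double sum
    over the square of side N + 1. *)
Lemma outer_le_countable_union (E : nat -> R -> Prop) (m : nat -> R) (M : R) :
  (forall i, outer_le (E i) (m i)) -> (forall N, sum_f_R0 m N <= M) ->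
  outer_le (fun x => exists i, E i x) M.
Proof.
  intros HE HM.
  set (P := fun (i : nat) (ab : (nat -> R) * (nat -> R)) =>
    (forall n, fst ab n <= snd ab n) /\
    (forall x, E i x -> exists n, fst ab n < x < snd ab n) /\
    (forall N, sum_f_R0 (fun n => snd ab n - fst ab n) N <= m i)).
  assert (HP : forall i, { ab | P i ab }).
  { intros i. apply constructive_indefinite_description.
    destruct (HE i) as [a [b H]]. exists (a, b). exact H. }
  set (c := fun ij : nat * nat =>
    snd (proj1_sig (HP (fst ij))) (snd ij) - fst (proj1_sig (HP (fst ij))) (snd ij)).
  assert (Hc : forall ij, 0 <= c ij).
  { intros [i j]. unfold c. simpl. pose proof (proj2_sig (HP i)) as Hpi. destruct Hpi as [H1 _].
    specialize (H1 j). lra. }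
  exists (fun n => fst (proj1_sig (HP (fst (Cantor.of_nat n)))) (snd (Cantor.of_nat n))),
    (fun n => snd (proj1_sig (HP (fst (Cantor.of_nat n)))) (snd (Cantor.of_nat n))).
  split; [|split].
  - intros n. specialize (Hc (Cantor.of_nat n)). unfold c in Hc. lra.
  - intros x [i Hi]. pose proof (proj2_sig (HP i)) as Hpi. destruct Hpi as [_ [H2 _]].
    destruct (H2 x Hi) as [j Hj]. exists (Cantor.to_nat (i, j)).
    rewrite Cantor.cancel_of_to. exact Hj.
  - intros N. rewrite lsum_seq.
    apply Rle_trans with (lsum c (list_prod (seq 0 (S N)) (seq 0 (S N)))).
    + assert (Hmap : forall l, lsum (fun n => c (Cantor.of_nat n)) l = lsum c (map Cantor.of_nat l)).
      { intros l. induction l as [|k l IH]; simpl; [reflexivity|rewrite IH; reflexivity]. }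
      unfold c in Hmap at 1. rewrite Hmap. apply lsum_incl; [exact Hc| |].
      * apply NoDup_map_NoDup_ForallPairs; [|apply seq_NoDup].
        intros i j _ _ Hij. rewrite <- (Cantor.cancel_to_of i), <- (Cantor.cancel_to_of j), Hij.
        reflexivity.
      * intros [i j] Hin. apply in_map_iff in Hin. destruct Hin as [n [Hn Hin]].
        apply in_seq in Hin. pose proof (Cantor.to_nat_non_decreasing i j) as Hnd.
        rewrite <- Hn, Cantor.cancel_to_of in Hnd.
        apply in_prod; apply in_seq; lia.
    + assert (Hprod : forall l l', lsum c (list_prod l l') = lsum (fun i => lsum (fun j => c (i, j)) l') l).
      { intros l l'. induction l as [|i l IH]; simpl; [reflexivity|].
        rewrite lsum_app, IH. f_equal. clear. induction l' as [|j l' IH]; simpl; [reflexivity|].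
        rewrite IH. reflexivity. }
      rewrite Hprod. eapply Rle_trans; [|apply (HM N)]. rewrite lsum_seq. apply lsum_le.
      intros i _. pose proof (proj2_sig (HP i)) as Hpi. destruct Hpi as [_ [_ H3]]. specialize (H3 N).
      rewrite lsum_seq in H3. exact H3.
Qed.

Lemma sum_f_R0_two (x y : R) (N : nat) : 0 <= x -> 0 <= y ->
  sum_f_R0 (fun i => match i with 0%nat => x | 1%nat => y | _ => 0 end) N <= x + y.
Proof.
  intros Hx Hy.
  destruct N as [|N]; [simpl; lra|].
  induction N as [|N IH]; [simpl; lra|]. rewrite tech5. lra.
Qed.

Lemma outer_le_empty (E : R -> Prop) (m : R) : 0 <= m -> (forall x, ~ E x) -> outer_le E m.
Proof.
  intros Hm HE. exists (fun _ => 0), (fun _ => 0). split; [intros; lra|]. split.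
  - intros x Hx. exfalso. exact (HE x Hx).
  - intros N. rewrite Rminus_diag. rewrite sum_cte. lra.
Qed.

Lemma outer_le_union (E F : R -> Prop) (m n : R) :
  0 <= m -> 0 <= n -> outer_le E m -> outer_le F n -> outer_le (fun x => E x \/ F x) (m + n).
Proof.
  intros Hm Hn HE HF.
  apply outer_le_mono with (m := m + n) (F := fun x => exists i : nat,
    (match i with 0%nat => E | 1%nat => F | _ => fun _ => False end) x).
  - apply outer_le_countable_union
      with (m := fun i => match i with 0%nat => m | 1%nat => n | _ => 0 end).
    + intros [|[|i]]; [exact HE|exact HF|]. apply outer_le_empty; [lra|tauto].
    + intros N. apply sum_f_R0_two; assumption.
  - intros x [Hx|Hx]; [exists 0%nat|exists 1%nat]; exact Hx.
  - lra.
Qed.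

Lemma outer_le_interval (a b d : R) :
  a <= b -> 0 < d -> outer_le (fun x => a <= x <= b) (b - a + d).
Proof.
  intros Hab Hd.
  exists (fun n => match n with 0%nat => a - d / 2 | _ => 0 end),
    (fun n => match n with 0%nat => b + d / 2 | _ => 0 end).
  split; [intros [|n]; lra|]. split; [intros x Hx; exists 0%nat; lra|].
  intros N. induction N as [|N IH]; [simpl; lra|]. rewrite tech5. lra.
Qed.

Lemma outer_le_of_covered (E : R -> Prop) (m d : R) :
  covered E m -> 0 < d -> outer_le E (m + d).
Proof.
  intros [l [H1 [H2 H3]]] Hd.
  assert (H : forall e, 0 < e -> 0 <= total_length l /\
    outer_le (fun s => exists I, In I l /\ fst I <= s <= snd I) (total_length l + e)).
  { clear H2 H3 Hd. induction l as [|[a b] l IH]; intros e He.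
    - simpl. split; [lra|]. apply outer_le_empty; [lra|]. intros x [I [[] _]].
    - assert (Hab : a <= b) by (apply (H1 (a, b)); left; reflexivity).
      destruct (IH ltac:(intros; apply H1; right; assumption) (e / 2) ltac:(lra)) as [Hl Ho].
      simpl. split; [lra|].
      apply outer_le_mono with (1 := outer_le_union _ _ (b - a + e / 2) (total_length l + e / 2)
        ltac:(lra) ltac:(lra) (outer_le_interval a b (e / 2) Hab ltac:(lra)) Ho); [|lra].
      intros s [I [[<-|HI] Hs]]; [left; exact Hs|right; exists I; tauto]. }
  destruct (H d Hd) as [_ Ho].
  apply outer_le_mono with (1 := Ho); [exact H2|lra].
Qed.

(** * Overlap lengths and porous sets *)

(** The projection onto [[a, b]]. For [c <= d] the difference [clamp a b d - clamp a b c] is the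
    length of the overlap of [[a, b]] with [[c, d]], so overlaps with adjacent cells telescope. *)
Definition clamp (a b t : R) : R := Rmax a (Rmin b t).

Ltac case_max_min :=
  unfold clamp, Rmax, Rmin in *;
  repeat match goal with
    | |- context [Rle_dec ?x ?y] =>
        lazymatch x with context [Rle_dec _ _] => fail | _ => idtac end;
        lazymatch y with context [Rle_dec _ _] => fail | _ => idtac end;
        destruct (Rle_dec x y)
    end; lra.

Lemma clamp_mono (a b s t : R) : s <= t -> clamp a b s <= clamp a b t.
Proof. intros H. case_max_min. Qed.

Lemma clamp_range (a b t : R) : a <= b -> a <= clamp a b t <= b.
Proof. intros H. case_max_min. Qed.

Lemma clamp_id (a b t : R) : a <= t <= b -> clamp a b t = t.
Proof. intros H. case_max_min. Qed.

Lemma clamp_overlap (a b c d : R) : a <= b -> c <= d ->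
  clamp c d b - clamp c d a = clamp a b d - clamp a b c.
Proof. intros H1 H2. case_max_min. Qed.

Lemma clamp_gt (c d a : R) : c < clamp c d a -> clamp c d a <= a.
Proof. case_max_min. Qed.

Lemma clamp_lt (c d b : R) : c <= d -> clamp c d b < d -> b <= clamp c d b.
Proof. case_max_min. Qed.

(** Taking the first interval away leaves [(c, p)] and [(q, d)] to be covered by the others. Their
    overlaps with these two pieces add up to at most their overlap with [[c, d]], by monotonicity
    between [p] and [q]. *)
Lemma interval_covered_length (l : list (R * R)) (c d : R) :
  c <= d -> (forall I, In I l -> fst I <= snd I) ->
  (forall t, c < t < d -> exists I, In I l /\ fst I <= t <= snd I) ->
  d - c <= lsum (fun I => clamp (fst I) (snd I) d - clamp (fst I) (snd I) c) l.
Proof.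
  revert c d. induction l as [|[a b] l IH]; intros c d Hcd Hl Hcov; simpl.
  - apply Rnot_lt_le. intros Hlt. destruct (Hcov ((c + d) / 2) ltac:(lra)) as [I [[] _]].
  - assert (Hab : a <= b) by (apply (Hl (a, b)); left; reflexivity).
    assert (Hl' : forall I, In I l -> fst I <= snd I) by (intros; apply Hl; right; assumption).
    assert (Hp := clamp_range c d a Hcd). assert (Hq := clamp_range c d b Hcd).
    assert (Hpq := clamp_mono c d a b Hab).
    assert (Hov := clamp_overlap a b c d Hab Hcd).
    assert (Hpa := clamp_gt c d a). assert (Hqb := clamp_lt c d b Hcd).
    set (p := clamp c d a) in *. set (q := clamp c d b) in *.
    assert (C1 : p - c <= lsum (fun I => clamp (fst I) (snd I) p - clamp (fst I) (snd I) c) l).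
    { apply IH; [lra|exact Hl'|]. intros t Ht.
      destruct (Hcov t ltac:(lra)) as [I [[<-|HI] HtI]]; [simpl in HtI; lra|exists I; tauto]. }
    assert (C2 : d - q <= lsum (fun I => clamp (fst I) (snd I) d - clamp (fst I) (snd I) q) l).
    { apply IH; [lra|exact Hl'|]. intros t Ht.
      destruct (Hcov t ltac:(lra)) as [I [[<-|HI] HtI]]; [simpl in HtI; lra|exists I; tauto]. }
    assert (C3 : lsum (fun I => clamp (fst I) (snd I) p - clamp (fst I) (snd I) c) l
      + lsum (fun I => clamp (fst I) (snd I) d - clamp (fst I) (snd I) q) l
      <= lsum (fun I => clamp (fst I) (snd I) d - clamp (fst I) (snd I) c) l).
    { rewrite <- (Rmult_1_l (lsum _ l)), <- (Rmult_1_l (lsum (fun I => _ - clamp _ _ q) l)).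
      rewrite <- lsum_lin. apply lsum_le. intros [a' b'] _. simpl.
      pose proof (clamp_mono a' b' p q Hpq). lra. }
    lra.
Qed.

Definition ind (P : Prop) : R := if excluded_middle_informative P then 1 else 0.

(** The factor [1 - th] is the same at every step above [eps], so finitely many steps bring any
    initial bound [M] down to [eps]. *)
Lemma outer_le_decrease (E : R -> Prop) (eps th M : R) :
  0 < eps -> 0 < th <= 1 -> outer_le E M ->
  (forall m, eps < m -> outer_le E m -> outer_le E (m * (1 - th))) -> outer_le E eps.
Proof.
  intros Heps Hth HM Hstep.
  assert (H : forall n, outer_le E (Rmax eps (M * (1 - th) ^ n))).
  { induction n as [|n IH].
    - apply outer_le_mono with (1 := HM); [auto|]. simpl. rewrite Rmult_1_r. apply Rmax_r.
    - destruct (Rle_lt_dec (M * (1 - th) ^ n) eps) as [Hle|Hlt].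
      + rewrite Rmax_left in IH by exact Hle.
        apply outer_le_mono with (1 := IH); [auto|apply Rmax_l].
      + rewrite Rmax_right in IH by lra.
        apply outer_le_mono with (1 := Hstep _ Hlt IH); [auto|].
        simpl. eapply Rle_trans; [|apply Rmax_r]. right. ring. }
  destruct (pow_lt_1_zero (1 - th) ltac:(rewrite Rabs_pos_eq; lra) (eps / (Rabs M + 1)))
    as [n Hn].
  { apply Rdiv_lt_0_compat; [lra|]. pose proof (Rabs_pos M). lra. }
  specialize (Hn n (Nat.le_refl n)).
  rewrite Rabs_pos_eq in Hn by (apply pow_le; lra).
  specialize (H n). rewrite Rmax_left in H; [exact H|].
  pose proof (Rabs_pos M). pose proof (Rle_abs M).
  assert (Hp : 0 <= (1 - th) ^ n) by (apply pow_le; lra).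
  apply Rle_trans with ((Rabs M + 1) * (eps / (Rabs M + 1))).
  - apply Rle_trans with ((Rabs M + 1) * (1 - th) ^ n).
    + apply Rmult_le_compat_r; lra.
    + apply Rmult_le_compat_l; lra.
  - right. field. lra.
Qed.

Lemma tail_small (c : nat -> R) (m e : R) :
  (forall n, 0 <= c n) -> (forall N, sum_f_R0 c N <= m) -> 0 < e ->
  exists N, forall k, sum_f_R0 (fun n => c (S N + n)%nat) k <= e.
Proof.
  intros Hc Hm He.
  destruct (infimum (fun s => exists N, s = m - sum_f_R0 c N) 0) as [u [Hu0 [Hu1 Hu2]]].
  - intros s [N ->]. specialize (Hm N). lra.
  - exists (m - sum_f_R0 c 0), 0%nat. reflexivity.
  - destruct (Hu2 e He) as [s [[N ->] Hs]]. exists N. intros k.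
    assert (H : m - sum_f_R0 c (S N + k) >= u) by (apply Rle_ge, Hu1; eexists; reflexivity).
    assert (E : sum_f_R0 c (S N + k)
      = sum_f_R0 c N + sum_f_R0 (fun n => c (S N + n)%nat) k).
    { clear. induction k as [|k IH].
      - rewrite Nat.add_0_r. simpl. rewrite Nat.add_0_r. reflexivity.
      - replace (S N + S k)%nat with (S (S N + k))%nat by lia.
        rewrite tech5, IH, tech5. replace (S N + S k)%nat with (S (S N + k))%nat by lia. ring. }
    lra.
Qed.

(* On the grid of mesh h, a fixed proportion of all but few cells is free of E; refining a
   cover of E by the grid therefore shortens it by a fixed factor. *)
Lemma porous_null (E : R -> Prop) (lo hi : R) :
  lo < hi -> (forall t, E t -> lo <= t <= hi) ->
  (forall m, 0 < m -> exists de M, 0 < de /\ 0 < M /\ forall l0, 0 < l0 ->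
     exists l (B : R -> Prop), 0 < l < l0 /\ covered B m /\
     forall s, lo <= s <= hi -> ~ B s ->
       exists c, s - M * l <= c /\ c + de * l <= s + M * l /\
         forall t, c < t < c + de * l -> ~ E t) ->
  null_set E.
Proof.
  intros Hlohi HE Hpor eps Heps. change (outer_le E eps).
  (* The exceptional set is measured against the final [eps] and not against the current cover, so
     that the free proportion [k0] stays fixed during the iteration. *)
  destruct (Hpor (eps / 16) ltac:(lra)) as [de0 [M [Hde0 [HM Hl]]]]. clear Hpor.
  set (de := Rmin de0 M).
  assert (Hde : 0 < de) by (apply Rmin_glb_lt; assumption).
  assert (Hde1 : de <= de0) by apply Rmin_l. assert (Hde2 : de <= M) by apply Rmin_r.
  set (k0 := de / (4 * M)).
  assert (Hk0 : 0 < k0 <= 1 / 4).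
  { split; [apply Rdiv_lt_0_compat; lra|]. apply Rmult_le_reg_r with (4 * M); [lra|].
    unfold k0, Rdiv. rewrite Rmult_assoc, Rinv_l by lra. lra. }
  apply outer_le_decrease with (th := k0 / 2) (M := hi - lo + 1); [exact Heps|lra| |].
  { apply outer_le_mono with (1 := outer_le_interval lo hi 1 ltac:(lra) ltac:(lra));
      [exact HE|lra]. }
  intros m Hm [a [b [Hab [Hcov Hsum]]]].
  destruct (tail_small (fun n => b n - a n) m (k0 * eps / 8)) as [N HN].
  { intros n. specialize (Hab n). lra. }
  { exact Hsum. }
  { assert (0 < k0 * eps) by (apply Rmult_lt_0_compat; lra). lra. }
  assert (Hke : 0 < k0 * eps) by (apply Rmult_lt_0_compat; lra).
  set (q := 2 * INR (S N) + 2).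
  assert (Hq : 1 <= q) by (unfold q; pose proof (pos_INR (S N)); lra).
  destruct (Hl (k0 * eps / 8 / (4 * M * q))) as [l [B [Hl0 [HB Hfree]]]].
  { apply Rdiv_lt_0_compat; [lra|]. apply Rmult_lt_0_compat; lra. }
  (* With this mesh, the free interval of a point in the middle half of a cell stays inside the
     cell, since it is within [M * l = h / 4] of the point. *)
  set (h := 4 * M * l). assert (Hh : 0 < h) by (apply Rmult_lt_0_compat; lra).
  assert (Hhq : q * h <= k0 * eps / 8).
  { unfold h. apply Rle_trans with (4 * M * q * (k0 * eps / 8 / (4 * M * q))).
    - replace (q * (4 * M * l)) with (4 * M * q * l) by ring.
      apply Rmult_le_compat_l; [|lra]. apply Rmult_le_pos; lra.
    - right. field. lra. }
  assert (Hkh : k0 * h = de * l) by (unfold k0, h; field; lra).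
  set (n := natfloor ((hi - lo) / h)).
  assert (Hn : INR n * h <= hi - lo < INR n * h + h).
  { destruct (natfloor_spec ((hi - lo) / h)) as [N1 N2].
    - apply Rdiv_nonneg; lra.
    - fold n in N1, N2. split.
      + apply Rmult_le_compat_r with (r := h) in N1; [|lra].
        unfold Rdiv in N1. rewrite Rmult_assoc, Rinv_l in N1 by lra. lra.
      + apply Rmult_lt_compat_r with (r := h) in N2; [|lra].
        unfold Rdiv in N2. rewrite Rmult_assoc, Rinv_l in N2 by lra. lra. }
  set (x := fun k => lo + INR k * h).
  assert (Hx : forall k, x (S k) = x k + h) by (intros k; unfold x; rewrite S_INR; ring).
  assert (Hxn : forall k, (k < n)%nat -> lo <= x k /\ x k + h <= hi).
  { intros k Hk. assert (Hk' : (S k <= n)%nat) by lia.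
    apply le_INR in Hk'. rewrite S_INR in Hk'. unfold x.
    assert (0 <= INR k * h) by (apply Rmult_le_pos; [apply pos_INR|lra]).
    assert ((INR k + 1) * h <= INR n * h) by (apply Rmult_le_compat_r; lra). lra. }
  set (meets := fun k => exists i, (i <= N)%nat /\ a i < x k + h /\ x k < b i).
  set (good := fun k => exists c, x k <= c /\ c + k0 * h <= x k + h /\
    forall t, c < t < c + k0 * h -> ~ E t).
  (* The length spent on a cell: the share [1 - k0] if the finite part of the old cover meets it,
     and the remaining [k0] if no free interval is known in it. *)
  set (len := fun k => (1 - k0) * h * ind (meets k) + k0 * h * ind (~ good k)).
  set (O := fun t => exists i, (i <= N)%nat /\ a i < t < b i).
  assert (Hk0h : 0 < k0 * h) by (apply Rmult_lt_0_compat; lra).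
  assert (Hk0h1 : 0 < (1 - k0) * h) by (apply Rmult_lt_0_compat; lra).
  assert (Hcell : forall k, covered (fun t => (E t /\ O t) /\ x k <= t <= x k + h) (len k)).
  { intros k. unfold len, ind.
    destruct (excluded_middle_informative (meets k)) as [Hmt|Hmt].
    - destruct (excluded_middle_informative (~ good k)) as [Hg|Hg].
      + apply covered_mono with (1 := covered_interval (x k) (x k + h) ltac:(lra));
          [tauto|lra].
      + apply NNPP in Hg. destruct Hg as [c [Hc1 [Hc2 Hc3]]].
        apply covered_mono with (1 := covered_union _ _ _ _
          (covered_interval (x k) c Hc1)
          (covered_interval (c + k0 * h) (x k + h) Hc2)); [|lra].
        intros t [[Ht _] Hxt]. destruct (Rle_lt_dec t c); [left; lra|right].
        split; [|lra]. apply Rnot_lt_le. intros Hlt. apply (Hc3 t); [lra|exact Ht].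
    - apply covered_empty.
      + destruct (excluded_middle_informative (~ good k)); lra.
      + intros t [[_ [i [Hi Ht]]] Hxt]. apply Hmt. exists i. split; [exact Hi|lra]. }
  assert (HcovO : forall j, covered (fun t => (E t /\ O t) /\ x 0%nat <= t <= x j)
    (h + lsum len (seq 0 j))).
  { induction j as [|j IH].
    - simpl. apply covered_mono with (1 := covered_interval (x 0%nat) (x 0%nat + h) ltac:(lra));
        [intros; lra|lra].
    - rewrite seq_S, lsum_app. simpl.
      apply covered_mono with (1 := covered_union _ _ _ _ IH (Hcell j)); [|lra].
      intros t [Ht Hxt]. rewrite Hx in Hxt.
      destruct (Rle_lt_dec t (x j)); [left|right]; (split; [exact Ht|lra]). }
  specialize (HcovO n).
  assert (Hlast := covered_interval (x n) (x n + h) ltac:(lra)).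
  (* A cell met by an interval lies inside the enlargement of that interval by [h] on both sides,
     and is charged to it. *)
  assert (Hmeets : h * lsum (fun k => ind (meets k)) (seq 0 n) <= m + 2 * INR (S N) * h).
  { assert (H1 : lsum (fun k => h * ind (meets k)) (seq 0 n) <=
      lsum (fun k => lsum (fun i => clamp (a i - h) (b i + h) (x (S k))
                                   - clamp (a i - h) (b i + h) (x k)) (seq 0 (S N))) (seq 0 n)).
    { apply lsum_le. intros k _.
      assert (Hnn : forall i, 0 <= clamp (a i - h) (b i + h) (x (S k))
                                   - clamp (a i - h) (b i + h) (x k)).
      { intros i. pose proof (clamp_mono (a i - h) (b i + h) (x k) (x (S k))) as Hmono.
        rewrite Hx in Hmono |- *. lra. }
      unfold ind. destruct (excluded_middle_informative (meets k)) as [[i [Hi Hmi]]|_].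
      - apply Rle_trans with (lsum (fun i => clamp (a i - h) (b i + h) (x (S k))
                                   - clamp (a i - h) (b i + h) (x k)) (i :: nil)).
        + simpl. rewrite Hx, !clamp_id by lra. lra.
        + apply lsum_incl; [exact Hnn| |].
          * constructor; [intros []|constructor].
          * intros j [<-|[]]. apply in_seq. lia.
      - rewrite Rmult_0_r.
        apply Rle_trans with (lsum (fun i => clamp (a i - h) (b i + h) (x (S k))
                                   - clamp (a i - h) (b i + h) (x k)) nil); [simpl; lra|].
        apply lsum_incl; [exact Hnn|constructor|intros j []]. }
    rewrite lsum_swap in H1.
    assert (H2 : lsum (fun i => lsum (fun k => clamp (a i - h) (b i + h) (x (S k))
        - clamp (a i - h) (b i + h) (x k)) (seq 0 n)) (seq 0 (S N))
      <= lsum (fun i => 1 * (b i - a i) + 2 * h * 1) (seq 0 (S N))).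
    { apply lsum_le. intros i _.
      rewrite (lsum_telescope (fun k => clamp (a i - h) (b i + h) (x k))).
      pose proof (Hab i). pose proof (clamp_range (a i - h) (b i + h) (x n) ltac:(lra)).
      pose proof (clamp_range (a i - h) (b i + h) (x 0%nat) ltac:(lra)). lra. }
    rewrite (lsum_lin (fun i => b i - a i) (fun _ => 1)) in H2.
    specialize (Hsum N). rewrite lsum_seq in Hsum.
    assert (H3 : forall j, lsum (fun _ : nat => 1) (seq 0 j) = INR j).
    { induction j as [|j IH]; [reflexivity|]. rewrite seq_S, lsum_app, IH, S_INR. simpl. ring. }
    rewrite H3 in H2.
    assert (H4 : lsum (fun k => h * ind (meets k)) (seq 0 n)
      = h * lsum (fun k => ind (meets k)) (seq 0 n)).
    { generalize (seq 0 n). intros L. induction L as [|k L IH]; simpl; [ring|].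
      rewrite IH. ring. }
    lra. }
  (* The middle half of a bad cell lies in B, so the bad cells have at most twice the length
     [eps / 16] of the cover of B. *)
  assert (Hbad : h * lsum (fun k => ind (~ good k)) (seq 0 n) <= eps / 8).
  { destruct HB as [L [HL1 [HL2 HL3]]].
    assert (H1 : lsum (fun k => h / 2 * ind (~ good k)) (seq 0 n) <=
      lsum (fun k => lsum (fun I => clamp (fst I) (snd I) (x (S k))
        - clamp (fst I) (snd I) (x k)) L) (seq 0 n)).
    { apply lsum_le. intros k Hk. apply in_seq in Hk.
      unfold ind. destruct (excluded_middle_informative (~ good k)) as [Hg|_].
      - apply Rle_trans with (lsum (fun I => clamp (fst I) (snd I) (x k + 3 * h / 4)
          - clamp (fst I) (snd I) (x k + h / 4)) L).
        + eapply Rle_trans; [|apply interval_covered_length; [lra|exact HL1|]]; [lra|].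
          intros t Ht. apply HL2. apply NNPP. intros HnB. apply Hg.
          destruct (Hxn k ltac:(lia)) as [X1 X2].
          destruct (Hfree t ltac:(lra) HnB) as [c [C1 [C2 C3]]].
          assert (Hdl : de * l <= de0 * l) by (apply Rmult_le_compat_r; lra).
          exists c. rewrite Hkh. unfold h in *. split; [lra|]. split; [lra|].
          intros t' Ht'. apply C3. lra.
        + apply lsum_le. intros I _.
          pose proof (clamp_mono (fst I) (snd I) (x k) (x k + h / 4) ltac:(lra)).
          pose proof (clamp_mono (fst I) (snd I) (x k + 3 * h / 4) (x (S k))
            ltac:(rewrite Hx; lra)). lra.
      - rewrite Rmult_0_r. clear - Hx Hh. induction L as [|I L IH]; simpl; [lra|].
        pose proof (clamp_mono (fst I) (snd I) (x k) (x (S k)) ltac:(rewrite Hx; lra)). lra. }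
    rewrite lsum_swap in H1.
    assert (H2 : lsum (fun I => lsum (fun k => clamp (fst I) (snd I) (x (S k))
        - clamp (fst I) (snd I) (x k)) (seq 0 n)) L <= total_length L).
    { unfold total_length. change (fold_right _ 0 L) with (lsum (fun I : R * R => snd I - fst I) L).
      apply lsum_le. intros I HI.
      rewrite (lsum_telescope (fun k => clamp (fst I) (snd I) (x k))).
      pose proof (HL1 I HI) as HI'.
      pose proof (clamp_range (fst I) (snd I) (x n) HI').
      pose proof (clamp_range (fst I) (snd I) (x 0%nat) HI'). lra. }
    assert (H4 : lsum (fun k => h / 2 * ind (~ good k)) (seq 0 n)
      = h / 2 * lsum (fun k => ind (~ good k)) (seq 0 n)).
    { generalize (seq 0 n). intros L'. induction L' as [|k L' IH]; simpl; [ring|].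
      rewrite IH. ring. }
    lra. }
  assert (Hlen : lsum len (seq 0 n) <= (1 - k0) * (m + 2 * INR (S N) * h) + k0 * (eps / 8)).
  { unfold len. rewrite lsum_lin.
    apply Rplus_le_compat; rewrite Rmult_assoc; apply Rmult_le_compat_l; lra. }
  assert (HO : outer_le (fun t => E t /\ O t)
    (h + lsum len (seq 0 n) + h + k0 * eps / 16)).
  { replace (h + lsum len (seq 0 n) + h) with (h + lsum len (seq 0 n) + (x n + h - x n)) by ring.
    apply outer_le_of_covered; [|lra].
    apply covered_mono with (1 := covered_union _ _ _ _ HcovO Hlast); [|lra].
    intros t [Ht HOt]. destruct (HE t Ht) as [Ht1 Ht2].
    destruct (Rle_lt_dec t (x n)); [left|right; unfold x in *; lra].
    split; [tauto|]. unfold x at 1. simpl. lra. }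
  (* Only finitely many intervals can be compared with the grid; the rest of the old cover is kept
     as it is, its length being small against the gain [k0 * m]. *)
  assert (HT : outer_le (fun t => E t /\ ~ O t) (k0 * eps / 8)).
  { exists (fun i => a (S N + i)%nat), (fun i => b (S N + i)%nat).
    split; [intros; apply Hab|]. split; [|exact HN].
    intros t [Ht HnO]. destruct (Hcov t Ht) as [i Hi].
    destruct (Nat.le_gt_cases i N) as [Hle|Hgt].
    - exfalso. apply HnO. exists i. tauto.
    - exists (i - S N)%nat. replace (S N + (i - S N))%nat with i by lia. exact Hi. }
  assert (Hlen0 : 0 <= lsum len (seq 0 n)).
  { clear - Hk0h Hk0h1. generalize (seq 0 n). intros L.
    induction L as [|k L IH]; simpl; [lra|].
    assert (0 <= len k); [|lra]. unfold len, ind.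
    destruct (excluded_middle_informative (meets k));
      destruct (excluded_middle_informative (~ good k)); lra. }
  apply outer_le_mono with (1 := outer_le_union _ _
    (h + lsum len (seq 0 n) + h + k0 * eps / 16) (k0 * eps / 8)
    ltac:(lra) ltac:(lra) HO HT).
  - intros t Ht. destruct (classic (O t)); tauto.
  - assert (Hkm : k0 * eps <= k0 * m) by (apply Rmult_le_compat_l; lra).
    assert (0 <= INR (S N) * h) by (apply Rmult_le_pos; [apply pos_INR|lra]).
    assert (0 <= k0 * (INR (S N) * h)) by (apply Rmult_le_pos; lra).
    unfold q in Hhq. lra.
Qed.

(** * The improvable parameters of a nice curve *)

Lemma covered_list_union {T : Type} (E : T -> R -> Prop) (m : R) (l : list T) :
  (forall t, In t l -> covered (E t) m) ->
  covered (fun s => exists t, In t l /\ E t s) (INR (length l) * m).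
Proof.
  induction l as [|t l IH]; intros H.
  - apply covered_empty; [simpl; lra|]. intros s [t [[] _]].
  - apply covered_mono with (1 := covered_union _ _ _ _ (H t (or_introl eq_refl))
      (IH (fun t' Ht' => H t' (or_intror Ht')))).
    + intros s [t' [[<-|Ht'] Hs]]; [left; exact Hs|right; exists t'; tauto].
    + simpl length. rewrite S_INR. lra.
Qed.

Lemma list_times_bound (ts : list R) (b : R) :
  (forall t, In t ts -> 0 < t) ->
  exists Q1, forall Q, Q1 <= Q -> forall t, In t ts -> b <= Q * t.
Proof.
  induction ts as [|t ts IH]; intros H.
  - exists 0. intros Q _ t [].
  - destruct IH as [Q1 HQ1]; [intros; apply H; right; assumption|].
    assert (Ht : 0 < t) by (apply H; left; reflexivity).
    exists (Rmax Q1 (b / t)). intros Q HQ t' [<-|Ht'].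
    + apply Rle_trans with (b / t * t); [right; field; lra|].
      apply Rmult_le_compat_r; [lra|]. eapply Rle_trans; [apply Rmax_r|exact HQ].
    + apply HQ1; [|exact Ht']. eapply Rle_trans; [apply Rmax_l|exact HQ].
Qed.

(** Porosity at the scale [l = 1 / (Q Q^r1)], which the flow expands to bounded size. The
    exceptional set consists of the points with a short vector at one of the five times; every other
    point has a good flag and hence a free interval nearby. *)
Lemma nice_curve_null (r1 r2 : R) (f g f' g' : R -> R) (lo hi c1 C rho0 Q0 sg T : R) :
  0 < r1 -> 0 < r2 -> r1 + r2 = 1 ->
  nice_curve r1 r2 f g f' g' lo hi c1 C rho0 Q0 -> 0 < sg < 1 ->
  null_set (fun t => lo <= t <= hi /\ forall Q, T <= Q -> improved_at r1 r2 sg Q (f t) (g t)).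
Proof.
  intros Hr1 Hr2 Hr HC Hsg.
  pose proof (nc_lt HC) as Hlt.
  pose proof (nc_c1 HC) as Hc1.
  pose proof (nc_C HC) as HCC.
  apply (porous_null _ lo hi); [exact Hlt|tauto|].
  intros m Hm.
  (* The multiples of Q are chosen only later, from [eta]; all that is known of them here is that
     there are five. *)
  destruct (nondivergence r1 r2 f g f' g' lo hi c1 C rho0 Q0 Hr1 Hr2 Hr HC (m / 5))
    as [eta [Heta Hnd]]; [lra|].
  destruct (good_flag_free r1 r2 f g f' g' lo hi c1 C rho0 Q0 Hr1 Hr2 Hr HC sg Hsg)
    as [eps [Heps Hfree]].
  destruct (exists_good_flag r1 r2 Hr1 Hr2 Hr eps eta (C / c1) Heps Heta)
    as [ts [ym [zm [X0 [Z0 [Q1 [Hlen [Hts [Hym [Hzm [HX0 [HZ0 Hflag]]]]]]]]]]]].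
  { apply Rdiv_nonneg; lra. }
  destruct (Hfree ym zm X0 Z0 Hym Hzm HX0 HZ0) as [th [S0 [Q2 [Hth [HS0 Hfr]]]]].
  destruct (list_times_bound ts (Rmax 1 Q0) Hts) as [Q3 HQ3].
  (* In units of [l], the free interval is centred at distance [|s0 / f' s| <= S0 / c1] from [s],
     and since [|f' s| <= C] the parameters within [th] of [s0] fill at least the radius
     [th / C]. *)
  exists (2 * th / C), (S0 / c1 + th / C).
  assert (HthC : 0 < th / C) by (apply Rdiv_lt_0_compat; lra).
  assert (HSc : 0 < S0 / c1) by (apply Rdiv_lt_0_compat; lra).
  split; [apply Rdiv_lt_0_compat; lra|]. split; [lra|].
  intros l0 Hl0.
  assert (HexQ : exists Q, Q1 <= Q /\ Q2 <= Q /\ Q3 <= Q /\ T <= Q /\ 1 <= Q /\ / l0 + 1 <= Q).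
  { exists (Rmax (Rmax Q1 Q2) (Rmax (Rmax Q3 T) (Rmax 1 (/ l0 + 1)))).
    pose proof (Rmax3_bounds Q1 Q2 (Rmax (Rmax Q3 T) (Rmax 1 (/ l0 + 1)))).
    pose proof (Rmax3_bounds Q3 T (Rmax 1 (/ l0 + 1))).
    pose proof (Rmax_l 1 (/ l0 + 1)). pose proof (Rmax_r 1 (/ l0 + 1)). lra. }
  destruct HexQ as [Q [HQ1' [HQ2' [HQ3' [HQT [HQge HQl]]]]]].
  assert (HP1 := Rpower_ge_1 Q r1 HQge ltac:(lra)).
  assert (HQP : 0 < Q * Rpower Q r1) by (apply Rmult_lt_0_compat; lra).
  set (l := / (Q * Rpower Q r1)).
  assert (Hl : 0 < l) by (apply Rinv_0_lt_compat; exact HQP).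
  exists l, (fun s => exists t, In t ts /\
    lo <= s <= hi /\ short_vector r1 r2 f g (Q * t) eta s).
  split; [split; [exact Hl|]|split].
  - assert (0 < / l0) by (apply Rinv_0_lt_compat; exact Hl0).
    apply Rle_lt_trans with (/ Q).
    + apply Rinv_le_contravar; [lra|]. apply Rle_mult_r; lra.
    + rewrite <- (Rinv_inv l0). apply Rinv_lt_contravar; [|lra]. apply Rmult_lt_0_compat; lra.
  - replace m with (INR (length ts) * (m / 5)) by (rewrite Hlen; simpl; field).
    apply covered_list_union. intros t Ht. specialize (HQ3 Q HQ3' t Ht).
    apply Hnd; eapply Rle_trans; [|exact HQ3| |exact HQ3]; [apply Rmax_r|apply Rmax_l].
  - intros s Hs HnB.
    destruct (Hflag (f s) (g s) Q (shear r1 r2 f' g' s) HQ1' HQge)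
      as [p1 [p2 [q [A [B [D HF]]]]]].
    { apply (shear_bound r1 r2 f g f' g' lo hi c1 C rho0 Q0 HC s Hs). }
    { apply shear_cond. }
    { intros t Ht u Hu. split; apply Rnot_lt_le; intros Hsh; apply HnB; exists t;
        (split; [exact Ht|]); (split; [exact Hs|]); exists u; tauto. }
    destruct (Hfr Q s p1 p2 q A B D HQ2' HQge Hs HF) as [s0 [Hs0 Hu]].
    pose proof (nc_f' HC s Hs) as Hf'.
    assert (Hf'0 : f' s <> 0) by (intros E; rewrite E, Rabs_R0 in Hf'; lra).
    set (x := s0 / f' s).
    assert (Hx : Rabs x <= S0 / c1).
    { unfold x, Rdiv. rewrite Rabs_mult, Rabs_inv. apply Rmult_le_compat; auto using Rabs_pos.
      - apply Rinv_nonneg. lra.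
      - apply Rinv_le_contravar; lra. }
    assert (Hxl : Rabs (x * l) <= S0 / c1 * l).
    { rewrite Rabs_mult, (Rabs_pos_eq l) by lra. apply Rmult_le_compat_r; lra. }
    apply Rabs_le_bounds in Hxl.
    exists (s + x * l - th / C * l). split; [|split].
    + rewrite Rmult_plus_distr_r. lra.
    + rewrite Rmult_plus_distr_r.
      replace (2 * th / C * l) with (2 * (th / C * l)) by (field; lra). lra.
    + intros t Ht [HtI Himp].
      assert (Htc : Rabs (t - (s + x * l)) <= th / C * l).
      { apply Rabs_le.
        replace (2 * th / C * l) with (2 * (th / C * l)) in Ht by (field; lra). lra. }
      set (u := (t - s) * (f' s * (Q * Rpower Q r1))).
      assert (Huv : Rabs (u - s0) <= th).
      { replace (u - s0) with ((t - (s + x * l)) * (f' s * (Q * Rpower Q r1))).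
        - rewrite !Rabs_mult, (Rabs_pos_eq Q), (Rabs_pos_eq (Rpower Q r1)) by lra.
          apply Rle_trans with (th / C * l * (C * (Q * Rpower Q r1))).
          + apply Rmult_le_compat; auto using Rabs_pos.
            * apply Rmult_le_pos; [apply Rabs_pos|lra].
            * apply Rmult_le_compat_r; lra.
          + right. unfold l. field. lra.
        - unfold u, x, l. field. split; [lra|]. split; [lra|exact Hf'0]. }
      specialize (Hu u Huv). cbv zeta in Hu.
      replace (s + u / (f' s * (Q * Rpower Q r1))) with t in Hu.
      * destruct (Hu HtI) as [Q' [HQ' Hni]]. apply Hni, Himp. lra.
      * unfold u. field. split; [lra|]. split; [lra|exact Hf'0].
Qed.

Lemma null_set_mono (E F : R -> Prop) : null_set F -> (forall x, E x -> F x) -> null_set E.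
Proof.
  intros HF HEF eps Heps. apply outer_le_mono with (1 := HF eps Heps); [exact HEF|lra].
Qed.

Lemma null_set_countable_union (E : nat -> R -> Prop) :
  (forall i, null_set (E i)) -> null_set (fun x => exists i, E i x).
Proof.
  intros HE eps Heps.
  apply (outer_le_countable_union E (fun i => eps / 2 * (/ 2) ^ i)).
  - intros i. apply HE. apply Rmult_lt_0_compat; [lra|]. apply pow_lt. lra.
  - intros N.
    assert (E' : sum_f_R0 (fun i => eps / 2 * (/ 2) ^ i) N = eps * (1 - (/ 2) ^ S N)).
    { induction N as [|N IH]; [simpl; field|]. rewrite tech5, IH. simpl. field. }
    rewrite E'. assert (0 < (/ 2) ^ S N) by (apply pow_lt; lra). nra.
Qed.

Lemma null_set_union (E F : R -> Prop) :
  null_set E -> null_set F -> null_set (fun x => E x \/ F x).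
Proof.
  intros HE HF eps Heps. replace eps with (eps / 2 + eps / 2) by field.
  apply outer_le_union; [lra|lra|apply HE; lra|apply HF; lra].
Qed.

Lemma null_set_point (a : R) : null_set (fun x => x = a).
Proof.
  intros eps Heps. apply outer_le_mono with (1 := outer_le_interval a a eps (Rle_refl a) Heps);
    [intros; lra|lra].
Qed.

Lemma nat_above (x : R) : exists n, x <= INR n.
Proof.
  exists (S (natfloor (Rabs x))). rewrite S_INR.
  destruct (natfloor_spec (Rabs x) (Rabs_pos x)). pose proof (Rle_abs x). lra.
Qed.

Lemma improved_at_mono (r1 r2 sg sg' Q al be : R) :
  0 <= Q -> sg <= sg' -> improved_at r1 r2 sg Q al be -> improved_at r1 r2 sg' Q al be.
Proof.
  intros HQ Hsg [q [p1 [p2 [Hq [H1 [H2 H3]]]]]]. exists q, p1, p2.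
  assert (HP1 := Rpower_pos Q (- r1)). assert (HP2 := Rpower_pos Q (- r2)).
  split; [exact Hq|]. split; [|split].
  - eapply Rlt_le_trans; [exact H1|]. apply Rmult_le_compat_r; lra.
  - eapply Rlt_le_trans; [exact H2|]. apply Rmult_le_compat_r; lra.
  - eapply Rlt_le_trans; [exact H3|]. apply Rmult_le_compat_r; lra.
Qed.

(** Improvement is monotone in [sg], so the values [1 - 1 / (n + 2)], together with integer bounds
    on the time, exhaust the improvable set by countably many null sets. *)
Lemma nice_curve_improvable_null (r1 r2 : R) (f g f' g' : R -> R) (lo hi c1 C rho0 Q0 : R) :
  0 < r1 -> 0 < r2 -> r1 + r2 = 1 ->
  nice_curve r1 r2 f g f' g' lo hi c1 C rho0 Q0 ->
  null_set (fun t => lo <= t <= hi /\ DI_improvable r1 r2 (f t, g t)).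
Proof.
  intros Hr1 Hr2 Hr HC.
  apply null_set_mono with (F := fun t => exists n T : nat,
    lo <= t <= hi /\ forall Q, INR T <= Q -> improved_at r1 r2 (1 - / (INR n + 2)) Q (f t) (g t)).
  - apply null_set_countable_union. intros n. apply null_set_countable_union. intros T.
    apply (nice_curve_null r1 r2 f g f' g' lo hi c1 C rho0 Q0); try assumption.
    pose proof (pos_INR n). assert (0 < / (INR n + 2)) by (apply Rinv_0_lt_compat; lra).
    assert (/ (INR n + 2) <= / 2) by (apply Rinv_le_contravar; lra). lra.
  - intros t [Ht [sg [Hsg [T HT]]]].
    destruct (nat_above (/ (1 - sg))) as [n Hn]. destruct (nat_above T) as [k Hk].
    exists n, k. split; [exact Ht|]. intros Q HQ.
    apply improved_at_mono with (sg := sg).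
    + pose proof (pos_INR k). lra.
    + assert (0 < / (1 - sg)) by (apply Rinv_0_lt_compat; lra).
      assert (/ (INR n + 2) <= / / (1 - sg)) by (apply Rinv_le_contravar; lra).
      rewrite Rinv_inv in H0. lra.
    + apply HT. lra.
Qed.

Lemma DI_improvable_swap (r1 r2 x y : R) :
  DI_improvable r1 r2 (x, y) -> DI_improvable r2 r1 (y, x).
Proof.
  intros [sg [Hsg [Q0 H]]]. exists sg. split; [exact Hsg|]. exists Q0. intros Q HQ.
  destruct (H Q HQ) as [q [p1 [p2 [Hq [H1 [H2 H3]]]]]]. exists q, p2, p1. auto.
Qed.

Lemma badly_approximable_swap (r1 r2 x y : R) :
  badly_approximable r1 r2 (x, y) -> badly_approximable r2 r1 (y, x).
Proof.
  intros [c [Hc H]]. exists c. split; [exact Hc|]. intros q p1 p2 Hq.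
  rewrite Rmax_comm. exact (H q p2 p1 Hq).
Qed.

(** * Lines *)

(** Minkowski's theorem for a box, with 4 instead of 1: the pigeonhole rounds two counts up, each at
    the cost of a factor at most 2. *)
Lemma dirichlet_box (r1 r2 al be Q u w zm : R) :
  r1 + r2 = 1 -> 1 <= Q -> 0 < u -> 0 < w -> 0 < zm ->
  u <= Rpower Q r1 -> w <= Rpower Q r2 -> 4 <= u * w * zm ->
  exists q p1 p2 : Z, (0 < q)%Z /\ IZR q / Q <= zm /\
    Rabs (Rpower Q r1 * (IZR q * al - IZR p1)) <= u /\
    Rabs (Rpower Q r2 * (IZR q * be - IZR p2)) <= w.
Proof.
  intros Hr HQ Hu Hw HZ HuP HwP HuwZ.
  assert (HPQ := Rpower_r1_r2 r1 r2 Hr Q ltac:(lra)).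
  assert (HP1 := Rpower_pos Q r1). assert (HP2 := Rpower_pos Q r2).
  set (P1 := Rpower Q r1) in *. set (P2 := Rpower Q r2) in *.
  destruct (natfloor_spec (zm * Q)) as [N1 N2]; [nra|].
  destruct (dirichlet al be 0 (u / P1) (w / P2) (S (natfloor (zm * Q))))
    as [q [p1 [p2 [Hq [Hqn [Hx Hy]]]]]].
  { apply Rdiv_lt_0_compat; assumption. }
  { apply Rdiv_lt_0_compat; assumption. }
  { rewrite S_INR. eapply Rle_lt_trans; [|exact N2].
    rewrite Rabs_R0, Rmult_0_r, Rplus_0_r.
    replace (1 / (u / P1)) with (P1 / u) by (field; lra).
    replace (1 / (w / P2)) with (P2 / w) by (field; lra).
    assert (1 <= P1 / u).
    { apply Rmult_le_reg_r with u; [lra|]. rewrite Rdiv_mult_cancel; lra. }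
    assert (1 <= P2 / w).
    { apply Rmult_le_reg_r with w; [lra|]. rewrite Rdiv_mult_cancel; lra. }
    apply Rle_trans with (2 * (P1 / u) * (2 * (P2 / w))).
    - apply Rmult_le_compat; lra.
    - replace (2 * (P1 / u) * (2 * (P2 / w))) with (4 * (Q / (u * w)))
        by (rewrite <- HPQ; field; lra).
      apply Rle_trans with (u * w * zm * (Q / (u * w))).
      + apply Rmult_le_compat_r; [|exact HuwZ]. apply Rlt_le, Rdiv_lt_0_compat; [lra|].
        apply Rmult_lt_0_compat; assumption.
      + right. field. lra. }
  exists q, p1, p2. split; [exact Hq|]. split; [|split].
  - assert (IZR q <= zm * Q).
    { apply Rle_trans with (INR (natfloor (zm * Q))); [|exact N1].
      rewrite INR_IZR_INZ in Hqn |- *. apply lt_IZR in Hqn. apply IZR_le. lia. }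
    apply Rmult_le_reg_r with Q; [lra|]. rewrite Rdiv_mult_cancel; lra.
  - rewrite Rabs_mult, (Rabs_pos_eq P1) by lra.
    apply Rmult_le_compat_l with (r := P1) in Hx; [|lra].
    replace (P1 * (u / P1)) with u in Hx by (field; lra). exact Hx.
  - rewrite Rmult_0_l, Rminus_0_r in Hy. rewrite Rabs_mult, (Rabs_pos_eq P2) by lra.
    apply Rmult_le_compat_l with (r := P2) in Hy; [|lra].
    replace (P2 * (w / P2)) with w in Hy by (field; lra). exact Hy.
Qed.

(** A positive [x] is at most [mu / Q^r], whose power [1 / r] is [mu^(1 / r) / Q], and
    [mu^(1 / r) <= mu] because [mu <= 1]; at [x = 0] the convention for [rpow] gives 0. *)
Lemma rpow_small (r x mu Q : R) :
  0 < r < 1 -> 0 < mu <= 1 -> 1 <= Q -> 0 <= x -> Rpower Q r * x <= mu ->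
  rpow x (1 / r) <= mu / Q.
Proof.
  intros Hr Hmu HQ Hx HPx. unfold rpow. destruct (Rle_dec x 0) as [_|Hx0].
  - apply Rdiv_nonneg; lra.
  - assert (HP := Rpower_pos Q r).
    assert (Hir : 1 <= 1 / r).
    { unfold Rdiv. rewrite Rmult_1_l, <- Rinv_1. apply Rinv_le_contravar; lra. }
    apply Rle_trans with (Rpower (mu / Rpower Q r) (1 / r)).
    + apply Rpower_le_mono; [lra| |lra].
      apply Rmult_le_reg_l with (Rpower Q r); [exact HP|].
      replace (Rpower Q r * (mu / Rpower Q r)) with mu by (field; lra). exact HPx.
    + unfold Rdiv at 1. rewrite <- Rpower_mult_distr; [|lra|apply Rinv_0_lt_compat; exact HP].
      rewrite Rpower_inv by exact HP. rewrite Rpower_mult.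
      replace (r * (1 / r)) with 1 by (field; lra). rewrite Rpower_1 by lra.
      apply Rmult_le_compat_r; [apply Rinv_nonneg; lra|].
      replace mu with (/ / mu) by apply Rinv_inv.
      assert (Him : 1 <= / mu) by (rewrite <- Rinv_1; apply Rinv_le_contravar; lra).
      rewrite Rpower_inv by lra. apply Rinv_le_contravar; [lra|].
      rewrite <- (Rpower_1 (/ mu)) at 1 by lra. apply Rle_Rpower; assumption.
Qed.

(* Khintchine's transference: a short dual vector w makes the lattice points of a large box
   lie in a plane, on which Minkowski's theorem yields a short vector. *)
Lemma badly_approximable_dual (r1 r2 al be : R) :
  0 < r1 -> 0 < r2 -> r1 + r2 = 1 -> badly_approximable r1 r2 (al, be) ->
  exists rho Q0, 0 < rho /\ forall Q w, Q0 <= Q -> 1 <= Q -> w <> zzero ->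
    rho < wnorm (Rpower Q r1) (Rpower Q r2) al be w.
Proof.
  intros Hr1 Hr2 Hr [c [Hc Hba]]. simpl in Hba.
  set (mu := Rmin (1 / 4) (c / 2)).
  assert (Hmu : 0 < mu) by (apply Rmin_glb_lt; lra).
  assert (Hmu1 : mu <= 1 / 4) by apply Rmin_l. assert (Hmuc : mu <= c / 2) by apply Rmin_r.
  (* A box with two sides [mu] and one side [D] then satisfies the volume condition of
     [dirichlet_box]. The bound [1 / (4 D)] on w makes each of the three terms of its pairing with a
     point of the box at most 1/4, so the integer pairing vanishes. *)
  set (D := 4 / (mu * mu)).
  assert (HD : mu * mu * D = 4) by (unfold D; field; lra).
  assert (HD1 : 1 <= D) by nra.
  destruct (large_power r1 D Hr1) as [Qa HQa]. destruct (large_power r2 D Hr2) as [Qb HQb].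
  exists (/ (4 * D)), (Rmax Qa Qb).
  assert (Hrho : 0 < / (4 * D)) by (apply Rinv_0_lt_compat; lra).
  assert (HrhoD : / (4 * D) * D = 1 / 4) by (field; lra).
  split; [exact Hrho|]. intros Q [[A B] C] HQ HQ1 Hw. apply Rnot_le_lt. intros Hwn.
  specialize (HQa Q (Rle_trans _ _ _ (Rmax_l _ _) HQ) HQ1).
  specialize (HQb Q (Rle_trans _ _ _ (Rmax_r _ _) HQ) HQ1).
  assert (HPQ := Rpower_r1_r2 r1 r2 Hr Q ltac:(lra)).
  
  unfold wnorm in Hwn.
  set (a := IZR A / Rpower Q r1) in *. set (b := IZR B / Rpower Q r2) in *.
  set (d := Rpower Q r1 * Rpower Q r2 * (IZR A * al + IZR B * be + IZR C)) in *.
  destruct (Rmax3_bounds (Rabs a) (Rabs b) (Rabs d)) as [Ba [Bb Bd]].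
  assert (Hno : forall q p1 p2 : Z, (0 < q)%Z -> IZR q / Q <= 2 * mu ->
    Rabs (Rpower Q r1 * (IZR q * al - IZR p1)) <= 2 * mu ->
    Rabs (Rpower Q r2 * (IZR q * be - IZR p2)) <= 2 * mu -> False).
  { intros q p1 p2 Hq Hz Hx Hy.
    specialize (Hba (Z.to_nat q) p1 p2 ltac:(lia)). unfold dev in Hba.
    rewrite INR_IZR_INZ, Z2Nat.id in Hba by lia.
    rewrite Rabs_mult, Rabs_pos_eq in Hx, Hy by lra.
    assert (HqR : 0 < IZR q) by (apply IZR_lt; exact Hq).
    assert (H1 : rpow (Rabs (IZR q * al - IZR p1)) (1 / r1) <= 2 * mu / Q)
      by (apply rpow_small; auto using Rabs_pos; lra).
    assert (H2 : rpow (Rabs (IZR q * be - IZR p2)) (1 / r2) <= 2 * mu / Q)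
      by (apply rpow_small; auto using Rabs_pos; lra).
    assert (Hcq : c / IZR q <= 2 * mu / Q)
      by (apply Rge_le in Hba; eapply Rle_trans; [exact Hba|]; apply Rmax_lub; assumption).
    apply Rmult_le_compat_r with (r := IZR q) in Hcq; [|lra].
    replace (c / IZR q * IZR q) with c in Hcq by (field; lra).
    replace (2 * mu / Q * IZR q) with (2 * mu * (IZR q / Q)) in Hcq by (field; lra).
    nra. }
  assert (Hplane : forall q p1 p2 : Z, (0 < q)%Z -> IZR q / Q <= D ->
    Rabs (Rpower Q r1 * (IZR q * al - IZR p1)) <= D ->
    Rabs (Rpower Q r2 * (IZR q * be - IZR p2)) <= D ->
    d * (IZR q / Q) = a * (Rpower Q r1 * (IZR q * al - IZR p1))
      + b * (Rpower Q r2 * (IZR q * be - IZR p2))).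
  { intros q p1 p2 Hq Hz Hx Hy.
    assert (HqR : 0 < IZR q) by (apply IZR_lt; exact Hq).
    assert (Hz0 : 0 <= IZR q / Q) by (apply Rdiv_nonneg; lra).
    assert (E : IZR (A * p1 + B * p2 + C * q) = d * (IZR q / Q)
      - a * (Rpower Q r1 * (IZR q * al - IZR p1)) - b * (Rpower Q r2 * (IZR q * be - IZR p2))).
    { rewrite !plus_IZR, !mult_IZR. unfold a, b, d. rewrite HPQ. field. lra. }
    set (x := Rpower Q r1 * (IZR q * al - IZR p1)) in *.
    set (y := Rpower Q r2 * (IZR q * be - IZR p2)) in *.
    set (z := IZR q / Q) in *.
    destruct (Z.eq_dec (A * p1 + B * p2 + C * q) 0) as [E0|E0]; [rewrite E0 in E; lra|].
    exfalso.
    assert (Hint : 1 <= Rabs (IZR (A * p1 + B * p2 + C * q)))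
      by (apply Rabs_IZR_ge_1; lia).
    rewrite E in Hint.
    assert (Hprod : forall u v, Rabs u <= / (4 * D) -> Rabs v <= D -> Rabs (u * v) <= 1 / 4).
    { intros u v Hu Hv. rewrite Rabs_mult, <- HrhoD.
      apply Rmult_le_compat; auto using Rabs_pos. }
    assert (T1 := Hprod d z ltac:(lra) ltac:(rewrite Rabs_pos_eq; lra)).
    assert (T2 := Hprod a x ltac:(lra) Hx). assert (T3 := Hprod b y ltac:(lra) Hy).
    apply Rabs_le_bounds in T1, T2, T3.
    assert (Rabs (d * z - a * x - b * y) <= 3 / 4) by (apply Rabs_le; lra). lra. }
  assert (Hsolve : forall u v w x y z : R, u * x = v * y + w * z -> Rabs v <= Rabs u ->
    Rabs w <= Rabs u -> 0 < Rabs u -> Rabs y <= mu -> Rabs z <= mu -> Rabs x <= 2 * mu).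
  { intros u v w x y z E Hv Hw' Hu Hy Hz.
    apply Rmult_le_reg_l with (Rabs u); [exact Hu|]. rewrite <- Rabs_mult, E.
    eapply Rle_trans; [apply Rabs_triang|]. rewrite !Rabs_mult.
    assert (Rabs v * Rabs y <= Rabs u * mu) by (apply Rmult_le_compat; auto using Rabs_pos).
    assert (Rabs w * Rabs z <= Rabs u * mu) by (apply Rmult_le_compat; auto using Rabs_pos).
    lra. }
  assert (Hnz : 0 < Rabs a \/ 0 < Rabs b \/ 0 < Rabs d).
  { apply NNPP. intros Hn. apply Hw.
    assert (Hz : forall t, ~ 0 < Rabs t -> t = 0).
    { intros t Ht. destruct (Req_dec t 0) as [?|Hne]; [assumption|].
      exfalso. apply Ht, Rabs_pos_lt, Hne. }
    assert (a = 0) by (apply Hz; tauto). assert (b = 0) by (apply Hz; tauto).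
    assert (d = 0) by (apply Hz; tauto).
    assert (EA : IZR A = 0).
    { replace (IZR A) with (a * Rpower Q r1) by (unfold a; field; lra). rewrite H. ring. }
    assert (EB : IZR B = 0).
    { replace (IZR B) with (b * Rpower Q r2) by (unfold b; field; lra). rewrite H0. ring. }
    unfold d in H1. rewrite HPQ, EA, EB in H1.
    assert (EC : IZR C = 0) by nra.
    apply eq_IZR in EA, EB, EC. subst. reflexivity. }
  assert (Hpq : forall q : Z, (0 < q)%Z -> 0 < IZR q / Q)
    by (intros q Hq; apply Rdiv_lt_0_compat; [apply IZR_lt; exact Hq|lra]).
  (* The equation of the plane is solved for the coordinate with the largest coefficient. The box is
     long exactly in that direction, and the equation brings this coordinate down to [2 * mu] as
     well. *)
  destruct (Rle_lt_dec (Rabs a) (Rabs d)) as [Had|Had];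
    [destruct (Rle_lt_dec (Rabs b) (Rabs d)) as [Hbd|Hbd] |
     destruct (Rle_lt_dec (Rabs b) (Rabs a)) as [Hba'|Hba']].
  - destruct (dirichlet_box r1 r2 al be Q mu mu D) as [q [p1 [p2 [Hq [Hz [Hx Hy]]]]]]; try lra.
    apply (Hno q p1 p2 Hq); try lra.
    pose proof (Hplane q p1 p2 Hq Hz ltac:(lra) ltac:(lra)) as E.
    specialize (Hpq q Hq).
    rewrite <- (Rabs_pos_eq (IZR q / Q)) by lra.
    apply (Hsolve d a b _ _ _ E); try assumption. lra.
  - destruct (dirichlet_box r1 r2 al be Q mu D mu) as [q [p1 [p2 [Hq [Hz [Hx Hy]]]]]]; try lra.
    apply (Hno q p1 p2 Hq); try lra.
    pose proof (Hplane q p1 p2 Hq ltac:(lra) ltac:(lra) Hy) as E.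
    specialize (Hpq q Hq).
    apply (Hsolve b d (- a) _ (IZR q / Q) (Rpower Q r1 * (IZR q * al - IZR p1)));
      rewrite ?Rabs_Ropp; try lra. rewrite Rabs_pos_eq; lra.
  - destruct (dirichlet_box r1 r2 al be Q D mu mu) as [q [p1 [p2 [Hq [Hz [Hx Hy]]]]]]; try lra.
    apply (Hno q p1 p2 Hq); try lra.
    pose proof (Hplane q p1 p2 Hq ltac:(lra) Hx ltac:(lra)) as E.
    specialize (Hpq q Hq).
    apply (Hsolve a d (- b) _ (IZR q / Q) (Rpower Q r2 * (IZR q * be - IZR p2)));
      rewrite ?Rabs_Ropp; try lra. rewrite Rabs_pos_eq; lra.
  - destruct (dirichlet_box r1 r2 al be Q mu D mu) as [q [p1 [p2 [Hq [Hz [Hx Hy]]]]]]; try lra.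
    apply (Hno q p1 p2 Hq); try lra.
    pose proof (Hplane q p1 p2 Hq ltac:(lra) ltac:(lra) Hy) as E.
    specialize (Hpq q Hq).
    apply (Hsolve b d (- a) _ (IZR q / Q) (Rpower Q r1 * (IZR q * al - IZR p1)));
      rewrite ?Rabs_Ropp; try lra. rewrite Rabs_pos_eq; lra.
Qed.

(** Two values at distance [d] bound the slope by [2 e / d], which gives [e + 2 e r] for the ratio
    [r = (b - a) / d >= 1]; the form [3 e r^2] is the one that [nc_good] asks for. *)
Lemma affine_good (k b0 a b e d s1 s2 s : R) :
  0 <= e -> 0 < d -> d <= b - a -> a <= s1 -> s1 + d <= s2 -> s2 <= b -> a <= s <= b ->
  Rabs (k * s1 + b0) <= e -> Rabs (k * s2 + b0) <= e ->
  Rabs (k * s + b0) <= 3 * e * ((b - a) / d) ^ 2.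
Proof.
  intros He Hd Hdb H1 H2 H3 Hs F1 F2.
  set (r := (b - a) / d).
  assert (Hr : 1 <= r).
  { apply Rmult_le_reg_r with d; [exact Hd|]. unfold r, Rdiv.
    rewrite Rmult_assoc, Rinv_l by lra. lra. }
  assert (Hrd : r * d = b - a) by (unfold r; field; lra).
  assert (Hk : Rabs k * d <= 2 * e).
  { apply Rle_trans with (Rabs (k * (s2 - s1))).
    - rewrite Rabs_mult, (Rabs_pos_eq (s2 - s1)) by lra.
      apply Rmult_le_compat_l; [apply Rabs_pos|lra].
    - replace (k * (s2 - s1)) with ((k * s2 + b0) - (k * s1 + b0)) by ring.
      eapply Rle_trans; [apply Rabs_minus_le|]. lra. }
  replace (k * s + b0) with ((k * s1 + b0) + k * (s - s1)) by ring.
  eapply Rle_trans; [apply Rabs_triang|]. rewrite Rabs_mult.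
  assert (Hss : Rabs (s - s1) <= r * d) by (rewrite Hrd; apply Rabs_le; lra).
  assert (Rabs k * Rabs (s - s1) <= 2 * e * r).
  { apply Rle_trans with (Rabs k * (r * d)).
    - apply Rmult_le_compat_l; [apply Rabs_pos|exact Hss].
    - replace (Rabs k * (r * d)) with (Rabs k * d * r) by ring.
      apply Rmult_le_compat_r; lra. }
  assert (e * 1 <= e * (r * r)) by (apply Rmult_le_compat_l; nra).
  assert (2 * e * r <= 2 * e * (r * r)) by (apply Rmult_le_compat_l; nra).
  replace (r ^ 2) with (r * r) by ring. lra.
Qed.

(** The first and second order estimates are those of affine functions. [nc_top] is witnessed at the
    centre [t0], where by transference no dual vector is ever small. *)
Lemma line_nice (r1 r2 a1 a2 d1 d2 t0 h : R) :
  0 < r1 -> 0 < r2 -> r1 + r2 = 1 -> 0 < h -> d1 <> 0 -> r2 <= r1 \/ d2 = 0 ->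
  badly_approximable r1 r2 (a1 + t0 * d1, a2 + t0 * d2) ->
  exists c1 C rho0 Q0, nice_curve r1 r2 (fun t => a1 + t * d1) (fun t => a2 + t * d2)
    (fun _ => d1) (fun _ => d2) (t0 - h) (t0 + h) c1 C rho0 Q0.
Proof.
  intros Hr1 Hr2 Hr Hh Hd1 Hdir Hba.
  destruct (badly_approximable_dual r1 r2 _ _ Hr1 Hr2 Hr Hba) as [rho0 [Q0 [Hrho Hdual]]].
  exists (Rabs d1), (3 + Rabs d1 + Rabs d2), rho0, Q0.
  assert (0 < Rabs d1) by (apply Rabs_pos_lt; exact Hd1). pose proof (Rabs_pos d2).
  constructor; try lra.
  - intros s t _ _. replace (a1 + t * d1 - (a1 + s * d1)) with (d1 * (t - s)) by ring.
    rewrite Rabs_mult. lra.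
  - intros s t _ _. replace (a1 + t * d1 - (a1 + s * d1)) with (d1 * (t - s)) by ring.
    rewrite Rabs_mult. apply Rmult_le_compat_r; [apply Rabs_pos|lra].
  - intros s t _ _. replace (a2 + t * d2 - (a2 + s * d2)) with (d2 * (t - s)) by ring.
    rewrite Rabs_mult. apply Rmult_le_compat_r; [apply Rabs_pos|lra].
  - intros s _. lra.
  - intros s _. lra.
  - intros s t _ _. replace (a1 + t * d1 - (a1 + s * d1) - d1 * (t - s)) with 0 by ring.
    rewrite Rabs_R0. apply Rmult_le_pos; [lra|apply pow2_ge_0].
  - intros s t _ _. replace (a2 + t * d2 - (a2 + s * d2) - d2 * (t - s)) with 0 by ring.
    rewrite Rabs_R0. apply Rmult_le_pos; [lra|apply pow2_ge_0].
  - destruct Hdir as [Hdir | ->]; [left; exact Hdir|right]. intros s _. split; [ring|reflexivity].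
  - intros A B D a b e d s1 s2 s3 s4 _ _ He Hd H1 H2 H3 H4 H5 F1 F2 _ _ s Hs.
    assert (E : forall t, A * (a1 + t * d1) + B * (a2 + t * d2) + D
      = (A * d1 + B * d2) * t + (A * a1 + B * a2 + D)) by (intros; ring).
    rewrite E in F1, F2 |- *.
    eapply Rle_trans; [apply (affine_good _ _ a b e d s1 s2 s); try assumption; lra|].
    apply Rmult_le_compat_r; [apply pow2_ge_0|]. apply Rmult_le_compat_r; lra.
  - intros Q w HQ HQ1 Hw. exists t0. split; [lra|]. apply Hdual; assumption.
Qed.

(** The line is exhausted by intervals centred at [t0], so that each of them contains the badly
    approximable point. *)
Lemma line_improvable_null (r1 r2 a1 a2 d1 d2 t0 : R) :
  0 < r1 -> 0 < r2 -> r1 + r2 = 1 -> d1 <> 0 -> r2 <= r1 \/ d2 = 0 ->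
  badly_approximable r1 r2 (a1 + t0 * d1, a2 + t0 * d2) ->
  null_set (fun t => DI_improvable r1 r2 (a1 + t * d1, a2 + t * d2)).
Proof.
  intros Hr1 Hr2 Hr Hd1 Hdir Hba.
  apply null_set_mono with (F := fun t => exists n : nat,
    t0 - (INR n + 1) <= t <= t0 + (INR n + 1) /\
    DI_improvable r1 r2 (a1 + t * d1, a2 + t * d2)).
  - apply null_set_countable_union. intros n. pose proof (pos_INR n).
    destruct (line_nice r1 r2 a1 a2 d1 d2 t0 (INR n + 1)) as [c1 [C [rho0 [Q0 HC]]]];
      try assumption; [lra|].
    exact (nice_curve_improvable_null _ _ _ _ _ _ _ _ _ _ _ _ Hr1 Hr2 Hr HC).
  - intros t Ht. destruct (nat_above (Rabs (t - t0))) as [n Hn]. exists n.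
    apply Rabs_le_bounds in Hn. split; [lra|exact Ht].
Qed.

(** Exchanging the coordinates if necessary, the first one is not constant and either has the larger
    weight or is the only one that moves. *)
Lemma line_theorem (r1 r2 : R) (a d : R * R) (t0 : R) :
  0 < r1 -> 0 < r2 -> r1 + r2 = 1 -> d <> (0, 0) ->
  badly_approximable r1 r2 (fst a + t0 * fst d, snd a + t0 * snd d) ->
  null_set (fun t => DI_improvable r1 r2 (fst a + t * fst d, snd a + t * snd d)).
Proof.
  intros Hr1 Hr2 Hr Hd Hba. destruct a as [a1 a2], d as [d1 d2]. simpl in *.
  destruct (classic (d1 <> 0 /\ (r2 <= r1 \/ d2 = 0))) as [[H1 H2]|Hn].
  - apply (line_improvable_null r1 r2 a1 a2 d1 d2 t0); assumption.
  - apply null_set_mono with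
      (F := fun t => DI_improvable r2 r1 (a2 + t * d2, a1 + t * d1));
      [|intros t; apply DI_improvable_swap].
    apply (line_improvable_null r2 r1 a2 a1 d2 d1 t0); [lra|lra|lra| | |].
    + intros E. apply Hn. split; [|right; exact E].
      intros E1. apply Hd. subst. reflexivity.
    + destruct (Req_dec d1 0) as [E1|E1]; [right; exact E1|left].
      apply Rnot_lt_le. intros Hlt. apply Hn. split; [exact E1|left; lra].
    + apply badly_approximable_swap. exact Hba.
Qed.

(** * Curves *)

Lemma mvt_closed (F F' : R -> R) (lo hi s t : R) :
  (forall c, lo <= c <= hi -> derivable_pt_lim F c (F' c)) ->
  lo <= s <= hi -> lo <= t <= hi ->
  exists x, lo <= x <= hi /\ Rmin s t <= x <= Rmax s t /\ F t - F s = F' x * (t - s).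
Proof.
  intros HF Hs Ht. destruct (Rtotal_order s t) as [H|[H|H]].
  - destruct (MVT_cor2 F F' s t H) as [x [E Hx]]; [intros; apply HF; lra|].
    exists x. rewrite Rmin_left, Rmax_right by lra. repeat split; try lra.
  - subst t. exists s. rewrite Rmin_left, Rmax_left by lra. repeat split; lra.
  - destruct (MVT_cor2 F F' t s H) as [x [E Hx]]; [intros; apply HF; lra|].
    exists x. rewrite Rmin_right, Rmax_left by lra. repeat split; try lra.
Qed.

(** Two chords give points [x1], [x2] at distance at least [d] where [F1] is at most [2 e / d], and
    between them [F2] is at most [4 e / d^2] somewhere; this is the reason for four points.
    Whichever derivative is bounded below then bounds [m], and integrating back bounds [F]. The
    bound on [m] itself is used to exclude integer lines close to the whole curve. *)
Lemma two_derivatives_good (F F1 F2 : R -> R) (lo hi c K m a b e d s1 s2 s3 s4 : R) :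
  (forall s, lo <= s <= hi -> derivable_pt_lim F s (F1 s)) ->
  (forall s, lo <= s <= hi -> derivable_pt_lim F1 s (F2 s)) ->
  (forall s, lo <= s <= hi -> Rabs (F1 s) <= K * m /\ Rabs (F2 s) <= K * m) ->
  (forall s, lo <= s <= hi -> c * m <= Rabs (F1 s)) \/
  (forall s, lo <= s <= hi -> c * m <= Rabs (F2 s)) ->
  0 < c -> 0 <= K -> 0 <= m -> lo <= a -> b <= hi -> 0 <= e -> 0 < d ->
  a <= s1 -> s1 + d <= s2 -> s2 + d <= s3 -> s3 + d <= s4 -> s4 <= b ->
  Rabs (F s1) <= e -> Rabs (F s2) <= e -> Rabs (F s3) <= e -> Rabs (F s4) <= e ->
  m <= (2 / (c * d) + 4 / (c * d ^ 2)) * e /\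
  forall s, a <= s <= b -> Rabs (F s) <= (3 + 4 * K / c) * e * ((b - a) / d) ^ 2.
Proof.
  intros D1 D2 HK Hc' Hc HK0 Hm Ha Hb He Hd H1 H2 H3 H4 H5 E1 E2 E3 E4.
  set (r := (b - a) / d).
  assert (Hrd : r * d = b - a) by (unfold r; field; lra).
  assert (Hr : 1 <= r) by nra.
  assert (Hd2 : 0 < d ^ 2) by (apply pow_lt; exact Hd).
  assert (Hcd : 0 < c * d) by (apply Rmult_lt_0_compat; assumption).
  assert (Hcd2 : 0 < c * d ^ 2) by (apply Rmult_lt_0_compat; assumption).
  assert (Hcd' : 0 < 2 / (c * d)) by (apply Rdiv_lt_0_compat; lra).
  assert (Hcd2' : 0 < 4 / (c * d ^ 2)) by (apply Rdiv_lt_0_compat; lra).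
  assert (Hchord : forall u v, lo <= u <= hi -> lo <= v <= hi -> u + d <= v ->
    Rabs (F u) <= e -> Rabs (F v) <= e -> exists x, u <= x <= v /\ Rabs (F1 x) * d <= 2 * e).
  { intros u v Hu Hv Huv Eu Ev.
    destruct (mvt_closed F F1 lo hi u v D1 Hu Hv) as [x [Hx [Hx' E]]].
    rewrite Rmin_left, Rmax_right in Hx' by lra. exists x. split; [exact Hx'|].
    apply Rle_trans with (Rabs (F1 x * (v - u))).
    - rewrite Rabs_mult, (Rabs_pos_eq (v - u)) by lra.
      apply Rmult_le_compat_l; [apply Rabs_pos|lra].
    - rewrite <- E. eapply Rle_trans; [apply Rabs_minus_le|]. lra. }
  destruct (Hchord s1 s2) as [x1 [Hx1 G1]]; try assumption; try lra.
  destruct (Hchord s3 s4) as [x2 [Hx2 G2]]; try assumption; try lra.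
  assert (Hm2 : c * m * d <= 2 * e \/ c * m * d * d <= 4 * e).
  { destruct Hc' as [Hc'|Hc'].
    - left. specialize (Hc' x1 ltac:(lra)).
      apply Rle_trans with (Rabs (F1 x1) * d); [apply Rmult_le_compat_r; lra|exact G1].
    - right.
      destruct (mvt_closed F1 F2 lo hi x1 x2 D2 ltac:(lra) ltac:(lra)) as [x [Hx [_ E]]].
      specialize (Hc' x Hx).
      apply Rle_trans with (Rabs (F1 x2 - F1 x1) * d).
      + apply Rmult_le_compat_r; [lra|]. rewrite E, Rabs_mult, (Rabs_pos_eq (x2 - x1)) by lra.
        apply Rmult_le_compat; try lra. apply Rmult_le_pos; lra.
      + apply Rle_trans with ((Rabs (F1 x2) + Rabs (F1 x1)) * d); [|lra].
        apply Rmult_le_compat_r; [lra|]. eapply Rle_trans; [apply Rabs_minus_le|]. lra. }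
  assert (Hme : m <= (2 / (c * d) + 4 / (c * d ^ 2)) * e).
  { rewrite Rmult_plus_distr_r. destruct Hm2 as [Hm2|Hm2].
    - assert (0 <= 4 / (c * d ^ 2) * e) by (apply Rmult_le_pos; lra).
      assert (m <= 2 / (c * d) * e); [|lra].
      apply Rmult_le_reg_l with (c * d); [exact Hcd|].
      replace (c * d * (2 / (c * d) * e)) with (2 * e) by (field; lra). lra.
    - assert (0 <= 2 / (c * d) * e) by (apply Rmult_le_pos; lra).
      assert (m <= 4 / (c * d ^ 2) * e); [|lra].
      apply Rmult_le_reg_l with (c * d ^ 2); [exact Hcd2|].
      replace (c * d ^ 2 * (4 / (c * d ^ 2) * e)) with (4 * e) by (field; lra).
      replace (c * d ^ 2 * m) with (c * m * d * d) by ring. exact Hm2. }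
  split; [exact Hme|].
  intros s Hs.
  destruct (mvt_closed F F1 lo hi s1 s D1 ltac:(lra) ltac:(lra)) as [x [Hx [Hx' E]]].
  assert (Hxab : a <= x <= b).
  { split; [apply Rle_trans with (Rmin s1 s)|apply Rle_trans with (Rmax s1 s)]; try apply Hx'.
    - apply Rmin_glb; lra.
    - apply Rmax_lub; lra. }
  assert (HF1 : Rabs (F1 x) * d <= (2 + 4 * K / c) * e * r).
  { assert (HKc : 0 <= K / c).
    { apply Rmult_le_pos; [exact HK0|]. apply Rinv_nonneg. exact Hc. }
    assert (HKer : 0 <= K / c * e) by (apply Rmult_le_pos; assumption).
    assert (Her : e * 1 <= e * r) by (apply Rmult_le_compat_l; lra).
    assert (HKer1 : K / c * e * 1 <= K / c * e * r) by (apply Rmult_le_compat_l; lra).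
    replace (4 * K / c) with (4 * (K / c)) by (field; lra).
    destruct Hm2 as [Hm2|Hm2].
    - apply Rle_trans with (K * m * d).
      + apply Rmult_le_compat_r; [lra|]. apply HK. lra.
      + replace (K * m * d) with (K / c * (c * m * d)) by (field; lra).
        apply Rle_trans with (K / c * (2 * e)); [apply Rmult_le_compat_l; assumption|]. lra.
    - destruct (mvt_closed F1 F2 lo hi x1 x D2 ltac:(lra) ltac:(lra)) as [z [Hz [_ Ez]]].
      replace (F1 x) with (F1 x1 + F2 z * (x - x1)) by lra.
      apply Rle_trans with ((Rabs (F1 x1) + K * m * (r * d)) * d).
      + apply Rmult_le_compat_r; [lra|]. eapply Rle_trans; [apply Rabs_triang|].
        apply Rplus_le_compat_l. rewrite Rabs_mult, Hrd.
        apply Rmult_le_compat; auto using Rabs_pos; [apply HK; exact Hz|]. apply Rabs_le. lra.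
      + rewrite Rmult_plus_distr_r.
        replace (K * m * (r * d) * d) with (K / c * (c * m * d * d) * r) by (field; lra).
        assert (K / c * (c * m * d * d) * r <= K / c * (4 * e) * r).
        { apply Rmult_le_compat_r; [lra|]. apply Rmult_le_compat_l; assumption. }
        lra. }
  replace (F s) with (F s1 + F1 x * (s - s1)) by lra.
  eapply Rle_trans; [apply Rabs_triang|]. rewrite Rabs_mult.
  assert (Hss : Rabs (s - s1) <= d * r) by (rewrite Rmult_comm, Hrd; apply Rabs_le; lra).
  assert (Rabs (F1 x) * Rabs (s - s1) <= (2 + 4 * K / c) * e * r * r).
  { apply Rle_trans with (Rabs (F1 x) * (d * r)).
    - apply Rmult_le_compat_l; [apply Rabs_pos|exact Hss].
    - rewrite <- Rmult_assoc. apply Rmult_le_compat_r; lra. }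
  assert (e * 1 <= e * (r * r)).
  { apply Rmult_le_compat_l; [exact He|]. rewrite <- (Rmult_1_r 1). apply Rmult_le_compat; lra. }
  replace ((3 + 4 * K / c) * e * r ^ 2) with (e * (r * r) + (2 + 4 * K / c) * e * r * r) by ring.
  lra.
Qed.

Lemma taylor_of_second (F F1 F2 : R -> R) (lo hi K s t : R) :
  (forall s, lo <= s <= hi -> derivable_pt_lim F s (F1 s)) ->
  (forall s, lo <= s <= hi -> derivable_pt_lim F1 s (F2 s)) ->
  (forall s, lo <= s <= hi -> Rabs (F2 s) <= K) ->
  lo <= s <= hi -> lo <= t <= hi -> Rabs (F t - F s - F1 s * (t - s)) <= K * (t - s) ^ 2.
Proof.
  intros D1 D2 HK Hs Ht.
  destruct (mvt_closed F F1 lo hi s t D1 Hs Ht) as [x [Hx [Hx' E]]].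
  destruct (mvt_closed F1 F2 lo hi s x D2 Hs Hx) as [z [Hz [_ Ez]]].
  replace (F t - F s - F1 s * (t - s)) with (F2 z * (x - s) * (t - s)) by (rewrite E, <- Ez; ring).
  rewrite !Rabs_mult, <- (pow2_abs (t - s)).
  replace (K * Rabs (t - s) ^ 2) with (K * Rabs (t - s) * Rabs (t - s)) by ring.
  apply Rmult_le_compat_r; [apply Rabs_pos|].
  apply Rmult_le_compat; auto using Rabs_pos.
  unfold Rmin, Rmax in Hx'. destruct (Rle_dec s t).
  - rewrite !Rabs_pos_eq; lra.
  - rewrite !Rabs_left1; lra.
Qed.

Lemma derivable_of_deriv01 (f : R -> R) (s l : R) :
  0 < s < 1 -> deriv01 f s l -> derivable_pt_lim f s l.
Proof.
  intros Hs Hd eps Heps. destruct (Hd eps Heps) as [de [Hde H]].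
  assert (Hpos : 0 < Rmin de (Rmin s (1 - s))) by (repeat apply Rmin_glb_lt; lra).
  exists (mkposreal _ Hpos). intros h Hh0 Hh. simpl in Hh.
  assert (H1 : Rabs h < de) by (eapply Rlt_le_trans; [exact Hh|apply Rmin_l]).
  assert (H2 : Rabs h < s)
    by (eapply Rlt_le_trans; [exact Hh|]; eapply Rle_trans; [apply Rmin_r|apply Rmin_l]).
  assert (H3 : Rabs h < 1 - s)
    by (eapply Rlt_le_trans; [exact Hh|]; eapply Rle_trans; [apply Rmin_r|apply Rmin_r]).
  apply Rabs_def2 in H2. apply Rabs_def2 in H3.
  specialize (H (s + h)). replace (s + h - s) with h in H by ring.
  apply H; [unfold in01; lra|]. split; [apply Rabs_pos_lt; exact Hh0|exact H1].
Qed.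

Lemma cont01_of_deriv01 (f : R -> R) (s l : R) : deriv01 f s l -> cont01 f s.
Proof.
  intros Hd eps Heps. destruct (Hd 1 Rlt_0_1) as [de [Hde H]].
  assert (Hl : 0 < Rabs l + 1) by (pose proof (Rabs_pos l); lra).
  exists (Rmin de (eps / (Rabs l + 1))). split.
  { apply Rmin_glb_lt; [exact Hde|]. apply Rdiv_lt_0_compat; assumption. }
  intros x Hx Hxs.
  destruct (Req_dec x s) as [->|Hne]; [rewrite Rminus_diag, Rabs_R0; exact Heps|].
  assert (Hpos : 0 < Rabs (x - s)) by (apply Rabs_pos_lt; lra).
  assert (H1 : Rabs (x - s) < de) by (eapply Rlt_le_trans; [exact Hxs|apply Rmin_l]).
  assert (H2 : Rabs (x - s) < eps / (Rabs l + 1))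
    by (eapply Rlt_le_trans; [exact Hxs|apply Rmin_r]).
  specialize (H x Hx (conj Hpos H1)).
  replace (f x - f s) with ((f x - f s) / (x - s) * (x - s)) by (field; lra).
  rewrite Rabs_mult.
  assert (H3 : Rabs ((f x - f s) / (x - s)) <= Rabs l + 1).
  { replace ((f x - f s) / (x - s)) with (l + ((f x - f s) / (x - s) - l)) by ring.
    eapply Rle_trans; [apply Rabs_triang|]. lra. }
  apply Rle_lt_trans with ((Rabs l + 1) * Rabs (x - s)).
  - apply Rmult_le_compat_r; lra.
  - apply Rmult_lt_compat_l with (r := Rabs l + 1) in H2; [|exact Hl].
    replace ((Rabs l + 1) * (eps / (Rabs l + 1))) with eps in H2 by (field; lra). exact H2.
Qed.

Section LocalCurve.

Variables (x y x1 x2 y1 y2 : R -> R).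
Hypothesis Cx : C2_01 x x1 x2.
Hypothesis Cy : C2_01 y y1 y2.

(* Nondegeneracy at s0 makes, near s0, every combination A x + B y have a first or a second
   derivative comparable to |A| + |B|. *)
Lemma local_nondegenerate (s0 : R) :
  0 < s0 < 1 -> x1 s0 * y2 s0 - y1 s0 * x2 s0 <> 0 -> x1 s0 <> 0 ->
  exists h c K, 0 < h /\ 0 < c /\ 1 <= K /\ 0 < s0 - h /\ s0 + h < 1 /\
    forall s, s0 - h <= s <= s0 + h ->
      c <= Rabs (x1 s) /\ Rabs (x1 s) <= K /\ Rabs (x2 s) <= K /\ Rabs (y1 s) <= K /\
      Rabs (y2 s) <= K /\ forall A B,
      (c * (Rabs A + Rabs B) <= Rabs (A * x1 s0 + B * y1 s0) / 2 ->
        c * (Rabs A + Rabs B) <= Rabs (A * x1 s + B * y1 s)) /\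
      (c * (Rabs A + Rabs B) <= Rabs (A * x2 s0 + B * y2 s0) / 2 ->
        c * (Rabs A + Rabs B) <= Rabs (A * x2 s + B * y2 s)) /\
      (c * (Rabs A + Rabs B) <= Rabs (A * x1 s0 + B * y1 s0) / 2 \/
       c * (Rabs A + Rabs B) <= Rabs (A * x2 s0 + B * y2 s0) / 2).
Proof.
  intros Hs0 HD Hx1.
  set (D := x1 s0 * y2 s0 - y1 s0 * x2 s0) in *.
  set (W := 1 + Rabs (x1 s0) + Rabs (x2 s0) + Rabs (y1 s0) + Rabs (y2 s0)).
  pose proof (Rabs_pos (x2 s0)).
  pose proof (Rabs_pos (y1 s0)). pose proof (Rabs_pos (y2 s0)).
  assert (HDp : 0 < Rabs D) by (apply Rabs_pos_lt; exact HD).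
  assert (Hx1p : 0 < Rabs (x1 s0)) by (apply Rabs_pos_lt; exact Hx1).
  assert (HW : 1 <= W) by (unfold W; lra).
  set (c := Rmin (Rabs D / (4 * W)) (Rabs (x1 s0) / 2)).
  assert (Hc : 0 < c) by (apply Rmin_glb_lt; [apply Rdiv_lt_0_compat; lra|lra]).
  assert (Hc1 : c <= Rabs D / (4 * W)) by apply Rmin_l.
  assert (Hc2 : c <= Rabs (x1 s0) / 2) by apply Rmin_r.
  assert (Hin : in01 s0) by (unfold in01; lra).
  destruct (Cx s0 Hin) as [_ [Dx2 Kx2]]. destruct (Cy s0 Hin) as [_ [Dy2 Ky2]].
  apply cont01_of_deriv01 in Dx2. apply cont01_of_deriv01 in Dy2.
  destruct (Dx2 c Hc) as [h1 [Hh1 C1]]. destruct (Kx2 c Hc) as [h2 [Hh2 C2]].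
  destruct (Dy2 c Hc) as [h3 [Hh3 C3]]. destruct (Ky2 c Hc) as [h4 [Hh4 C4]].
  set (h := Rmin (Rmin (Rmin h1 h2) (Rmin h3 h4)) (Rmin s0 (1 - s0)) / 2).
  assert (Hh : 0 < h /\ h < h1 /\ h < h2 /\ h < h3 /\ h < h4 /\ h < s0 /\ h < 1 - s0).
  { unfold h.
    assert (0 < Rmin (Rmin (Rmin h1 h2) (Rmin h3 h4)) (Rmin s0 (1 - s0)))
      by (repeat apply Rmin_glb_lt; lra).
    pose proof (Rmin_l (Rmin (Rmin h1 h2) (Rmin h3 h4)) (Rmin s0 (1 - s0))).
    pose proof (Rmin_r (Rmin (Rmin h1 h2) (Rmin h3 h4)) (Rmin s0 (1 - s0))).
    pose proof (Rmin_l (Rmin h1 h2) (Rmin h3 h4)). pose proof (Rmin_r (Rmin h1 h2) (Rmin h3 h4)).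
    pose proof (Rmin_l h1 h2). pose proof (Rmin_r h1 h2).
    pose proof (Rmin_l h3 h4). pose proof (Rmin_r h3 h4).
    pose proof (Rmin_l s0 (1 - s0)). pose proof (Rmin_r s0 (1 - s0)). lra. }
  exists h, c, (W + c). split; [lra|]. split; [exact Hc|]. split; [lra|].
  split; [lra|]. split; [lra|].
  intros s Hs.
  assert (Hd : Rabs (s - s0) <= h) by (apply Rabs_le; lra).
  assert (His : in01 s) by (unfold in01; lra).
  specialize (C1 s His ltac:(lra)). specialize (C2 s His ltac:(lra)).
  specialize (C3 s His ltac:(lra)). specialize (C4 s His ltac:(lra)).
  assert (Hup : forall u v w, Rabs (u - v) < c -> Rabs v <= w -> Rabs u <= w + c).
  { intros u v w Huv Hv. replace u with (v + (u - v)) by ring.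
    eapply Rle_trans; [apply Rabs_triang|]. lra. }
  split.
  { pose proof (Rabs_triang_inv (x1 s0) (x1 s)) as Ht. rewrite Rabs_minus_sym in Ht. lra. }
  split; [apply (Hup _ (x1 s0)); [exact C1|unfold W; lra]|].
  split; [apply (Hup _ (x2 s0)); [exact C2|unfold W; lra]|].
  split; [apply (Hup _ (y1 s0)); [exact C3|unfold W; lra]|].
  split; [apply (Hup _ (y2 s0)); [exact C4|unfold W; lra]|].
  intros A B. pose proof (Rabs_pos A) as HA. pose proof (Rabs_pos B) as HB.
  assert (Hosc : forall u u0 v v0, Rabs (u - u0) < c -> Rabs (v - v0) < c ->
    Rabs (A * u0 + B * v0) - c * (Rabs A + Rabs B) <= Rabs (A * u + B * v)).
  { intros u u0 v v0 Hu Hv.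
    replace (A * u0 + B * v0) with ((A * u + B * v) + (- (A * (u - u0)) + - (B * (v - v0))))
      by ring.
    assert (Rabs (A * (u - u0)) <= Rabs A * c)
      by (rewrite Rabs_mult; apply Rmult_le_compat_l; lra).
    assert (Rabs (B * (v - v0)) <= Rabs B * c)
      by (rewrite Rabs_mult; apply Rmult_le_compat_l; lra).
    pose proof (Rabs_triang (A * u + B * v) (- (A * (u - u0)) + - (B * (v - v0)))).
    pose proof (Rabs_triang (- (A * (u - u0))) (- (B * (v - v0)))) as Ht.
    rewrite !Rabs_Ropp in Ht. lra. }
  split; [|split].
  - intros Hge. pose proof (Hosc (x1 s) (x1 s0) (y1 s) (y1 s0) C1 C3). lra.
  - intros Hge. pose proof (Hosc (x2 s) (x2 s0) (y2 s) (y2 s0) C2 C4). lra.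
  - set (F1 := A * x1 s0 + B * y1 s0). set (F2 := A * x2 s0 + B * y2 s0).
    assert (EA : Rabs A * Rabs D <= Rabs F1 * Rabs (y2 s0) + Rabs F2 * Rabs (y1 s0)).
    { rewrite <- !Rabs_mult.
      replace (A * D) with (F1 * y2 s0 + - (F2 * y1 s0)) by (unfold D, F1, F2; ring).
      eapply Rle_trans; [apply Rabs_triang|]. rewrite Rabs_Ropp. lra. }
    assert (EB : Rabs B * Rabs D <= Rabs F2 * Rabs (x1 s0) + Rabs F1 * Rabs (x2 s0)).
    { rewrite <- !Rabs_mult.
      replace (B * D) with (F2 * x1 s0 + - (F1 * x2 s0)) by (unfold D, F1, F2; ring).
      eapply Rle_trans; [apply Rabs_triang|]. rewrite Rabs_Ropp. lra. }
    pose proof (Rabs_pos F1) as PF1. 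
    set (M := Rmax (Rabs F1) (Rabs F2)).
    assert (M1 : Rabs F1 <= M) by apply Rmax_l. assert (M2 : Rabs F2 <= M) by apply Rmax_r.
    assert (HM : (Rabs A + Rabs B) * Rabs D <= M * W).
    { assert (Rabs F1 * Rabs (y2 s0) <= M * Rabs (y2 s0)) by (apply Rmult_le_compat_r; lra).
      assert (Rabs F2 * Rabs (y1 s0) <= M * Rabs (y1 s0)) by (apply Rmult_le_compat_r; lra).
      assert (Rabs F2 * Rabs (x1 s0) <= M * Rabs (x1 s0)) by (apply Rmult_le_compat_r; lra).
      assert (Rabs F1 * Rabs (x2 s0) <= M * Rabs (x2 s0)) by (apply Rmult_le_compat_r; lra).
      unfold W. lra. }
    assert (HcM : c * (Rabs A + Rabs B) <= M / 2).
    { apply Rle_trans with (Rabs D / (4 * W) * (Rabs A + Rabs B)).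
      - apply Rmult_le_compat_r; lra.
      - apply Rmult_le_reg_r with (4 * W); [lra|].
        replace (Rabs D / (4 * W) * (Rabs A + Rabs B) * (4 * W))
          with ((Rabs A + Rabs B) * Rabs D) by (field; lra).
        assert (0 <= M * W) by (apply Rmult_le_pos; lra). lra. }
    unfold M, Rmax in HcM. destruct (Rle_dec (Rabs F1) (Rabs F2)); [right|left]; exact HcM.
Qed.

Lemma local_nice (r1 r2 s0 : R) :
  0 < r1 -> 0 < r2 -> r1 + r2 = 1 -> r2 <= r1 ->
  0 < s0 < 1 -> x1 s0 * y2 s0 - y1 s0 * x2 s0 <> 0 -> x1 s0 <> 0 ->
  exists h, 0 < h /\ forall lo hi, s0 - h <= lo -> lo < hi -> hi <= s0 + h ->
    exists c1 C rho0 Q0, nice_curve r1 r2 x y x1 y1 lo hi c1 C rho0 Q0.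
Proof.
  intros Hr1 Hr2 Hr Hr12 Hs0 HD Hx1.
  destruct (local_nondegenerate s0 Hs0 HD Hx1)
    as [h [c [K [Hh [Hc [HK [Hlo [Hhi Hloc]]]]]]]].
  exists h. split; [exact Hh|]. intros lo hi Hl Hlh Hu.
  assert (Hsub : forall s, lo <= s <= hi -> s0 - h <= s <= s0 + h) by (intros; lra).
  assert (Hint : forall s, lo <= s <= hi -> 0 < s < 1) by (intros; lra).
  assert (Hin : forall s, lo <= s <= hi -> in01 s) by (intros s Hs; unfold in01; lra).
  assert (Dx : forall s, lo <= s <= hi -> derivable_pt_lim x s (x1 s))
    by (intros s Hs; apply derivable_of_deriv01; [auto|]; apply (Cx s (Hin s Hs))).
  assert (Dx1 : forall s, lo <= s <= hi -> derivable_pt_lim x1 s (x2 s))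
    by (intros s Hs; apply derivable_of_deriv01; [auto|]; apply (Cx s (Hin s Hs))).
  assert (Dy : forall s, lo <= s <= hi -> derivable_pt_lim y s (y1 s))
    by (intros s Hs; apply derivable_of_deriv01; [auto|]; apply (Cy s (Hin s Hs))).
  assert (Dy1 : forall s, lo <= s <= hi -> derivable_pt_lim y1 s (y2 s))
    by (intros s Hs; apply derivable_of_deriv01; [auto|]; apply (Cy s (Hin s Hs))).
  set (C := 3 + 4 * K / c).
  assert (HKc : 0 < 4 * K / c) by (apply Rdiv_lt_0_compat; lra).
  assert (Hgood : forall A B E a b e d s1 s2 s3 s4, lo <= a -> b <= hi -> 0 <= e -> 0 < d ->
    a <= s1 -> s1 + d <= s2 -> s2 + d <= s3 -> s3 + d <= s4 -> s4 <= b ->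
    Rabs (A * x s1 + B * y s1 + E) <= e -> Rabs (A * x s2 + B * y s2 + E) <= e ->
    Rabs (A * x s3 + B * y s3 + E) <= e -> Rabs (A * x s4 + B * y s4 + E) <= e ->
    Rabs A + Rabs B <= (2 / (c * d) + 4 / (c * d ^ 2)) * e /\
    forall s, a <= s <= b -> Rabs (A * x s + B * y s + E) <= C * e * ((b - a) / d) ^ 2).
  { intros A B E a b e d s1 s2 s3 s4 Ha Hb He Hd H1 H2 H3 H4 H5 G1 G2 G3 G4.
    apply (two_derivatives_good (fun s => A * x s + B * y s + E)
      (fun s => A * x1 s + B * y1 s) (fun s => A * x2 s + B * y2 s) lo hi)
      with (s1 := s1) (s2 := s2) (s3 := s3) (s4 := s4); try assumption; try lra.
    - intros s Hs. replace (A * x1 s + B * y1 s) with (A * x1 s + B * y1 s + 0) by ring.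
      apply (derivable_pt_lim_plus (fun s => A * x s + B * y s) (fun _ => E)).
      + apply (derivable_pt_lim_plus (fun s => A * x s) (fun s => B * y s)).
        * apply (derivable_pt_lim_scal x A s). auto.
        * apply (derivable_pt_lim_scal y B s). auto.
      + apply derivable_pt_lim_const.
    - intros s Hs. apply (derivable_pt_lim_plus (fun s => A * x1 s) (fun s => B * y1 s)).
      + apply (derivable_pt_lim_scal x1 A s). auto.
      + apply (derivable_pt_lim_scal y1 B s). auto.
    - intros s Hs. destruct (Hloc s (Hsub s Hs)) as [_ [B1 [B2 [B3 [B4 _]]]]].
      assert (Hup : forall u v, Rabs u <= K -> Rabs v <= K ->
        Rabs (A * u + B * v) <= K * (Rabs A + Rabs B)).
      { intros u v Hu' Hv'. eapply Rle_trans; [apply Rabs_triang|]. rewrite !Rabs_mult.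
        pose proof (Rmult_le_compat_l (Rabs A) _ _ (Rabs_pos A) Hu').
        pose proof (Rmult_le_compat_l (Rabs B) _ _ (Rabs_pos B) Hv'). lra. }
      split; apply Hup; assumption.
    - destruct (Hloc lo ltac:(lra)) as [_ [_ [_ [_ [_ Hdich]]]]].
      destruct (Hdich A B) as [_ [_ [Hd1|Hd2]]].
      + left. intros s Hs. destruct (Hloc s (Hsub s Hs)) as [_ [_ [_ [_ [_ Hs']]]]].
        apply (Hs' A B). exact Hd1.
      + right. intros s Hs. destruct (Hloc s (Hsub s Hs)) as [_ [_ [_ [_ [_ Hs']]]]].
        apply (Hs' A B). exact Hd2.
    - pose proof (Rabs_pos A). pose proof (Rabs_pos B). lra. }
  (* The four test points are [lo], [lo + d], [lo + 2 d] and [hi]. For [Q0 <= Q], an integer line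
     with values at most [1 / (2 Q)] there has [|A| + |B| <= 1 / 2], hence [A = B = 0], and then the
     constant term vanishes too. *)
  set (d := (hi - lo) / 3). 
  set (Q0 := 2 / (c * d) + 4 / (c * d ^ 2)).
  exists c, (C + K), (1 / 2), Q0.
  constructor; try lra.
  - unfold C. lra.
  - intros s t Hs Ht. destruct (mvt_closed x x1 lo hi s t Dx Hs Ht) as [z [Hz [_ ->]]].
    rewrite Rabs_mult. apply Rmult_le_compat_r; [apply Rabs_pos|]. apply (Hloc z (Hsub z Hz)).
  - intros s t Hs Ht. destruct (mvt_closed x x1 lo hi s t Dx Hs Ht) as [z [Hz [_ ->]]].
    rewrite Rabs_mult. apply Rmult_le_compat_r; [apply Rabs_pos|].
    destruct (Hloc z (Hsub z Hz)) as [_ [B1 _]]. unfold C. lra.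
  - intros s t Hs Ht. destruct (mvt_closed y y1 lo hi s t Dy Hs Ht) as [z [Hz [_ ->]]].
    rewrite Rabs_mult. apply Rmult_le_compat_r; [apply Rabs_pos|].
    destruct (Hloc z (Hsub z Hz)) as [_ [_ [_ [B3 _]]]]. unfold C. lra.
  - intros s Hs. destruct (Hloc s (Hsub s Hs)) as [B0 [B1 _]]. unfold C. lra.
  - intros s Hs. destruct (Hloc s (Hsub s Hs)) as [_ [_ [_ [B3 _]]]]. unfold C. lra.
  - intros s t Hs Ht. eapply Rle_trans; [apply (taylor_of_second x x1 x2 lo hi K); auto|].
    + intros z Hz. apply (Hloc z (Hsub z Hz)).
    + apply Rmult_le_compat_r; [apply pow2_ge_0|unfold C; lra].
  - intros s t Hs Ht. eapply Rle_trans; [apply (taylor_of_second y y1 y2 lo hi K); auto|].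
    + intros z Hz. apply (Hloc z (Hsub z Hz)).
    + apply Rmult_le_compat_r; [apply pow2_ge_0|unfold C; lra].
  - intros A B E a b e d' s1 s2 s3 s4 Ha Hb He Hd' H1 H2 H3 H4 H5 G1 G2 G3 G4 s Hs.
    destruct (Hgood A B E a b e d' s1 s2 s3 s4) as [_ Hg]; try assumption.
    eapply Rle_trans; [apply Hg; exact Hs|].
    apply Rmult_le_compat_r; [apply pow2_ge_0|]. apply Rmult_le_compat_r; lra.
  - intros Q [[A B] E] HQ HQ1 Hw. apply NNPP. intros Hn. apply Hw.
    assert (HPQ := Rpower_r1_r2 r1 r2 Hr Q ltac:(lra)).
    assert (Hall : forall s, lo <= s <= hi ->
      Rabs (IZR A * x s + IZR B * y s + IZR E) <= 1 / 2 / Q).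
    { intros s Hs.
      assert (Hle : wnorm (Rpower Q r1) (Rpower Q r2) (x s) (y s) (A, B, E) <= 1 / 2).
      { apply Rnot_lt_le. intros Hlt. apply Hn. exists s. tauto. }
      unfold wnorm in Hle. rewrite HPQ in Hle.
      pose proof (Rle_trans _ _ _ (Rmax_r _ _) Hle) as Hle'.
      rewrite Rabs_mult, (Rabs_pos_eq Q) in Hle' by lra.
      apply Rmult_le_reg_l with Q; [lra|].
      replace (Q * (1 / 2 / Q)) with (1 / 2) by (field; lra). exact Hle'. }
    assert (HeQ : 0 <= 1 / 2 / Q) by (apply Rdiv_nonneg; lra).
    destruct (Hgood (IZR A) (IZR B) (IZR E) lo hi (1 / 2 / Q) d lo (lo + d) (lo + 2 * d) hi)
      as [HAB _]; try lra; try (apply Hall); try (unfold d in *; lra).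
    assert (Hsmall : Rabs (IZR A) + Rabs (IZR B) <= 1 / 2).
    { eapply Rle_trans; [exact HAB|]. fold Q0.
      apply Rle_trans with (Q * (1 / 2 / Q)); [apply Rmult_le_compat_r; lra|].
      right. field. lra. }
    assert (Hz : forall k, Rabs (IZR k) <= 1 / 2 -> k = 0%Z).
    { intros k Hk. destruct (Z.eq_dec k 0) as [?|Hne]; [assumption|exfalso].
      assert (1 <= Rabs (IZR k)) by (apply Rabs_IZR_ge_1; lia). lra. }
    pose proof (Rabs_pos (IZR A)). pose proof (Rabs_pos (IZR B)).
    assert (EA : A = 0%Z) by (apply Hz; lra). assert (EB : B = 0%Z) by (apply Hz; lra).
    subst A B. specialize (Hall lo ltac:(lra)).
    rewrite !Rmult_0_l, !Rplus_0_l in Hall.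
    assert (1 / 2 / Q <= 1 / 2).
    { unfold Rdiv at 1. rewrite <- (Rmult_1_r (1 / 2)) at 2. apply Rmult_le_compat_l; [lra|].
      rewrite <- Rinv_1. apply Rinv_le_contravar; lra. }
    rewrite (Hz E) by lra. reflexivity.
Qed.

End LocalCurve.

(** A Lindelof argument: the grid intervals of mesh [1 / (n + 1)], over all n, are countably many,
    and each point of E lies in one that is short enough to meet E in a null set. *)
Lemma null_set_of_local (E : R -> Prop) :
  (forall s, E s -> 0 <= s) ->
  (forall s, E s -> exists h, 0 < h /\ forall lo hi, s - h <= lo -> lo < hi -> hi <= s + h ->
     null_set (fun t => E t /\ lo <= t <= hi)) ->
  null_set E.
Proof.
  intros Hpos Hloc.
  set (P := fun n k t => INR k / (INR n + 1) <= t <= (INR k + 1) / (INR n + 1)).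
  apply null_set_mono with (F := fun t => exists n k : nat, (E t /\ P n k t) /\
    null_set (fun t => E t /\ P n k t)).
  - apply null_set_countable_union. intros n. apply null_set_countable_union. intros k.
    destruct (classic (null_set (fun t => E t /\ P n k t))) as [H|H].
    + apply null_set_mono with (1 := H). tauto.
    + intros eps Heps. apply outer_le_empty; [lra|]. tauto.
  - intros s Hs. destruct (Hloc s Hs) as [h [Hh Hnull]]. specialize (Hpos s Hs).
    destruct (nat_above (/ h)) as [n Hn].
    assert (HN : 0 < INR n + 1) by (pose proof (pos_INR n); lra).
    assert (Hih : 0 < / h) by (apply Rinv_0_lt_compat; exact Hh).
    assert (HNh : / (INR n + 1) <= h).
    { rewrite <- (Rinv_inv h). apply Rinv_le_contravar; lra. }
    destruct (natfloor_spec (s * (INR n + 1))) as [K1 K2]; [apply Rmult_le_pos; lra|].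
    set (k := natfloor (s * (INR n + 1))) in *.
    assert (HPs : P n k s).
    { unfold P. split.
      - apply Rmult_le_reg_r with (INR n + 1); [exact HN|].
        rewrite Rdiv_mult_cancel by lra. lra.
      - apply Rmult_le_reg_r with (INR n + 1); [exact HN|].
        rewrite Rdiv_mult_cancel by lra. lra. }
    exists n, k. split; [tauto|]. unfold P in *.
    assert (0 < / (INR n + 1)) by (apply Rinv_0_lt_compat; exact HN).
    apply Hnull; lra.
Qed.

(** If the determinant vanished, the relations with coefficients [(c, - a)] and [(d, - b)] would
    make all four entries 0, and then [(1, 1)] would be a nontrivial relation. *)
Lemma lin_indep2_det (a b c d : R) : lin_indep2 (a, b) (c, d) -> a * d - b * c <> 0.
Proof.
  intros H E. unfold lin_indep2 in H. simpl in H.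
  destruct (H c (- a)) as [Hc Ha]; [ring|lra|].
  destruct (H d (- b)) as [Hd Hb]; [lra|ring|].
  destruct (H 1 1) as [H1 _]; lra.
Qed.

Lemma curve_improvable_null (r1 r2 : R) (x y x1 x2 y1 y2 : R -> R) :
  0 < r1 -> 0 < r2 -> r1 + r2 = 1 -> r2 <= r1 ->
  C2_01 x x1 x2 -> C2_01 y y1 y2 ->
  null_set (fun s => in01 s /\ ~ lin_indep2 (x1 s, y1 s) (x2 s, y2 s)) ->
  null_set (fun s => in01 s /\ DI_improvable r1 r2 (x s, y s)).
Proof.
  intros Hr1 Hr2 Hr Hr12 Cx Cy Hdeg.
  assert (Hmain : null_set (fun s => (0 < s < 1 /\ x1 s * y2 s - y1 s * x2 s <> 0 /\ x1 s <> 0)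
    /\ DI_improvable r1 r2 (x s, y s))).
  { apply null_set_of_local; [intros; lra|]. intros s [[Hs [HD Hx1]] _].
    destruct (local_nice x y x1 x2 y1 y2 Cx Cy r1 r2 s) as [h [Hh Hn]]; try assumption.
    exists h. split; [exact Hh|]. intros lo hi H1 H2 H3.
    destruct (Hn lo hi H1 H2 H3) as [c1 [C [rho0 [Q0 HC]]]].
    apply null_set_mono with
      (1 := nice_curve_improvable_null _ _ _ _ _ _ _ _ _ _ _ _ Hr1 Hr2 Hr HC). tauto. }
  (* The local estimates require [x1 s <> 0]. Where [x1] vanishes, linear independence forces
     [x2 s <> 0], so these points are isolated zeros of [x1]. *)
  assert (Hzero : null_set (fun s => 0 < s < 1 /\ x1 s = 0 /\ x2 s <> 0)).
  { apply null_set_of_local; [intros; lra|]. intros s [Hs [Hx1 Hx2]].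
    destruct (Cx s) as [_ [Hd _]]; [unfold in01; lra|].
    assert (Hp : 0 < Rabs (x2 s)) by (apply Rabs_pos_lt; exact Hx2).
    destruct (Hd (Rabs (x2 s)) Hp) as [de [Hde H]].
    exists (de / 2). split; [lra|]. intros lo hi H1 H2 H3.
    apply null_set_mono with (1 := null_set_point s).
    intros t [[Ht [Ht1 _]] Htt]. apply NNPP. intros Hne.
    assert (Habs : 0 < Rabs (t - s) < de).
    { split; [apply Rabs_pos_lt; lra|]. apply Rle_lt_trans with (de / 2); [|lra].
      apply Rabs_le. lra. }
    specialize (H t ltac:(unfold in01; lra) Habs). rewrite Ht1, Hx1, Rminus_diag in H.
    replace (0 / (t - s) - x2 s) with (- x2 s) in H by (field; lra).
    rewrite Rabs_Ropp in H. lra. }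
  apply null_set_mono with (1 := null_set_union _ _ Hdeg (null_set_union _ _
    (null_set_union _ _ (null_set_point 0) (null_set_point 1)) (null_set_union _ _ Hzero Hmain))).
  intros s [Hs HDI].
  destruct (classic (lin_indep2 (x1 s, y1 s) (x2 s, y2 s))) as [Hli|Hli]; [right|left; tauto].
  apply lin_indep2_det in Hli.
  destruct (Req_dec s 0) as [E|E]; [left; left; exact E|].
  destruct (Req_dec s 1) as [E1|E1]; [left; right; exact E1|]. right.
  assert (Hs' : 0 < s < 1) by (unfold in01 in Hs; lra).
  destruct (Req_dec (x1 s) 0) as [Ex|Ex]; [left|right; tauto].
  split; [exact Hs'|]. split; [exact Ex|]. intros Ex2. apply Hli. rewrite Ex, Ex2. ring.
Qed.

(** For [r1 < r2] the coordinates are exchanged; linear independence of the two derivatives does not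
    depend on their order. *)
Lemma curve_theorem (r1 r2 : R) (phi : R -> R * R) :
  0 < r1 -> 0 < r2 -> r1 + r2 = 1 -> nondegenerate phi ->
  null_set (fun s => in01 s /\ DI_improvable r1 r2 (phi s)).
Proof.
  intros Hr1 Hr2 Hr [x1 [x2 [y1 [y2 [Cx [Cy Hdeg]]]]]].
  destruct (Rle_lt_dec r2 r1) as [Hle|Hlt].
  - apply null_set_mono with (1 := curve_improvable_null r1 r2 _ _ x1 x2 y1 y2
      Hr1 Hr2 Hr Hle Cx Cy Hdeg).
    intros s. rewrite <- surjective_pairing. tauto.
  - apply null_set_mono with (F := fun s => in01 s /\ DI_improvable r2 r1 (snd (phi s), fst (phi s))).
    + apply (curve_improvable_null r2 r1 _ _ y1 y2 x1 x2); try assumption; try lra.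
      apply null_set_mono with (1 := Hdeg). intros s [Hs Hn]. split; [exact Hs|].
      intros Hli. apply Hn. intros a b E1 E2. exact (Hli a b E2 E1).
    + intros s [Hs HDI]. split; [exact Hs|]. apply DI_improvable_swap.
      rewrite <- surjective_pairing. exact HDI.
Qed.

Theorem theorem1p6 (r1 r2 : R) (hr1 : 0 < r1) (hr2 : 0 < r2) (hr : r1 + r2 = 1) :
  (* (i) line L = { a + t d : t in R }, d <> 0; length measure on L is the
     pushforward of (a multiple of) Lebesgue measure in t *)
  (forall (a d : R * R), d <> (0, 0) ->
     (exists t0 : R, badly_approximable r1 r2 (fst a + t0 * fst d, snd a + t0 * snd d)) ->
     null_set (fun t => ~ no_DI_improvement r1 r2 (fst a + t * fst d, snd a + t * snd d)))
  /\
  (* (ii) nondegenerate curves *)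
  (forall phi : R -> R * R, nondegenerate phi ->
     null_set (fun s => in01 s /\ ~ no_DI_improvement r1 r2 (phi s))).
Proof.
  split.
  - intros a d Hd [t0 Hba].
    apply null_set_mono with (1 := line_theorem r1 r2 a d t0 hr1 hr2 hr Hd Hba).
    intros t Ht. apply NNPP. exact Ht.
  - intros phi Hphi.
    apply null_set_mono with (1 := curve_theorem r1 r2 phi hr1 hr2 hr Hphi).
    intros s [Hs Ht]. split; [exact Hs|]. apply NNPP. exact Ht.
Qed.
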